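(* Consider the primal problem $$\min_{X\in\mathbb{X}}\ \Phi(X):=h(\mathcal{F}X)+\langle C,X\rangle+\theta(X)\quad\text{s.t.}\quad \mathcal{A}X\in b+\mathcal{Q},$$ where $\theta$ is a spectral function, either $\theta=g\circ\sigma$ with $g$ proper closed convex and absolutely symmetric, or (with $\mathbb{X}=\mathbb{S}^n$) $\theta=g\circ\lambda$ with $g$ proper closed convex and symmetric. Let $\overline{X}$ be an optimal solution of this problem with $\mathcal{M}_P(\overline{X})\ne\emptyset$. Assume that: (a) $h$ is twice continuously differentiable on $\mathrm{dom}\,h$; (b) $g$ is $\mathcal{C}^2$-cone reducible at $\sigma(\overline{X})$ (if $\theta=g\circ\sigma$), respectively at $\lambda(\overline{X})$ (if $\theta=g\circ\lambda$); (c) the ''no-gap'' second order sufficient condition holds at $\overline{X}$: for every $H\in\mathcal{C}_P(\overline{X})\setminus\{0\}$, $$\sup_{\bar y\in\mathcal{M}_P(\overline{X})}\Big\{\langle\mathcal{F}H,\nabla^2h(\mathcal{F}\overline{X})\mathcal{F}H\rangle-\phi^*_{(\overline{X},H)}\big(\mathcal{A}^*\bar y-C-\mathcal{F}^*\nabla h(\mathcal{F}\overline{X})\big)\Big\}>0,$$ where $\phi^*_{(\overline{X},H)}$ is the conjugate function of $\phi_{(\overline{X},H)}(\cdot):=\theta^{\downarrow\downarrow}_-(\overline{X};H,\cdot)$. Then $\overline{X}$ is the unique optimal solution of the primal problem, and the quadratic growth condition holds at $\overline{X}$: there exist constants $\delta_p>0$ and $\kappa_p>0$ such that $$\Phi(X)\ge\Phi(\overline{X})+\kappa_p\,\mathrm{dist}^2(X,\Omega_P)\qquad\forall\,X\in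 F_P\cap\mathbb{B}_{\delta_p}(\overline{X}).$$
   Context: Setting. $\mathbb{X}$ is either $\mathbb{R}^{n\times m}$ ($n\le m$) or the space $\mathbb{S}^n$ of real symmetric $n\times n$ matrices, with the trace inner product and the induced norm. $C\in\mathbb{X}$, $b\in\mathbb{R}^e$; $\mathcal{F}:\mathbb{X}\to\mathbb{R}^d$ and $\mathcal{A}:\mathbb{X}\to\mathbb{R}^e$ are linear with adjoints $\mathcal{F}^*,\mathcal{A}^*$; $h:\mathbb{R}^d\to(-\infty,+\infty]$ is convex and continuously differentiable on $\mathrm{dom}\,h$, which is a nonempty open convex set; $\theta:\mathbb{X}\to(-\infty,+\infty]$ is proper closed convex; $\mathcal{Q}\subseteq\mathbb{R}^e$ is a convex polyhedral cone with dual cone $\mathcal{Q}^*=\{y\mid\langle y,z\rangle\ge0\ \forall z\in\mathcal{Q}\}$. The dual problem is $\min_{(y,w,S)\in\mathbb{R}^e\times\mathbb{R}^d\times\mathbb{X}}\ \delta_{\mathcal{Q}^*}(y)-\langle b,y\rangle+h^*(-w)+\theta^*(-S)$ s.t. $\mathcal{A}^*y+\mathcal{F}^*w+S=C$ ($\delta$ denotes an indicator function, $^*$ on functions the conjugate). Standing assumption: the optimal solution sets $\Omega_P$ of the primal problem and $\Omega_D$ of the dual problem are nonempty. $F_P=\{X\in\mathbb{X}\mid\mathcal{A}X\in b+\mathcal{Q}\}$ is the primal feasible set. $\mathbb{B}_\rho(u)$ is the closed ball of radius $\rho$ centered at $u$, and $\mathrm{dist}$ is the Euclidean distance to a set. Spectral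 functions. $\sigma(X)$ is the vector of singular values of $X\in\mathbb{X}$, and $\lambda(X)$ the vector of eigenvalues of $X\in\mathbb{S}^n$, in non-increasing order. $g:\mathbb{R}^n\to(-\infty,+\infty]$ is symmetric (resp. absolutely symmetric) if $g(Qx)=g(x)$ for all $x$ and all permutation (resp. signed permutation) matrices $Q$. Multipliers. $\mathcal{M}_P(\overline{X})$ is the set of $\bar y\in\mathbb{R}^e$ such that $0\in C-\mathcal{A}^*\bar y+\mathcal{F}^*\nabla h(\mathcal{F}\overline{X})+\partial\theta(\overline{X})$ and $0\in\mathcal{A}\overline{X}-b+\mathcal{N}_{\mathcal{Q}^*}(\bar y)$, where $\mathcal{N}_{\mathcal{Q}^*}$ is the normal cone of convex analysis. Directional epiderivatives. For a proper closed convex function $p:\mathbb{U}\to(-\infty,+\infty]$, $u\in\mathrm{dom}\,p$: $p^{\downarrow}(u;d)=\liminf_{t\downarrow0,\,d'\to d}\frac{p(u+td')-p(u)}{t}$, and, when $p^\downarrow(u;d)$ is finite, $p^{\downarrow\downarrow}_-(u;d,w)=\liminf_{t\downarrow0,\,w'\to w}\frac{p(u+td+\frac12t^2w')-p(u)-t\,p^{\downarrow}(u;d)}{\frac12t^2}$. Critical cone. With the tangent cone $\mathcal{T}_D(u)=\{d\mid\exists\,u^k\to u,\ u^k\in D,\ t^k\downarrow0,\ (u^k-u)/t^k\to d\}$, $$\mathcal{C}_P(\overline{X})=\{H\in\mathbb{X}\mid\mathcal{A}H\in\mathcal{T}_{\mathcal{Q}}(\mathcal{A}\overline{X}-b),\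 H\in\mathcal{T}_{\mathrm{dom}\,\theta}(\overline{X}),\ \langle\mathcal{F}^*\nabla h(\mathcal{F}\overline{X})+C,H\rangle+\theta^{\downarrow}(\overline{X};H)=0\}.$$ $\mathcal{C}^2$-cone reducibility. A closed convex set $\mathcal{K}\subseteq\mathbb{V}$ is $\mathcal{C}^2$-cone reducible at $\bar v\in\mathcal{K}$ if there exist a Euclidean space $\mathbb{U}$, a pointed closed convex cone $\mathcal{R}\subseteq\mathbb{U}$ (i.e. $\mathcal{R}\cap(-\mathcal{R})=\{0\}$), an open neighborhood $\mathcal{W}$ of $\bar v$ and a twice continuously differentiable $\Xi:\mathcal{W}\to\mathbb{U}$ with $\Xi(\bar v)=0$, $\Xi'(\bar v)$ onto, and $\mathcal{K}\cap\mathcal{W}=\{v\in\mathcal{W}\mid\Xi(v)\in\mathcal{R}\}$. A proper closed convex function $p$ is $\mathcal{C}^2$-cone reducible at $u\in\mathrm{dom}\,p$ if $\mathrm{epi}\,p$ is $\mathcal{C}^2$-cone reducible at $(u,p(u))$. *)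

(* Defs.v *)
From HB Require Import structures.
From mathcomp Require Import all_boot all_order all_algebra perm.
From mathcomp Require Import all_classical all_reals all_analysis.

Set Implicit Arguments.
Unset Strict Implicit.
Unset Printing Implicit Defensive.

Import Order.TTheory GRing.Theory Num.Def Num.Theory.
Import numFieldNormedType.Exports.

Local Open Scope classical_set_scope.
Local Open Scope ring_scope.

(* The library norm of a matrix is the max norm, which only serves to define the
   topology.  The inner product carries the Euclidean norm [eucl_norm] below;
   [dot_norm] says that both norms induce the same topology (and makes [dot]
   positive definite). *)
HB.mixin Record NormedModule_isEuclidean (R : realType) V
    & NormedModule R V & Vector R V := {
  dot : V -> V -> R ;
  dotC : forall x y, dot x y = dot y x ;
  dot_linearl : forall y a x z, dot (a *: x + z) y = a * dot x y + dot z y ;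
  dot_norm : exists2 c : R, 0 < c &
    forall x, `|x| ^+ 2 <= c * dot x x /\ dot x x <= c * `|x| ^+ 2
}.

#[short(type="euclideanType")]
HB.structure Definition Euclidean (R : realType) :=
  {V of NormedModule R V & Vector R V & NormedModule_isEuclidean R V}.

Section MatrixEuclidean.
Variables (R : realType) (m n : nat).
Implicit Types A B : 'M[R]_(m, n).

Definition mxdot A B : R := \tr (A *m B^T).

Lemma mxdotE A B : mxdot A B = \sum_i \sum_j A i j * B i j.
Proof.
by apply: eq_bigr => i _; rewrite mxE; apply: eq_bigr => j _; rewrite mxE.
Qed.

Lemma mxdotC A B : mxdot A B = mxdot B A.
Proof.
by rewrite !mxdotE; apply: eq_bigr => i _; apply: eq_bigr => j _; rewrite mulrC.
Qed.

Lemma mxdot_linearl B a A A' : mxdot (a *: A + A') B = a * mxdot A B + mxdot A' B.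
Proof. by rewrite /mxdot mulmxDl -scalemxAl mxtraceD mxtraceZ. Qed.

Lemma mxdot_norm : exists2 c : R, 0 < c &
  forall A, `|A| ^+ 2 <= c * mxdot A A /\ mxdot A A <= c * `|A| ^+ 2.
Proof.
have entry A i j : `|A i j| <= `|A|.
  by rewrite [leRHS]/normr /= mx_normrE; apply: (le_bigmax _ _ (i, j)).
have dot_ge0 A : 0 <= mxdot A A.
  by rewrite mxdotE; do 2!apply: sumr_ge0 => ? _; rewrite -expr2 sqr_ge0.
exists (m * n).+1%:R => [|A]; first by rewrite ltr0n.
split.
- apply: (@le_trans _ _ (mxdot A A)); last first.
    by rewrite ler_peMl// ler1n.
  have [->|A0] := eqVneq `|A| 0; first by rewrite expr0n.
  have [[i j] /= Aij] := mx_norm_neq0 A0.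
  rewrite (_ : `|A| = `|A i j|) // real_normK ?num_real// mxdotE.
  rewrite (bigD1 i)//= (bigD1 j)//= -expr2 -addrA lerDl addr_ge0//.
    by apply: sumr_ge0 => ? _; rewrite -expr2 sqr_ge0.
  by do 2!apply: sumr_ge0 => ? _; rewrite -expr2 sqr_ge0.
- rewrite mxdotE (@le_trans _ _ (\sum_(i < m) \sum_(j < n) `|A| ^+ 2))//.
    apply: ler_sum => i _; apply: ler_sum => j _.
    by rewrite -expr2 -(real_normK (num_real _)) lerXn2r ?nnegrE.
  rewrite sumr_const card_ord sumr_const card_ord -mulrnA -[leLHS]mulr_natl.
  by rewrite ler_wpM2r ?sqr_ge0// ler_nat mulnC leqnSn.
Qed.

HB.instance Definition _ := NormedModule_isEuclidean.Build R 'M[R]_(m, n)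
  mxdotC mxdot_linearl mxdot_norm.

End MatrixEuclidean.

Section Symmetric.
Variables (R : realType) (n : nat).

Definition symspace : {vspace 'M[R]_n} := lker (linfun (fun A : 'M[R]_n => A^T - A)).

Lemma mem_symspace (A : 'M[R]_n) : (A \in symspace) = (A^T == A).
Proof.
have lf : linear (fun A : 'M[R]_n => A^T - A).
  by move=> a x y /=; apply/matrixP => i j; rewrite !mxE mulrBr opprD addrACA.
pose f : {linear 'M[R]_n -> 'M[R]_n} :=
  HB.pack (fun A : 'M[R]_n => A^T - A) (GRing.isLinear.Build R _ _ _ _ lf).
by rewrite memv_ker -[RHS]subr_eq0 (lfunE f).
Qed.

Definition symmx : Type := subvs_of symspace.

HB.instance Definition _ := Vector.on symmx.

Definition symnorm (A : symmx) : R := `|vsval A|.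

Lemma symnormD A B : symnorm (A + B) <= symnorm A + symnorm B.
Proof. by rewrite /symnorm linearD ler_normD. Qed.

Lemma symnormZ (a : R) A : symnorm (a *: A) = `|a| * symnorm A.
Proof. by rewrite /symnorm linearZ normrZ. Qed.

Lemma symnorm0_eq0 A : symnorm A = 0 -> A = 0.
Proof. by move=> /normr0_eq0 A0; apply: val_inj; rewrite /= A0. Qed.

HB.instance Definition _ :=
  Lmodule_isNormed.Build R symmx symnormD symnormZ symnorm0_eq0.

Definition symdot (A B : symmx) : R := mxdot (vsval A) (vsval B).

Lemma symdotC A B : symdot A B = symdot B A.
Proof. exact: mxdotC. Qed.

Lemma symdot_linearl B a A A' :
  symdot (a *: A + A') B = a * symdot A B + symdot A' B.
Proof. by rewrite /symdot linearP mxdot_linearl. Qed.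

Lemma symdot_norm : exists2 c : R, 0 < c &
  forall A : symmx, `|A| ^+ 2 <= c * symdot A A /\ symdot A A <= c * `|A| ^+ 2.
Proof.
have [c c0 cP] := mxdot_norm R n n.
by exists c => // A; exact: (cP (vsval A)).
Qed.

HB.instance Definition _ := NormedModule_isEuclidean.Build R symmx
  symdotC symdot_linearl symdot_norm.

End Symmetric.

Section EuclideanNotions.
Variables (R : realType) (V : euclideanType R).
Implicit Types (x y z : V) (D : set V) (p : V -> \bar R).

Definition eucl_norm x : R := Num.sqrt (dot x x).

Definition eucl_dist x D : R := inf [set eucl_norm (x - z) | z in D].

Definition dual_cone D : set V := [set y | forall z, D z -> 0 <= dot y z].

(* Empty when [y] is not in [D]. *)
Definition normal_cone D y : set V :=
  [set z | D y /\ forall y', D y' -> dot z (y' - y) <= 0].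

Definition subdifferential p x : set V :=
  [set z | p x \is a fin_num /\
           forall y, (p x + (dot z (y - x))%:E <= p y)%E].

Definition conjugate p y : \bar R :=
  ereal_sup (range (fun x => ((dot x y)%:E - p x)%E)).

End EuclideanNotions.

Definition is_adjoint (R : realType) (V W : euclideanType R)
    (L : V -> W) (Ladj : W -> V) : Prop :=
  forall x y, dot (L x) y = dot x (Ladj y).

Section ConvexAnalysis.
Variables (R : realType) (V : normedModType R).
Implicit Types (D : set V) (p : V -> \bar R) (u d w : V).

Definition effdom p : set V := [set x | (p x < +oo)%E].

Definition epi p : set (V * R^o) := [set z | (p z.1 <= z.2%:E)%E].

Definition indicator D (x : V) : \bar R := if x \in D then 0%E else +oo%E.

Definition proper_fun p : Prop := (forall x, p x != -oo%E) /\ effdom p !=set0.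

Definition proper_closed_convex p : Prop :=
  [/\ proper_fun p, closed (epi p) & convex_set (epi p)].

Definition cone D : Prop := forall (t : R) x, 0 < t -> D x -> D (t *: x).

Definition pointed_closed_convex_cone D : Prop :=
  [/\ closed D, convex_set D, cone D & D `&` [set - x | x in D] = [set 0]].

Definition tangent_cone D u : set V := [set d |
  exists (uk : nat -> V) (tk : nat -> R),
  [/\ forall k, D (uk k), forall k, 0 < tk k, uk @ \oo --> u,
      tk @ \oo --> (0 : R) & (fun k => (tk k)^-1 *: (uk k - u)) @ \oo --> d]].

Definition epiderivative p u d : \bar R :=
  limf_einf (fun z : R^o * V => (p (u + z.1 *: z.2)%R - p u) * (z.1^-1)%:E)%E
    (filter_prod (0 : R)^'+ (nbhs d)).

(* Only meaningful when [epiderivative p u d] is finite. *)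
Definition epiderivative2 p u d w : \bar R :=
  limf_einf (fun z : R^o * V =>
      (p (u + z.1 *: d + (z.1 ^+ 2 / 2) *: z.2)%R - p u
       - z.1%:E * epiderivative p u d) * ((z.1 ^+ 2 / 2)^-1)%:E)%E
    (filter_prod (0 : R)^'+ (nbhs w)).

End ConvexAnalysis.

(* Only used between finite-dimensional spaces, where continuity and
   differentiability of the derivative, as a map into linear maps, can be checked
   pointwise. *)

Section Smoothness.
Variables (R : realType) (V W : normedModType R).

Definition C1_on (A : set V) (f : V -> W) : Prop := forall x, A x ->
  differentiable f x /\ forall v, {for x, continuous (fun y => 'd f y v)}.

Definition C2_on (A : set V) (f : V -> W) : Prop :=
  C1_on A f /\ forall v, C1_on A (fun y => 'd f y v).

End Smoothness.

Section Gradient.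
Variables (R : realType) (d : nat) (f : 'rV[R]_d -> R^o).

(* The representer of ['d f x] for the inner product. *)
Definition grad (x : 'rV[R]_d) : 'rV[R]_d := \row_i 'd f x (delta_mx 0 i).

Definition hess (x v : 'rV[R]_d) : 'rV[R]_d := 'd grad x v.

End Gradient.

(* Any Euclidean space is isometric to some ['rV[R]_k]. *)
Definition C2_cone_reducible (R : realType) (V : normedModType R)
    (K : set V) (v : V) : Prop :=
  K v /\ exists (k : nat) (C : set 'rV[R]_k) (W : set V) (Xi : V -> 'rV[R]_k),
  [/\ pointed_closed_convex_cone C, open W /\ W v, C2_on W Xi,
      Xi v = 0 /\ (forall y, exists x, 'd Xi v x = y)
    & K `&` W = [set x | W x /\ C (Xi x)]].

Definition C2_cone_reducible_fun (R : realType) (V : normedModType R)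
    (p : V -> \bar R) (u : V) : Prop :=
  effdom p u /\ C2_cone_reducible (epi p) (u, fine (p u)).

(* Finite intersections of closed half-spaces bounded by hyperplanes through 0. *)
Definition polyhedral_cone (R : realType) (e : nat) (Q : set 'rV[R]_e) : Prop :=
  exists (k : nat) (B : 'M[R]_(e, k)),
    Q = [set z | forall j, 0 <= (z *m B) ord0 j].

Section Spectra.
Variables (R : realType) (n : nat).

Definition nonincreasing_row (v : 'rV[R]_n) : Prop :=
  forall i j : 'I_n, (i <= j)%N -> v ord0 j <= v ord0 i.

(* Defined when the characteristic polynomial splits over [R], in particular for
   symmetric matrices; multiplicities are counted. *)
Definition eigenvalues (A : 'M[R]_n) : 'rV[R]_n :=
  xget 0 [set v | nonincreasing_row v /\
                  char_poly A = \prod_i ('X - (v ord0 i)%:P)].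

Definition singular_values m (A : 'M[R]_(n, m)) : 'rV[R]_n :=
  map_mx Num.sqrt (eigenvalues (A *m A^T)).

Definition symmetric_fun (g : 'rV[R]_n -> \bar R) : Prop :=
  forall (s : 'S_n) x, g (x *m perm_mx s) = g x.

(* The two factors range over all signed permutation matrices, a class closed
   under transposition, so acting on row vectors from the right is no loss. *)
Definition absolutely_symmetric_fun (g : 'rV[R]_n -> \bar R) : Prop :=
  forall (eps : 'I_n -> bool) (s : 'S_n) x,
    g (x *m (diag_mx (\row_i (-1) ^+ eps i) *m perm_mx s)) = g x.

End Spectra.

(* The matrix space together with the kind of spectral function: singular values
   on n x m matrices with n <= m, or singular values or eigenvalues on symmetric
   n x n matrices. *)
Variant spectral_kind (n : nat) : Type :=
  | RectSingular m of (n <= m)%N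
  | SymSingular
  | SymEigen.
Arguments SymSingular {n}.
Arguments SymEigen {n}.

Section SpectralKind.
Variables (R : realType) (n : nat).

Definition matrix_space (k : spectral_kind n) : euclideanType R :=
  match k with
  | RectSingular m _ => 'M[R]_(n, m)
  | SymSingular | SymEigen => symmx R n
  end.

Definition spectrum (k : spectral_kind n) : matrix_space k -> 'rV[R]_n :=
  match k with
  | RectSingular m _ => fun X : 'M[R]_(n, m) => singular_values X
  | SymSingular => fun X : symmx R n => singular_values (vsval X)
  | SymEigen => fun X : symmx R n => eigenvalues (vsval X)
  end.

Definition spectral_symmetry (k : spectral_kind n) (g : 'rV[R]_n -> \bar R) :=
  match k with
  | RectSingular _ _ | SymSingular => absolutely_symmetric_fun g
  | SymEigen => symmetric_fun g
  end.

End SpectralKind.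

Section Problem.
Variables (R : realType) (d e : nat) (E : euclideanType R).
Variables (C : E) (b : 'rV[R]_e).
Variables (F : E -> 'rV[R]_d) (Fadj : 'rV[R]_d -> E).
Variables (A : E -> 'rV[R]_e) (Aadj : 'rV[R]_e -> E).
Variables (h : 'rV[R]_d -> \bar R) (theta : E -> \bar R) (Q : set 'rV[R]_e).

Definition primal_obj (X : E) : \bar R := (h (F X) + (dot C X)%:E + theta X)%E.

Definition primal_feasible : set E := [set X | exists2 z, Q z & A X = b + z].

(* Optimal solutions, here and for the dual, have a finite objective value. *)
Definition primal_solutions : set E :=
  [set X | [/\ primal_feasible X, (primal_obj X < +oo)%E &
    forall Y, primal_feasible Y -> (primal_obj X <= primal_obj Y)%E]].

Definition dual_obj (p : 'rV[R]_e * 'rV[R]_d * E) : \bar R :=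
  let: (y, w, Z) := p in
  (indicator (dual_cone Q) y - (dot b y)%:E
   + conjugate h (- w)%R + conjugate theta (- Z)%R)%E.

Definition dual_feasible : set ('rV[R]_e * 'rV[R]_d * E) :=
  [set p | let: (y, w, Z) := p in Aadj y + Fadj w + Z = C].

Definition dual_solutions : set ('rV[R]_e * 'rV[R]_d * E) :=
  [set p | [/\ dual_feasible p, (dual_obj p < +oo)%E &
    forall q, dual_feasible q -> (dual_obj p <= dual_obj q)%E]].

Definition grad_h (X : E) : 'rV[R]_d := grad (fine \o h) (F X).

Definition hess_h (X : E) : 'rV[R]_d -> 'rV[R]_d := hess (fine \o h) (F X).

Definition multipliers (X : E) : set 'rV[R]_e :=
  [set y | [set C - Aadj y + Fadj (grad_h X) + V | V in subdifferential theta X] 0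
        /\ [set A X - b + z | z in normal_cone (dual_cone Q) y] 0].

Definition critical_cone (X : E) : set E :=
  [set H | [/\ tangent_cone Q (A X - b) (A H), tangent_cone (effdom theta) X H &
    ((dot (Fadj (grad_h X) + C) H)%:E + epiderivative theta X H = 0)%E]].

Definition no_gap_SOSC (X : E) : Prop :=
  forall H, critical_cone X H -> H <> 0 ->
    (0 < ereal_sup [set ((dot (F H) (hess_h X (F H)))%:E
         - conjugate (epiderivative2 theta X H)
                     (Aadj y - C - Fadj (grad_h X))%R)%E | y in multipliers X])%E.

Definition quadratic_growth (X : E) : Prop :=
  exists delta kappa : R, [/\ 0 < delta, 0 < kappa &
    forall Y, primal_feasible Y -> eucl_norm (Y - X) <= delta ->
      (primal_obj X + (kappa * eucl_dist Y primal_solutions ^+ 2)%:E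
       <= primal_obj Y)%E].

End Problem.

(* Main.v *)
From HB Require Import structures.
Require Import Defs.
From mathcomp Require Import all_boot all_order all_algebra perm.
From mathcomp Require Import all_classical all_reals all_analysis.
From mathcomp Require Import ring lra.
Import Order.TTheory GRing.Theory Num.Theory.
Import numFieldNormedType.Exports.
Local Open Scope classical_set_scope.
Local Open Scope ring_scope.

(** Quadratic growth is proved by contradiction.  If it fails at [Xb], there are
    [t_i -> 0+] and directions [H_i -> H] with [<H, H> = 1] such that
    [Xb + t_i H_i] is feasible and its objective value is at most that of [Xb]
    plus [o(t_i^2)] ([feasible_sequence]).  Put [G = Fadj (grad h) + C] and
    [q = <F H, hess h (F H)>], derivatives being taken at [F Xb].  Taylor
    expansion of [h] gives, up to [o(t_i^2)] ([theta_upper]),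
      [theta (Xb + t_i H_i) <= theta Xb - t_i <G, H_i> - t_i^2/2 q].
    For a multiplier [y], the subgradient [V = Aadj y - G] of [theta] at [Xb]
    satisfies [<V, H_i> >= - <G, H_i>]; hence [H] is critical and the
    epiderivative of [theta] along [H] is [<V, H>] ([limit_critical]).  So
    [theta] grows along the sequence at most like [<V, .>] minus [t^2/2 q].  If
    the sequence can be replaced by parabolas, the second-order epiderivative of
    [theta] takes a value at most [<V, W> - q] (up to any error) at some [W], and
    its conjugate at [V] is at least [q], for every multiplier
    ([conjugate_ge]).  This contradicts the second-order condition.  Uniqueness
    follows from growth by convexity.

    The replacement by parabolas is the property [parabolically_regular], and
    the bulk of the file proves it for spectral functions [theta = g o lam].
    For sets that are cone reducible, second-order quotients along arbitrary
    sequences are close to second-order tangents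
    ([cone_reducible_second_order_regular], by solving [Xi = y] with a
    contraction); this applies to the epigraph of [g].  To pass from [g] to
    [theta], one diagonalizes.  Suppose that
    [theta X_i <= theta Xb + t_i <V, H_i> + c t_i^2/2] with [X_i = Xb + t_i H_i].
    Frames that diagonalize the [X_i], slightly perturbed towards [V], converge
    to a frame [P] that diagonalizes [Xb] and [V] simultaneously, and
    [H = P (k x + h)], where [x] and [v] are the spectra of [Xb] and [V], the
    generator [k] is an infinitesimal rotation, and
    [lam X_i = x + t_i h + o(t_i)] ([limiting_frame]).  The trace inequality of
    von Neumann, applied to [V] turned by [k], shows that
    [<V, X_i> + t_i^2/2 <k v, k x> <= <v, lam X_i>] up to [o(t_i^2)]
    ([trace_inequality_curve]), so the spectra [lam X_i] satisfy a bound on [g]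
    of the same kind with [c - <k v, k x>] in place of [c].  Regularity of the
    epigraph of [g] gives a parabola of spectra; lifted by [P] and the curve of
    rotations with velocity [k], it has the right velocity [H], and the term
    [<v, k k x> = - <k v, k x>] of its acceleration compensates the change of
    [c] ([spectral_parabolic_regular]).

    Eigenvalues of symmetric matrices and singular values of rectangular ones
    are treated at once, as decompositions along the orbits of a compact group
    ([spectral_system]), whose existence is proved by maximizing a linear
    functional over an orbit ([spectral_decomposition]). *)

Set Implicit Arguments.
Unset Strict Implicit.
Unset Printing Implicit Defensive.

(** * Linear combinations in a module *)

Section LinearCombinations.
Variables (R : comPzRingType) (V : lmodType R).

(** Formal linear combinations of atoms: an identity in a module is proved by
    comparing, atom by atom, the coefficients of its two sides, which turns it
    into identities between scalars. *)
Inductive lexp :=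
  LVar of nat | LZero | LAdd of lexp & lexp | LOpp of lexp | LScale of R & lexp.

Fixpoint leval (s : seq V) (u : lexp) : V :=
  match u with
  | LVar i => nth 0 s i
  | LZero => 0
  | LAdd u1 u2 => leval s u1 + leval s u2
  | LOpp u1 => - leval s u1
  | LScale a u1 => a *: leval s u1
  end.

Fixpoint lcoef (i : nat) (u : lexp) : R :=
  match u with
  | LVar j => if eqn i j then 1 else 0
  | LZero => 0
  | LAdd u1 u2 => lcoef i u1 + lcoef i u2
  | LOpp u1 => - lcoef i u1
  | LScale a u1 => a * lcoef i u1
  end.

Lemma levalE s u : leval s u = \sum_(i < size s) lcoef i u *: s`_i.
Proof.
elim: u => [j||u1 IH1 u2 IH2|u1 IH1|a u1 IH1] /=.
- have [js|js] := ltnP j (size s).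
    rewrite (bigD1 (Ordinal js))//= eqnE eqxx scale1r big1 ?addr0// => i.
    by rewrite -val_eqE -[RHS](scale0r s`_i) => /negPf /= ->.
  rewrite nth_default// big1// => i _; rewrite eqnE ltn_eqF ?scale0r//.
  exact: leq_trans js.
- by rewrite big1// => i _; rewrite scale0r.
- by rewrite IH1 IH2 -big_split; apply: eq_bigr => i _; rewrite scalerDl.
- by rewrite IH1 -sumrN; apply: eq_bigr => i _; rewrite scaleNr.
- by rewrite IH1 scaler_sumr; apply: eq_bigr => i _; rewrite scalerA.
Qed.

Fixpoint same_coefs (u1 u2 : lexp) (n : nat) : Prop :=
  match n with
  | 0 => True
  | n'.+1 => same_coefs u1 u2 n' /\ lcoef n' u1 = lcoef n' u2
  end.

Lemma same_coefs_eq s u1 u2 :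
  same_coefs u1 u2 (size s) -> leval s u1 = leval s u2.
Proof.
move=> H; rewrite !levalE; apply: eq_bigr => -[i /= +] _.
move: (size s) H => n; elim: n => [//|n IH] [H E]; rewrite ltnS leq_eqVlt.
by move=> /predU1P[->|/IH ->//]; rewrite E.
Qed.

End LinearCombinations.

(** Equal atoms that come from different lemmas may reach the same operation by
    different instances, so they are identified up to conversion; comparing last
    arguments first makes the failing comparisons cheap. *)
Ltac lsame x y :=
  first [constr_eq x y
        | lazymatch x with ?f ?a =>
            lazymatch y with ?g ?b => unify a b; unify x y end
          end].
Ltac lmember x l :=
  lazymatch l with
  | nil => constr:(false)
  | ?y :: ?r => match goal with
                | _ => let _ := match goal with _ => lsame x y end in
                       constr:(true)
                | _ => lmember x r
                end
  end.
Ltac latoms u l :=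
  lazymatch u with
  | GRing.add ?a ?b => let l1 := latoms a l in latoms b l1
  | GRing.opp ?a => latoms a l
  | GRing.scale _ ?a => latoms a l
  | GRing.zero => l
  | _ => lazymatch lmember u l with
         | true => l
         | false => constr:(u :: l)
         end
  end.
Ltac lindex x l :=
  lazymatch l with
  | ?y :: ?r => match goal with
                | _ => let _ := match goal with _ => lsame x y end in
                       constr:(0%N)
                | _ => let i := lindex x r in constr:(i.+1)
                end
  end.
Ltac lreify R u l :=
  lazymatch u with
  | GRing.add ?a ?b =>
      let a1 := lreify R a l in let b1 := lreify R b l in
      constr:(@LAdd R a1 b1)
  | GRing.opp ?a => let a1 := lreify R a l in constr:(@LOpp R a1)
  | GRing.scale ?c ?a => let a1 := lreify R a l in constr:(@LScale R c a1)
  | GRing.zero => constr:(@LZero R)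
  | _ => let i := lindex u l in constr:(@LVar R i)
  end.
(** Leaves one scalar equation per atom, to be closed by [ring] or [field]. *)
Ltac lincomb_coefs R :=
  lazymatch goal with
  | |- @eq ?T ?u ?v =>
    let l0 := constr:(@nil T) in
    let l1 := latoms u l0 in let l := latoms v l1 in
    let u' := lreify R u l in let v' := lreify R v l in
    change (leval l u' = leval l v'); apply: same_coefs_eq;
    cbn [same_coefs lcoef size eqn]; repeat split
  end.
Ltac lincomb R := lincomb_coefs R; ring.

(** * Expansions of functions of several variables *)

Section Differential.
Variable R : realType.

(** The mean value theorem for [s |-> f (x + s *: y) - b * s ^+ 2 / 2].  With
    [b] the value of a quadratic form at [y], the right-hand side is an error of
    second order as soon as ['d f] has a first-order expansion. *)
Lemma mean_value_diff_quadratic (V : normedModType R) (f : V -> R^o) (x y : V) (b : R) :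
  (forall s : R, 0 <= s <= 1 -> differentiable f (x + s *: y)) ->
  exists2 s : R, 0 <= s <= 1 &
    f (x + y) - f x - b / 2 = 'd f (x + s *: y) y - s * b.
Proof.
move=> df; pose phi (s : R) : R := f (x + s *: y).
have dphi (s : R) : 0 <= s <= 1 -> is_derive s 1 phi ('d f (x + s *: y) y).
  move=> s01.
  have dl : is_diff s (fun s : R^o => x + s *: y) (fun s : R^o => s *: y).
    have -> : (fun s : R^o => x + s *: y) = cst x + ( *:%R^~ y) by [].
    by apply: is_diff_eq; rewrite add0r.
  have dphis : differentiable (phi : R^o -> R^o) s.
    apply: (@differentiable_comp _ _ _ _ (fun s : R^o => x + s *: y) f) => //.
    exact: df.
  apply: DeriveDef; first exact: diff_derivable.
  rewrite deriveE//.
  rewrite (_ : phi = f \o (fun s : R^o => x + s *: y))//.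
  by rewrite diff_comp//=; [rewrite diff_val scale1r | exact: df].
pose psi : R -> R := phi - (b / 2) \*: (@id R) ^+ 2.
have dpsi (s : R) : 0 <= s <= 1 ->
    is_derive s 1 psi ('d f (x + s *: y) y - s * b).
  move=> /dphi ds_; rewrite /psi; apply: is_derive_eq.
  by rewrite expr1 /GRing.scale/= mulr1; field.
have [||s s01 E] := @MVT_segment R psi
    (fun s => 'd f (x + s *: y) y - s * b) 0 1 ler01.
- move=> s; rewrite in_itv/= => /andP[s0 s1]; apply: dpsi.
  by rewrite !ltW.
- apply: derivable_within_continuous => s; rewrite in_itv/= => s01.
  by have [] := dpsi s s01.
exists s; first by move: s01; rewrite in_itv.
have p1 : psi 1 = f (x + y) - b / 2.
  by change (f (x + 1 *: y) - b / 2 * (1 * 1) = f (x + y) - b / 2 :> R);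
     rewrite scale1r !mulr1.
have p0 : psi 0 = f x.
  by change (f (x + 0 *: y) - b / 2 * (0 * 0) = f x :> R);
     rewrite scale0r !mulr0 subr0 addr0.
by rewrite -[RHS]mulr1 -[in RHS](subr0 1) -E p1 p0; ring.
Qed.

Lemma mean_value_diff (V : normedModType R) (f : V -> R^o) (x y : V) :
  (forall s : R, 0 <= s <= 1 -> differentiable f (x + s *: y)) ->
  exists2 s : R, 0 <= s <= 1 & f (x + y) - f x = 'd f (x + s *: y) y.
Proof.
move=> /(@mean_value_diff_quadratic _ f x y 0)[s s01 E]; exists s => //.
by move: E; rewrite mul0r mulr0 !subr0.
Qed.

Lemma diff_near (V W : normedModType R) (f : V -> W) (x : V) :
  differentiable f x -> forall eps : R, 0 < eps ->
  \forall y \near 0, `|f (x + y) - f x - 'd f x y| <= eps * `|y|.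
Proof.
move=> df eps e0; have := diff_locallyx df => E.
near=> y; rewrite [x + y]addrC E.
set o := (X in _ + X - _ - _).
have -> : f x + 'd f x y + o - f x - 'd f x y = o by lincomb R.
rewrite {}/o; by near: y; apply: littleoP.
Unshelve. all: by end_near. Qed.

(** Derivatives are only known to be regular direction by direction; a finite
    family of coordinates makes such statements uniform in the direction. *)
Definition coordinates (V : normedModType R) (I : finType) (e : I -> V)
    (c : I -> V -> R^o) :=
  [/\ forall v, v = \sum_i c i v *: e i, forall i v, `|c i v| <= `|v| &
      forall i, continuous (c i)].

Lemma coordinates_diff (V : normedModType R) (I : finType) (e : I -> V)
    (c : I -> V -> R^o) (f : V -> R^o) (x v : V) :
  coordinates e c -> 'd f x v = \sum_i c i v * 'd f x (e i).
Proof.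
move=> [ce _ _]; rewrite {1}[v]ce linear_sum /=.
by apply: eq_bigr => i _; rewrite linearZ.
Qed.

(** Taylor expansion from first-order expansions [L i] of the partial
    derivatives: in the mean value formula, each coordinate of [y] is multiplied
    by an error [o(|y|)]. *)
Lemma taylor2 (V : normedModType R) (I : finType) (e : I -> V)
    (c : I -> V -> R^o) (f : V -> R^o) (x : V) (L : I -> V -> R) :
  coordinates e c ->
  (\forall z \near x, differentiable f z) ->
  (forall i (s : R) v, L i (s *: v) = s * L i v) ->
  (forall i (eps : R), 0 < eps -> \forall y \near 0,
     `|'d f (x + y) (e i) - 'd f x (e i) - L i y| <= eps * `|y|) ->
  forall eps : R, 0 < eps -> \forall y \near 0,
    `|f (x + y) - f x - 'd f x y - (\sum_i c i y * L i y) / 2|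
    <= eps * `|y| ^+ 2.
Proof.
move=> cec df LZ ddf eps e0.
have [_ cb _] := cec; pose m : R := (#|I|.+1)%:R.
have m0 : 0 < m by rewrite ltr0n.
pose P y := forall i,
  `|'d f (x + y) (e i) - 'd f x (e i) - L i y| <= eps / m * `|y|.
have nP : \forall y \near (0 : V), P y.
  by apply: filter_forall => i; apply: ddf; rewrite divr_gt0.
have nD : \forall y \near (0 : V), differentiable f (x + y).
  by move: df; rewrite nbhs0P.
have [d /= d0 dP] : nbhs_ball (0 : V) (P `&` [set y | differentiable f (x + y)]).
  by rewrite nbhs_ballE; apply: filterI.
near=> y.
have yd (s : R) : 0 <= s <= 1 -> ball (0 : V) d (s *: y).
  move=> /andP[s0 s1]; rewrite -ball_normE /= sub0r normrN normrZ ger0_norm//.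
  apply: le_lt_trans (_ : `|y| < d); first by rewrite ler_piMl.
  by near: y; apply: nbhs0_lt.
set b := \sum_i _.
have [|s s01 E] := @mean_value_diff_quadratic V f x y b.
  by move=> s /yd /dP [].
have -> : f (x + y) - f x - 'd f x y - b / 2 =
    'd f (x + s *: y) y - 'd f x y - s * b by rewrite -addrA addrCA E; ring.
have [/= Ps _] := dP _ (yd _ s01).
have -> : 'd f (x + s *: y) y - 'd f x y - s * b = \sum_i c i y *
  ('d f (x + s *: y) (e i) - 'd f x (e i) - L i (s *: y)).
  rewrite (coordinates_diff f (x + s *: y) y cec) (coordinates_diff f x y cec).
  rewrite mulr_sumr -!sumrB.
  apply: eq_bigr => i _; rewrite LZ; ring.
apply: le_trans (ler_norm_sum _ _ _) _.
apply: (@le_trans _ _ (\sum_(i : I) (eps / m * `|y| ^+ 2))).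
  apply: ler_sum => i _; rewrite normrM.
  apply: le_trans (ler_pM _ _ (cb i y) (Ps i)) _ => //.
  rewrite normrZ mulrCA; apply: ler_wpM2l; first by rewrite divr_ge0 ?ltW.
  rewrite mulrCA expr2 ler_piMl ?mulr_ge0//.
  by move/andP: s01 => [s0 s1]; rewrite ger0_norm.
rewrite sumr_const -mulr_natl mulrA ler_wpM2r ?sqr_ge0//.
rewrite mulrA ler_pdivrMr// mulrC ler_wpM2l ?ltW// /m ltr_nat.
by [].
Unshelve. all: by end_near. Qed.

(** Apply the mean value theorem on the segment from [z] to [y], where the
    partial derivatives are uniformly close to those at [x]. *)
Lemma strict_diff (V : normedModType R) (I : finType) (e : I -> V)
    (c : I -> V -> R^o) (f : V -> R^o) (x : V) :
  coordinates e c ->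
  (\forall z \near x, differentiable f z) ->
  (forall v, {for x, continuous (fun z => 'd f z v : R^o)}) ->
  forall eps : R, 0 < eps -> exists2 r : R, 0 < r &
    forall y z, `|y - x| < r -> `|z - x| < r ->
      `|f y - f z - 'd f x (y - z)| <= eps * `|y - z|.
Proof.
move=> cec df cdf eps e0.
have [_ cb _] := cec; pose m : R := (#|I|.+1)%:R.
have m0 : 0 < m by rewrite ltr0n.
pose P z := forall i, `|'d f z (e i) - 'd f x (e i)| <= eps / m.
have nP : \forall z \near x, P z.
  apply: filter_forall => i.
  have em : 0 < eps / m by rewrite divr_gt0.
  have /cvgrPdist_le/(_ _ em) := cdf (e i).
  by apply: filterS => z; rewrite distrC.
have [d /= d0 dP] : nbhs_ball x (P `&` [set y | differentiable f y]).
  by rewrite nbhs_ballE; apply: filterI.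
exists d => // y z yd zd.
have sd (s : R) : 0 <= s <= 1 -> ball x d (z + s *: (y - z)).
  move=> /andP[s0 s1]; rewrite -ball_normE /= distrC.
  have -> : z + s *: (y - z) - x = (1 - s) *: (z - x) + s *: (y - x).
    by lincomb R.
  apply: le_lt_trans (ler_normD _ _) _; rewrite !normrZ !ger0_norm ?subr_ge0//.
  have [->|s0'] := eqVneq s 0; first by rewrite subr0 mul0r addr0 mul1r.
  have h1 : 0 <= (1 - s) * (d - `|z - x|) by rewrite mulr_ge0 ?subr_ge0// ltW.
  have h2 : 0 < s * (d - `|y - x|) by rewrite mulr_gt0 ?subr_gt0// lt0r s0'.
  by nra.
have [|s s01 E] := @mean_value_diff V f z (y - z).
  by move=> s /sd /dP [].
move: E; rewrite [z + _]addrC subrK => ->.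
have [/= Ps _] := dP _ (sd _ s01).
have -> : 'd f (z + s *: (y - z)) (y - z) - 'd f x (y - z) =
  \sum_i c i (y - z) * ('d f (z + s *: (y - z)) (e i) - 'd f x (e i)).
  rewrite (coordinates_diff f (z + s *: (y - z)) _ cec) (coordinates_diff f x _ cec).
  by rewrite -!sumrB; apply: eq_bigr => i _; rewrite mulrBr.
apply: le_trans (ler_norm_sum _ _ _) _.
apply: (@le_trans _ _ (\sum_(i : I) (eps / m * `|y - z|))).
  apply: ler_sum => i _; rewrite normrM mulrC.
  by apply: ler_pM => //; exact: Ps.
rewrite sumr_const -mulr_natl mulrA ler_wpM2r// mulrA ler_pdivrMr// mulrC.
by rewrite ler_wpM2l ?ltW// /m ltr_nat.
Qed.

Lemma row_norm_le k (v : 'rV[R]_k) (r : R) :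
  0 <= r -> (forall j, `|v 0 j| <= r) -> `|v| <= r.
Proof.
move=> r0 vr; rewrite [leLHS]/Num.norm /= mx_normrE.
apply: bigmax_le => //= -[i j] _ /=; rewrite ord1; exact: vr.
Qed.

Lemma row_entry_le k (v : 'rV[R]_k) j : `|v 0 j| <= `|v|.
Proof.
by rewrite [leRHS]/Num.norm /= mx_normrE; apply: (le_bigmax _ _ (0, j)).
Qed.

Lemma row_coordinates k :
  coordinates (fun j : 'I_k => delta_mx 0 j : 'rV[R]_k) (fun j v => v 0 j).
Proof.
split=> [v|j v|j v]; first exact: row_sum_delta.
- exact: row_entry_le.
- exact: differentiable_continuous (differentiable_coord _ _ _).
Qed.

(** The coordinates of the space that contains the epigraphs of functions of
    row vectors. *)
Lemma row_pair_coordinates k :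
  coordinates
    (fun j : 'I_k + 'I_1 => if j is inl i then (delta_mx 0 i, 0)
                            else (0, 1) : 'rV[R]_k * R^o)
    (fun j v => if j is inl i then v.1 0 i else v.2).
Proof.
split=> [[v r]|[i|i] [v r]|[i|i] v] /=.
- rewrite big_sumType big_ord1 /=.
  have -> : \sum_(i < k) v 0 i *: (delta_mx 0 i, 0) = (v, 0) :> 'rV[R]_k * R^o.
    rewrite [in RHS](row_sum_delta v); apply: injective_projections => /=.
      by rewrite raddf_sum.
    by rewrite raddf_sum big1//= => i _; rewrite scaler0.
  by apply: injective_projections;
    rewrite /= ?scaler0 ?add0r ?addr0 ?/GRing.scale/= ?mulr1.
- by rewrite le_max row_entry_le.
- by rewrite le_max lexx orbT.
- apply: (@continuous_comp _ _ _ fst (fun w : 'rV[R]_k => w 0 i : R^o)).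
    exact: cvg_fst.
  exact: differentiable_continuous (differentiable_coord _ _ _).
- exact: cvg_snd.
Qed.

Lemma diff_entry (V : normedModType R) k (Xi : V -> 'rV[R]_k) x j :
  differentiable Xi x ->
  differentiable (fun z => Xi z 0 j : R^o) x /\
  forall v, 'd (fun z => Xi z 0 j : R^o) x v = 'd Xi x v 0 j.
Proof.
move=> dX; have dc := @differentiable_coord R 1 k (Xi x) 0 j.
split=> [|v]; first exact: (@differentiable_comp _ _ _ _ Xi (fun w => w 0 j)).
rewrite (_ : (fun z => Xi z 0 j) = (fun w : 'rV[R]_k => w 0 j : R^o) \o Xi)//.
rewrite diff_comp//=.
have lc : linear (fun w : 'rV[R]_k => w 0 j : R^o).
  by move=> a u w; rewrite !mxE.
pose lw := GRing.isLinear.Build R _ _ _ _ lc.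
pose l : {linear 'rV[R]_k -> R^o} := HB.pack (fun w : 'rV[R]_k => w 0 j : R^o) lw.
by rewrite (@diff_lin _ _ _ l)// => w; exact: differentiable_continuous (differentiable_coord _ _ _).
Qed.

Section RowValued.
Variables (V : normedModType R) (I : finType) (e : I -> V) (c : I -> V -> R^o).
Hypothesis cec : coordinates e c.
Variables (k : nat) (Xi : V -> 'rV[R]_k) (W : set V) (x : V).
Hypotheses (oW : open W) (Wx : W x) (XiC2 : C2_on W Xi).

(** The second derivative of [Xi] at [x] in the direction [(y, y)]. *)
Definition hessian_form (y : V) : 'rV[R]_k :=
  \sum_i c i y *: 'd (fun z => 'd Xi z (e i)) x y.

Let nW : \forall z \near x, W z. Proof. exact: open_nbhs_nbhs. Qed.

Lemma taylor2_row (eps : R) : 0 < eps -> \forall y \near 0,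
  `|Xi (x + y) - Xi x - 'd Xi x y - 2^-1 *: hessian_form y|
  <= eps * `|y| ^+ 2.
Proof.
move=> e0; have [C1 C2] := XiC2.
suff H (j : 'I_k) : \forall y \near 0, `|Xi (x + y) 0 j - Xi x 0 j - 'd Xi x y 0 j
      - (\sum_i c i y * 'd (fun z => 'd Xi z (e i)) x y 0 j) / 2|
      <= eps * `|y| ^+ 2.
  have {}H := filter_forall (@nbhs_filter _ _) H.
  apply: filterS H => y H; apply: row_norm_le => [|j].
    by rewrite mulr_ge0 ?sqr_ge0// ltW.
  move: (H j); rewrite !mxE summxE [_^-1 * _]mulrC.
  by congr (`| _ - _ / _ | <= _); apply: eq_bigr => i _; rewrite !mxE.
have dX : differentiable Xi x by have [] := C1 x Wx.
have [_ dXE] := diff_entry j dX.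
have := @taylor2 V I e c (fun z => Xi z 0 j) x
  (fun i y => 'd (fun z => 'd Xi z (e i)) x y 0 j) cec.
move=> T; suff : \forall y \near 0, `|Xi (x + y) 0 j - Xi x 0 j
    - 'd (fun z => Xi z 0 j : R^o) x y
    - (\sum_i c i y * 'd (fun z => 'd Xi z (e i)) x y 0 j) / 2|
    <= eps * `|y| ^+ 2 by apply: filterS => y; rewrite dXE.
apply: T => //.
- apply: filterS nW => z Wz; have [dXz _] := C1 z Wz.
  by have [] := diff_entry j dXz.
- by move=> i s v; rewrite linearZ /= mxE.
- move=> i r r0.
  have [ddX _] := C2 (e i) x Wx.
  have nW0 : \forall y \near (0 : V), W (x + y) by move: nW; rewrite nbhs0P.
  apply: filterS2 nW0 (diff_near ddX r0) => y Wy.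
  apply: le_trans; have [dXy _] := C1 _ Wy.
  have [_ ->] := diff_entry j dXy.
  by apply: le_trans (row_entry_le _ j); rewrite !mxE dXE.
Qed.

Lemma strict_diff_row (eps : R) : 0 < eps -> exists2 r : R, 0 < r &
  forall y z, `|y - x| < r -> `|z - x| < r ->
    `|Xi y - Xi z - 'd Xi x (y - z)| <= eps * `|y - z|.
Proof.
move=> e0; have [C1 _] := XiC2.
have dX : differentiable Xi x by have [] := C1 x Wx.
suff H (j : 'I_k) : \forall r \near 0^'+, forall y z, `|y - x| < r ->
    `|z - x| < r -> `|Xi y 0 j - Xi z 0 j - 'd Xi x (y - z) 0 j|
    <= eps * `|y - z|.
  have {}H := filter_forall (@at_right_proper_filter _ _) H.
  near (0 : R)^'+ => r; exists r => // y z yr zr.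
  apply: row_norm_le => [|j]; first by rewrite mulr_ge0// ltW.
  have /(_ j y z yr zr) : forall j y z, `|y - x| < r ->
    `|z - x| < r -> `|Xi y 0 j - Xi z 0 j - 'd Xi x (y - z) 0 j|
    <= eps * `|y - z| by near: r.
  by rewrite !mxE.
have [_ dXE] := diff_entry j dX.
have [||r r0 rP] := @strict_diff V I e c (fun z => Xi z 0 j) x cec _ _ _ e0.
- apply: filterS nW => z Wz; have [dXz _] := C1 z Wz.
  by have [] := diff_entry j dXz.
- move=> v; have [_ /(_ v) cX] := C1 x Wx.
  have : (fun z => 'd Xi z v 0 j : R^o) @ x --> ('d Xi x v 0 j : R^o).
    apply: (@continuous_comp _ _ _ (fun z => 'd Xi z v)
      (fun w : 'rV[R]_k => w 0 j : R^o)) => //.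
    exact: differentiable_continuous (differentiable_coord _ _ _).
  move=> cXj; suff : (fun z => 'd (fun z => Xi z 0 j : R^o) z v : R^o) @ x
      --> ('d Xi x v 0 j : R^o) by rewrite -dXE.
  apply: cvg_trans cXj; apply: near_eq_cvg.
  apply: filterS nW => z Wz; have [dXz _] := C1 z Wz.
  by have [_ ->] := diff_entry j dXz.
- near=> s => y z ys zs; rewrite -dXE; apply: rP.
    by apply: lt_trans ys _; near: s; exact: nbhs_right_lt.
  by apply: lt_trans zs _; near: s; exact: nbhs_right_lt.
Unshelve. all: by end_near. Qed.

End RowValued.

End Differential.

(** * Second-order regularity of cone-reducible sets *)

(** Declared over a [realType], so that row vectors form the complete normed
    module on which a contraction has a fixed point. *)
HB.instance Definition _ (R : realType) (m n : nat) :=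
  Complete.copy 'M[R]_(m, n) 'M[R : completeType]_(m, n).

Section SecondOrderRegularity.
Variables (R : realType).

Lemma convex_setE (M : lmodType R) (A : set M) (x y : M) (s : R) :
  convex_set A -> A x -> A y -> 0 <= s <= 1 -> A (s *: x + (1 - s) *: y).
Proof.
move=> cA Ax Ay /andP[s0 s1].
have := cA x y (Itv01 s0 s1); rewrite !inE => H.
exact: H Ax Ay.
Qed.

Lemma cvg_finsum (T : Type) (F : set_system T) (FF : Filter F)
    (V : normedModType R) (I : finType) (f : I -> T -> V) (l : I -> V) :
  (forall i, f i @ F --> l i) ->
  (fun x => \sum_i f i x) @ F --> \sum_i l i.
Proof.
move=> fl; elim: (index_enum I) => [|i r IH].
  by under eq_fun do rewrite big_nil; rewrite big_nil; exact: cvg_cst.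
by under eq_fun do rewrite big_cons; rewrite big_cons; apply: cvgD.
Qed.

(** The inner second-order tangents [w] of [K] at [x] along [zeta]. *)
Definition second_order_inner (V : normedModType R) (K : set V) (x zeta w : V) :=
  forall delta : R, 0 < delta -> \forall s \near 0^'+,
    exists2 w', `|w' - w| <= delta & K (x + s *: zeta + (s ^+ 2 / 2) *: w').

(** Second-order regularity in the sense of Bonnans, Cominetti and Shapiro, in
    sequential form: the second-order quotients of any sequence of [K] that
    leaves [x] in the direction [zeta] come arbitrarily close to inner
    second-order tangents.  The filter [F] selects a subsequence. *)
Definition second_order_regular (V : normedModType R) (K : set V) (x : V) :=
  forall (F : set_system nat), ProperFilter F ->
  forall (t : nat -> R) (z : nat -> V) (zeta : V),
  (forall k, 0 < t k) -> t @ F --> (0 : R) -> (\forall k \near F, K (z k)) ->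
  (fun k => (t k)^-1 *: (z k - x)) @ F --> zeta ->
  forall eps : R, 0 < eps -> \forall k \near F,
    exists2 w, `|w - (2 / t k ^+ 2) *: (z k - x - t k *: zeta)| <= eps &
      second_order_inner K x zeta w.

Lemma surjective_right_inverse (V : normedModType R) k
    (D : {linear V -> 'rV[R]_k}) :
  (forall y, exists x, D x = y) ->
  exists (S : {linear 'rV[R]_k -> V}) (c : R),
    [/\ 0 < c, forall y, D (S y) = y & forall y, `|S y| <= c * `|y|].
Proof.
move=> Dsurj.
have [s sP] := choice (fun j : 'I_k => Dsurj (delta_mx 0 j)).
have lS : linear (fun y : 'rV[R]_k => \sum_j y 0 j *: s j).
  move=> a u v; rewrite scaler_sumr -big_split; apply: eq_bigr => j _.
  by rewrite !mxE scalerDl scalerA.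
pose S : {linear 'rV[R]_k -> V} := HB.pack
  (fun y : 'rV[R]_k => \sum_j y 0 j *: s j) (GRing.isLinear.Build R _ _ _ _ lS).
exists S, (1 + \sum_j `|s j|); split=> [|y|y].
- by rewrite ltr_pwDl// sumr_ge0.
- rewrite /S/= linear_sum [RHS]row_sum_delta; apply: eq_bigr => j _.
  by rewrite linearZ /= sP.
- rewrite /S/= mulrDl mul1r; apply: le_trans (ler_norm_sum _ _ _) _.
  apply: (@le_trans _ _ ((\sum_j `|s j|) * `|y|)); last by rewrite lerDr.
  rewrite mulr_suml; apply: ler_sum => j _.
  by rewrite normrZ mulrC ler_wpM2l// row_entry_le.
Qed.

(** Newton iteration with the fixed inverse [S]: strict differentiability makes
    [v |-> v - (Xi (z + S v) - y)] a contraction of factor 1/2 on a ball around 0,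
    and a fixed point solves the equation. *)
Lemma strict_diff_solve (V : normedModType R) k (Xi : V -> 'rV[R]_k) (x : V)
    (D : {linear V -> 'rV[R]_k}) (S : {linear 'rV[R]_k -> V}) (c r : R) :
  0 < c -> (forall y, D (S y) = y) -> (forall y, `|S y| <= c * `|y|) ->
  (forall y z, `|y - x| < r -> `|z - x| < r ->
    `|Xi y - Xi z - D (y - z)| <= (2 * c)^-1 * `|y - z|) ->
  forall z y, `|z - x| < r / 2 -> c * (2 * `|Xi z - y|) < r / 2 ->
  exists2 v, `|v| <= 2 * `|Xi z - y| & Xi (z + S v) = y.
Proof.
move=> c0 DS Sc sd z y zr yr; set rho := 2 * `|Xi z - y| in yr *.
have rho0 : 0 <= rho by rewrite mulr_ge0.
pose U := [set v : 'rV[R]_k | `|v| <= rho].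
pose T (v : 'rV[R]_k) := v - (Xi (z + S v) - y).
have inr v : U v -> `|z + S v - x| < r.
  move=> Uv; rewrite -addrA [S v - x]addrC addrA.
  apply: le_lt_trans (ler_normD _ _) _; rewrite (splitr r); apply: ltrD => //.
  by apply: le_lt_trans yr; apply: le_trans (Sc v) _; rewrite ler_pM2l.
have Tlip v w : U v -> U w -> `|T v - T w| <= 2^-1 * `|v - w|.
  move=> Uv Uw; have := sd _ _ (inr v Uv) (inr w Uw).
  have -> : z + S v - (z + S w) = S (v - w) by rewrite linearB /=; lincomb R.
  rewrite DS => H; rewrite -[leLHS]normrN.
  have -> : - (T v - T w) = (Xi (z + S v) - Xi (z + S w) - (v - w)).
    by rewrite /T; lincomb R.
  apply: le_trans H _; apply: (@le_trans _ _ ((2 * c)^-1 * (c * `|v - w|))).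
    by rewrite ler_wpM2l// invr_ge0 mulr_ge0 ?ltW.
  by rewrite mulrA invfM -[X in X * _]mulrA mulVf ?gt_eqF// mulr1.
have U0 : U 0 by rewrite /U/= normr0.
have T0 : `|T 0| = 2^-1 * rho.
  by rewrite /T linear0 addr0 sub0r normrN /rho mulrA mulVf// mul1r.
have TU : set_fun U U T.
  move=> v Uv; rewrite /U/=.
  have := Tlip v 0 Uv U0; rewrite subr0 => H.
  rewrite -[T v](subrK (T 0)); apply: le_trans (ler_normD _ _) _.
  rewrite T0; apply: le_trans (lerD H (lexx _)) _.
  rewrite -mulrDr -ler_pdivlMl ?invr_gt0// invrK.
  by rewrite mulr_natl mulr2n lerD2r.
have contr : is_contraction (HB.pack T (isFun.Build _ _ U U T TU) : {fun U >-> U}).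
  exists (2^-1)%:nng; split=> [|[v w] [/= Uv Uw]]; last exact: Tlip.
  by rewrite /= invf_lt1 ?ltr1n.
have clU : closed U.
  by apply: closed_comp (@closed_le R rho) => v _; exact: norm_continuous.
have [|v Uv /= Tv] := banach_fixed_point contr clU; first by exists 0.
exists v => //; apply/eqP; rewrite -subr_eq0; apply/eqP.
have : v - (v - (Xi (z + S v) - y)) = 0 by rewrite -/(T v) -Tv subrr.
by rewrite opprB addrC subrK.
Qed.

Section Reducible.
Variables (V : normedModType R) (I : finType) (e : I -> V) (c : I -> V -> R^o).
Hypotheses (cec : coordinates e c)
  (cZ : forall i (a : R) v, c i (a *: v) = a * c i v).
Variables (k : nat) (Xi : V -> 'rV[R]_k) (W : set V) (x : V).
Hypotheses (oW : open W) (Wx : W x) (XiC2 : C2_on W Xi).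

Let B := hessian_form e c Xi x.

Lemma hessian_formZ (a : R) y : B (a *: y) = a ^+ 2 *: B y.
Proof.
rewrite /B /hessian_form scaler_sumr; apply: eq_bigr => i _.
by rewrite linearZ/= cZ !scalerA expr2 mulrAC.
Qed.

Lemma hessian_form_continuous : continuous B.
Proof.
have [_ _ cc] := cec; have [_ C2] := XiC2.
rewrite /B /hessian_form => y; apply: cvg_finsum => i.
apply: cvgZ; first exact: cc.
have [dd _] := C2 (e i) x Wx.
exact: diff_continuous.
Qed.

Lemma second_order_quotient_cvg (T : Type) (F : set_system T) {FF : ProperFilter F}
    (t : T -> R) (z : T -> V) (zeta : V) :
  (\forall a \near F, 0 < t a) -> t @ F --> (0 : R) -> z @ F --> zeta ->
  (fun a => (2 / t a ^+ 2) *: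
     (Xi (x + t a *: z a) - Xi x - t a *: 'd Xi x (z a))) @ F --> B zeta.
Proof.
move=> t0 tcvg zcvg.
have Bz : (fun a => B (z a)) @ F --> B zeta.
  by apply: (@continuous_cvg _ _ _ F FF z B zeta) => //;
     exact: hessian_form_continuous.
rewrite -[B zeta]addr0.
suff : (fun a => (2 / t a ^+ 2) *:
    (Xi (x + t a *: z a) - Xi x - 'd Xi x (t a *: z a)
     - 2^-1 *: B (t a *: z a))) @ F --> (0 : 'rV[R]_k).
  move=> /(cvgD Bz); apply: cvg_trans; apply: near_eq_cvg.
  apply: filterS t0 => a t0 /=; rewrite !fctE hessian_formZ linearZ/=.
  by lincomb_coefs R; field; rewrite gt_eqF.
apply/cvgr0Pnorm_le => eps e0.
pose M := `|zeta| + 1.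
have M0 : 0 < M by rewrite ltr_wpDl.
have e'0 : 0 < eps / (2 * M ^+ 2) by rewrite divr_gt0// mulr_gt0// exprn_gt0.
have tz : (fun a => t a *: z a) @ F --> (0 : V).
  by rewrite -(scale0r zeta); apply: cvgZ.
have nT := tz _ (taylor2_row cec oW Wx XiC2 e'0).
have nM : \forall a \near F, `|z a| <= M.
  have : \forall a \near F, `|zeta - z a| <= 1.
    by move/cvgrPdist_le: zcvg; apply.
  apply: filterS => a za; rewrite -(subrK zeta (z a)) addrC.
  by apply: le_trans (ler_normD _ _) _; rewrite lerD2l distrC.
move: nT; rewrite /nbhs/= => nT.
apply: filterS3 t0 nM nT => a ta zM /= H.
rewrite normrZ ger0_norm; last by rewrite divr_ge0// sqr_ge0.
apply: le_trans (ler_wpM2l _ H) _; first by rewrite divr_ge0// sqr_ge0.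
rewrite normrZ exprMn (gtr0_norm ta).
have -> : 2 / t a ^+ 2 * (eps / (2 * M ^+ 2) * (t a ^+ 2 * `|z a| ^+ 2)) =
    eps * (`|z a| ^+ 2 / M ^+ 2) by field; rewrite !gt_eqF.
rewrite ler_piMr ?(ltW e0)// ler_pdivrMr ?exprn_gt0// mul1r.
by rewrite lerXn2r ?nnegrE// ltW.
Qed.

(** The second-order quotient at [z i] is moved by the right inverse [S] of
    ['d Xi x] to the [w] for which [Xi] maps the parabola of coefficients [zeta]
    and [w], up to [o(s ^ 2)], to [y = s D zeta + s^2/2 u], where
    [u = 2/t^2 (Xi (z i) - t D zeta)] and [t = t i].  For [s < t] this [y] is a
    nonnegative combination of [D zeta] and [Xi (z i)], which both lie in the
    cone [C].  Solving [Xi = y] then changes the parabola by [o(s ^ 2)] only. *)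
Lemma cone_reducible_second_order_regular (K : set V) (C : set 'rV[R]_k) :
  pointed_closed_convex_cone C -> Xi x = 0 ->
  (forall y, exists v, 'd Xi x v = y) ->
  K `&` W = [set z | W z /\ C (Xi z)] ->
  second_order_regular K x.
Proof.
move=> [clC cvC coneC _] Xi0 surj KW F FF t z zeta t0 tcvg Kz zcvg eps e0.
have [S [cS [cS0 DS Sc]]] := surjective_right_inverse surj.
have addC u v : C u -> C v -> C (u + v).
  move=> Cu Cv.
  have h01 : 0 <= (2^-1 : R) <= 1 by rewrite invr_ge0 ler0n invf_le1 ?ler1n.
  have /(coneC 2 _ (ltr0Sn _ _)) := @convex_setE _ C u v _ cvC Cu Cv h01.
  by congr C; lincomb_coefs R; field.
set D := 'd Xi x in surj DS.
have DZ (a : R) v : D (a *: v) = a *: D v by exact: linearZ.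
have DD u v : D (u + v) = D u + D v by exact: linearD.
have DB u v : D (u - v) = D u - D v by exact: linearB.
pose zt i := (t i)^-1 *: (z i - x).
have zE i : z i = x + t i *: zt i.
  by rewrite /zt; lincomb_coefs R; field; rewrite gt_eqF.
pose Q i := (2 / t i ^+ 2) *: (Xi (z i) - t i *: D (zt i)).
have Qcvg : Q @ F --> B zeta.
  have := @second_order_quotient_cvg nat F FF t zt zeta (nearW FF t0) tcvg zcvg.
  apply: cvg_trans; apply: near_eq_cvg; apply: nearW => i /=.
  by rewrite /Q Xi0 subr0 -/(zt i) -zE.
have ztcvg : z @ F --> x.
  rewrite -[x in _ --> x]addr0 -(scale0r zeta) (funext zE).
  by apply: cvgD; [exact: cvg_cst | apply: cvgZ].
have Wz : \forall i \near F, W (z i).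
  by apply: (ztcvg W); apply: open_nbhs_nbhs.
have CXiz : \forall i \near F, C (Xi (z i)).
  apply: filterS2 Kz Wz => i Kzi Wzi.
  by have : (K `&` W) (z i) by []; rewrite KW => -[].
have cD : continuous D by apply: diff_continuous; have [C1 _] := XiC2; have [] := C1 x Wx.
have CDz : C (D zeta).
  have : (fun i => D (zt i) + (t i / 2) *: Q i) @ F --> D zeta + (0 / 2) *: B zeta.
    apply: cvgD; first by apply: (@continuous_cvg _ _ _ F FF zt D zeta); [exact: cD|].
    apply: cvgZ => //; apply: cvgM => //; exact: cvg_cst.
  rewrite mul0r scale0r addr0; apply: (closed_cvg C clC).
  apply: filterS CXiz => i /(coneC (t i)^-1) H.
  have /H : 0 < (t i)^-1 by rewrite invr_gt0.
  congr C; rewrite /Q; lincomb_coefs R; field; rewrite gt_eqF//.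
have e'0 : 0 < eps / cS by rewrite divr_gt0.
have QB : \forall i \near F, `|B zeta - Q i| <= eps / cS.
  by move/cvgrPdist_le: Qcvg; apply.
apply: filterS2 CXiz QB => i Ci Qi.
set w_ := _ *: _.
pose u := (2 / t i ^+ 2) *: (Xi (z i) - t i *: D zeta).
pose w := w_ + S (u - B zeta - D w_).
have Dw_ : D w_ = (2 / t i ^+ 2) *: (t i *: D (zt i) - t i *: D zeta).
  have -> : w_ = (2 / t i ^+ 2) *: (t i *: zt i - t i *: zeta).
    by rewrite /w_ [z i]zE; lincomb R.
  by rewrite DZ DB !DZ.
have uQ : u - B zeta - D w_ = Q i - B zeta.
  by rewrite Dw_ /u /Q; lincomb R.
exists w.
  have -> : w - w_ = S (Q i - B zeta) by rewrite /w uQ; lincomb R.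
  apply: le_trans (Sc _) _; rewrite -ler_pdivlMl// mulrC.
  by rewrite distrC.
have Dw : D w = u - B zeta.
  rewrite /w DD DS; lincomb R.
move=> delta delta0.
have cS20 : 0 < (2 * cS)^-1 by rewrite invr_gt0 mulr_gt0.
have [r r0 rP] := strict_diff_row cec oW Wx XiC2 cS20.
have [rW /= rW0 rWP] : nbhs_ball x W.
  by rewrite nbhs_ballE; exact: open_nbhs_nbhs.
pose theta := delta / (2 * cS).
have th0 : 0 < theta by rewrite divr_gt0// mulr_gt0.
pose eta (s : R) := zeta + (s / 2) *: w.
have scvg : (fun s : R => s) @ 0^'+ --> (0 : R) by exact: cvg_at_right_filter.
have etacvg : eta @ 0^'+ --> zeta.
  have : eta @ 0^'+ --> zeta + (0 / 2) *: w.
    apply: cvgD; first exact: cvg_cst.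
    by apply: cvgZr_tmp; apply: cvgMr_tmp.
  by rewrite mul0r scale0r addr0.
have Q'cvg := @second_order_quotient_cvg R 0^'+ (at_right_proper_filter 0) id
  eta zeta (nbhs_right_gt 0) scvg etacvg.
have xcvg : (fun s : R => x + s *: eta s) @ 0^'+ --> x.
  rewrite -[x in _ --> x]addr0 -(scale0r zeta).
  by apply: cvgD; [exact: cvg_cst | apply: cvgZ].
near=> s.
have s0 : 0 < s by [].
pose zs := x + s *: eta s.
pose y := s *: D zeta + (s ^+ 2 / 2) *: u.
have zsr : `|zs - x| < Num.min r rW / 2.
  rewrite distrC /zs; near: s; move/cvgrPdist_lt: xcvg; apply.
  by rewrite divr_gt0// lt_min r0.
have Qs : `|Xi zs - y| <= s ^+ 2 / 2 * theta.
  have -> : Xi zs - y = (s ^+ 2 / 2) *: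
      ((2 / s ^+ 2) *: (Xi zs - Xi x - s *: D (eta s)) - B zeta).
    have -> : D (eta s) = D zeta + (s / 2) *: (u - B zeta).
      by rewrite /eta DD DZ Dw.
    by rewrite Xi0 /y; lincomb_coefs R; field; rewrite gt_eqF.
  rewrite normrZ ger0_norm ?divr_ge0 ?sqr_ge0//.
  apply: ler_wpM2l; first by rewrite divr_ge0 ?sqr_ge0.
  by rewrite distrC /zs; near: s; move/cvgrPdist_le: Q'cvg; apply.
have ys : cS * (s ^+ 2 * theta) < Num.min r rW / 2.
  near: s.
  have : (fun s : R => cS * (s ^+ 2 * theta)) @ 0^'+ --> cS * (0 ^+ 2 * theta).
    by apply: cvgMl_tmp; apply: cvgMr_tmp; rewrite /=; apply: cvgM.
  rewrite expr0n mul0r mulr0 => /cvgrPdist_lt H.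
  have m0 : 0 < Num.min r rW / 2 by rewrite divr_gt0// lt_min r0.
  apply: filterS (H _ m0) => s; rewrite sub0r normrN; apply: le_lt_trans.
  exact: ler_norm.
have ys2 : 2 * `|Xi zs - y| <= s ^+ 2 * theta.
  by rewrite -ler_pdivlMl// mulrA [2^-1 * _]mulrC.
have [v vle Xiv] : exists2 v, `|v| <= 2 * `|Xi zs - y| & Xi (zs + S v) = y.
  apply: (strict_diff_solve cS0 DS Sc rP).
    by apply: lt_le_trans zsr _; rewrite ler_pM2r// ge_min lexx.
  apply: le_lt_trans (lt_le_trans ys _); first by rewrite ler_pM2l.
  by rewrite ler_pM2r// ge_min lexx.
have Sv : `|S v| <= cS * (s ^+ 2 * theta).
  by apply: le_trans (Sc v) _; rewrite ler_pM2l//; apply: le_trans vle _.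
exists (w + (2 / s ^+ 2) *: S v).
  have -> : w + (2 / s ^+ 2) *: S v - w = (2 / s ^+ 2) *: S v by lincomb R.
  rewrite normrZ ger0_norm ?divr_ge0 ?sqr_ge0//.
  apply: le_trans (ler_wpM2l _ Sv) _; first by rewrite divr_ge0 ?sqr_ge0.
  rewrite /theta le_eqVlt; apply/predU1P; left; field; rewrite !gt_eqF//.
have -> : x + s *: zeta + (s ^+ 2 / 2) *: (w + (2 / s ^+ 2) *: S v) = zs + S v.
  by rewrite /zs /eta; lincomb_coefs R; field; rewrite gt_eqF.
suff : (K `&` W) (zs + S v) by case.
rewrite KW /= Xiv; split.
  apply: rWP; rewrite -ball_normE /= distrC.
  have -> : zs + S v - x = (zs - x) + S v by lincomb R.
  apply: le_lt_trans (ler_normD _ _) _.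
  apply: (@lt_le_trans _ _ (Num.min r rW / 2 + Num.min r rW / 2)).
    by apply: ltrD => //; apply: le_lt_trans ys.
  by rewrite -splitr ge_min lexx orbT.
have st : s < t i by near: s; exact: nbhs_right_lt.
have -> : y = (s - s ^+ 2 / t i) *: D zeta + (s ^+ 2 / t i ^+ 2) *: Xi (z i).
  by rewrite /y /u; lincomb_coefs R; field; rewrite gt_eqF.
apply: addC; apply: coneC => //; last by rewrite divr_gt0 ?exprn_gt0.
by rewrite subr_gt0 ltr_pdivrMr// expr2 ltr_pM2l.
Unshelve. all: by end_near. Qed.

End Reducible.

Lemma reducible_fun_second_order_regular n (g : 'rV[R]_n -> \bar R) x :
  C2_cone_reducible_fun g x -> second_order_regular (epi g) (x, fine (g x)).
Proof.
move=> [_ [_ [k [C [W [Xi [coneC [oW Wx] XiC2 [Xi0 surj] KW]]]]]]].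
apply: (cone_reducible_second_order_regular (row_pair_coordinates R n) _
  oW Wx XiC2 coneC Xi0 surj KW) => -[i|i] a v //=; by rewrite mxE.
Qed.

End SecondOrderRegularity.

(** * Euclidean spaces and limits of matrices *)

Section EuclideanSpaces.
Variables (R : realType) (V : euclideanType R).
Implicit Types (x y z : V) (a : R).

Lemma dotDl x y z : dot (x + y) z = dot x z + dot y z.
Proof. by have := dot_linearl z 1 x y; rewrite scale1r mul1r. Qed.

Lemma dot0l x : dot 0 x = 0.
Proof.
by apply: (addrI (dot (0 : V) x)); rewrite -dotDl !addr0.
Qed.

Lemma dotZl a x y : dot (a *: x) y = a * dot x y.
Proof. by have := dot_linearl y a x 0; rewrite dot0l !addr0. Qed.

Lemma dotNl x y : dot (- x) y = - dot x y.
Proof. by rewrite -scaleN1r dotZl mulN1r. Qed.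

Lemma dotBl x y z : dot (x - y) z = dot x z - dot y z.
Proof. by rewrite dotDl dotNl. Qed.

Lemma dotDr x y z : dot z (x + y) = dot z x + dot z y.
Proof. by rewrite dotC dotDl !(dotC z). Qed.

Lemma dot0r x : dot x 0 = 0.
Proof. by rewrite dotC dot0l. Qed.

Lemma dotZr a x y : dot y (a *: x) = a * dot y x.
Proof. by rewrite dotC dotZl dotC. Qed.

Lemma dotNr x y : dot y (- x) = - dot y x.
Proof. by rewrite dotC dotNl dotC. Qed.

Lemma dotBr x y z : dot z (x - y) = dot z x - dot z y.
Proof. by rewrite dotDr dotNr. Qed.

Lemma dot_ge0 x : 0 <= dot x x.
Proof.
have [c c0 cP] := @dot_norm R V; have [H _] := cP x.
by rewrite -(pmulr_rge0 _ c0); apply: le_trans H; rewrite sqr_ge0.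
Qed.

Lemma dot_eq0 x : dot x x = 0 -> x = 0.
Proof.
have [c c0 cP] := @dot_norm R V; have [H _] := cP x => x0.
apply/normr0_eq0/eqP; rewrite -sqrf_eq0 eq_le sqr_ge0 andbT.
by apply: le_trans H _; rewrite x0 mulr0.
Qed.

Lemma dot_le_sum x y : 2 * dot x y <= dot x x + dot y y.
Proof.
by have := dot_ge0 (x - y); rewrite !(dotBl, dotBr) (dotC y x); lra.
Qed.

(** Cauchy-Schwarz inequality. *)
Lemma dot_sqr_le x y : dot x y ^+ 2 <= dot x x * dot y y.
Proof.
have [y0|y0] := eqVneq (dot y y) 0.
  by rewrite (dot_eq0 y0) dot0r expr0n/= mulr_ge0// ?dot0r ?dot_ge0.
have yp : 0 < dot y y by rewrite lt0r y0 dot_ge0.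
have := dot_ge0 (dot y y *: x - dot x y *: y).
rewrite !(dotBl, dotBr, dotZl, dotZr) (dotC y x) => H.
rewrite -(ler_pM2l yp); nra.
Qed.

Lemma dot_bound : exists2 c : R, 0 < c & forall x y, `|dot x y| <= c * `|x| * `|y|.
Proof.
have [c c0 cP] := @dot_norm R V; exists c => // x y.
have cxy : 0 <= c * `|x| * `|y| by rewrite !mulr_ge0// ltW.
rewrite -(@ler_pXn2r _ 2)// ?nnegrE// real_normK ?num_real//.
apply: le_trans (dot_sqr_le x y) _.
rewrite [c * _ * _]mulrC mulrA [_ * c]mulrC.
have [_ Hx] := cP x; have [_ Hy] := cP y.
apply: le_trans (ler_pM (dot_ge0 x) (dot_ge0 y) Hx Hy) _.
by rewrite le_eqVlt; apply/predU1P; left; ring.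
Qed.

Lemma cvg_dot (T : Type) (F : set_system T) {FF : Filter F} (f g : T -> V) x y :
  f @ F --> x -> g @ F --> y -> (fun k => dot (f k) (g k)) @ F --> dot x y.
Proof.
move=> fx gy; have [c c0 cP] := dot_bound.
have f0 : (fun k => `|f k - x|) @ F --> (0 : R).
  rewrite -(normr0 V) -(subrr x).
  by apply: cvg_norm; apply: cvgB fx _; exact: cvg_cst.
have g0 : (fun k => `|g k - y|) @ F --> (0 : R).
  rewrite -(normr0 V) -(subrr y).
  by apply: cvg_norm; apply: cvgB gy _; exact: cvg_cst.
apply/cvgrPdist_le => eps e0.
have B : (fun k => c * `|f k - x| * `|g k| + c * `|x| * `|g k - y|) @ F -->
    c * 0 * `|y| + c * `|x| * 0.
  apply: cvgD; last by apply: cvgMl_tmp.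
  by apply: cvgM; [apply: cvgMl_tmp | apply: cvg_norm].
move: B; rewrite mulr0 mul0r mulr0 addr0 => /cvgrPdist_le/(_ _ e0).
apply: filterS => k; rewrite sub0r normrN; apply: le_trans.
have -> : dot x y - dot (f k) (g k) = - (dot (f k - x) (g k) + dot x (g k - y)).
  by rewrite dotBl dotBr; ring.
rewrite normrN; apply: le_trans (ler_normD _ _) _.
by apply: le_trans (ler_norm _); apply: lerD; exact: cP.
Qed.

Lemma cvg_dot0 (T : Type) (F : set_system T) {FF : Filter F} (f : T -> V) x :
  (fun k => dot (f k - x) (f k - x)) @ F --> (0 : R) -> f @ F --> x.
Proof.
move=> H; have [c c0 cP] := @dot_norm R V.
apply/cvgrPdist_le => eps e0.
have e20 : 0 < eps ^+ 2 / c by rewrite divr_gt0// exprn_gt0.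
move/cvgrPdist_le: H => /(_ _ e20).
apply: filterS => k; rewrite sub0r normrN ger0_norm ?dot_ge0// => H.
rewrite distrC -(@ler_pXn2r _ 2)// ?nnegrE ?(ltW e0)//.
have [Hc _] := cP (f k - x); apply: le_trans Hc _.
by rewrite mulrC -ler_pdivlMr.
Qed.

Lemma cvg_dot_sub0 (T : Type) (F : set_system T) {FF : Filter F} (f : T -> V) x :
  f @ F --> x -> (fun k => dot (f k - x) (f k - x)) @ F --> (0 : R).
Proof.
move=> fx; have fx0 : (fun k => f k - x) @ F --> (0 : V).
  by rewrite -(subrr x); apply: cvgB => //; exact: cvg_cst.
suff : (fun k => dot (f k - x) (f k - x)) @ F --> dot (0 : V) 0 by rewrite dot0l.
exact: cvg_dot.
Qed.

End EuclideanSpaces.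

(** Ultrafilters do the work of extracting convergent subsequences: one
    ultrafilter serves all the sequences of an argument at the same time. *)
Lemma ultra_bounded_cvg (R : realType) (T : Type) (F : set_system T)
    (f : T -> R) (M : R) :
  UltraFilter F -> (\forall k \near F, `|f k| <= M) ->
  exists l : R, f @ F --> l.
Proof.
move=> UF fM.
have := @segment_compact R (- M) M; rewrite compact_ultra => H.
have UfF : UltraFilter (f @ F).
  split=> [|G PG FG]; first exact: fmap_proper_filter.
  rewrite eqEsubset; split=> // A GA.
  have [//|FnA] := @in_ultra_setVsetC _ F (f @^-1` A) UF.
  have /FG GnA : (f @ F) (~` A) by [].
  by have := filter_ex (filterI GA GnA) => -[? []].
have [l [_ fl]] : `[- M, M] `&` [set p | f @ F --> p] !=set0.
  apply: H; apply: filterS fM => k /=.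
  by rewrite ler_norml in_itv.
by exists l.
Qed.

Lemma matrix_cvg (R : realType) m n (T : Type) (F : set_system T)
    (FF : Filter F) (f : T -> 'M[R]_(m, n)) (A : 'M[R]_(m, n)) :
  (forall i j, (fun k => f k i j) @ F --> A i j) -> f @ F --> A.
Proof.
move=> fA; apply/cvgrPdist_le => eps e0.
have : \forall k \near F, forall ij : 'I_m * 'I_n,
    `|A ij.1 ij.2 - f k ij.1 ij.2| <= eps.
  by apply: filter_forall => -[i j]; move/cvgrPdist_le: (fA i j); apply.
apply: filterS => k H; rewrite [leLHS]/Num.norm /= mx_normrE.
apply: bigmax_le => [|ij _]; first exact: ltW.
by rewrite !mxE; exact: H.
Qed.

Lemma matrix_cvg_entry (R : realType) m n (T : Type) (F : set_system T)
    (FF : Filter F) (f : T -> 'M[R]_(m, n)) (A : 'M[R]_(m, n)) i j :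
  f @ F --> A -> (fun k => f k i j) @ F --> A i j.
Proof.
move=> /cvgrPdist_le fA; apply/cvgrPdist_le => eps e0.
apply: filterS (fA _ e0) => k; apply: le_trans.
rewrite [leRHS]/Num.norm /= mx_normrE.
by have := le_bigmax 0 (fun ij : 'I_m * 'I_n => `|(A - f k) ij.1 ij.2|) (i, j);
  rewrite /= !mxE.
Qed.

Lemma ultra_matrix_cvg (R : realType) m n (T : Type) (F : set_system T)
    (f : T -> 'M[R]_(m, n)) (M : R) :
  UltraFilter F -> (forall i j, \forall k \near F, `|f k i j| <= M) ->
  exists A : 'M[R]_(m, n), f @ F --> A.
Proof.
move=> UF fM.
have /choice[A AP] : forall ij : 'I_m * 'I_n,
    exists l : R, (fun k => f k ij.1 ij.2) @ F --> l.
  by move=> [i j]; exact: ultra_bounded_cvg (fM i j).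
exists (\matrix_(i, j) A (i, j)); apply: matrix_cvg => i j.
by rewrite mxE; exact: (AP (i, j)).
Qed.

(** * Decompositions along the orbits of a compact group *)

(** What eigenvalues of symmetric matrices and singular values of rectangular
    matrices have in common.  [Dg] maps a row to a diagonal matrix, [lam] is the
    spectrum, [Ch] the set of rows that are spectra; [G] is a compact group of
    isometries whose orbits are the sets of matrices with a given spectrum, and
    [K] consists of its infinitesimal generators.  The rows in [Reg] are interior
    to [Ch], and adding a positive multiple of [w0] makes any spectrum regular.
    The field [K_curve] says that every generator is the velocity of a curve in
    the group that agrees with its exponential to second order, [orbit_tangent]
    that limits of difference quotients along an orbit come from generators, and
    [stationary_Dg] and [maximal_chamber] describe the critical points and the
    maximizers, on an orbit, of the linear functional given by a regular
    diagonal matrix. *)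
Record spectral_system (R : realType) (E : euclideanType R) (n : nat)
    (Dg : {linear 'rV[R]_n -> E}) (lam : E -> 'rV[R]_n)
    (G K : set (E -> E)) (Ch Reg : set 'rV[R]_n) (w0 : 'rV[R]_n) : Prop := {
  dot_Dg : forall x y, dot (Dg x) (Dg y) = dot x y;
  G_linear : forall U, G U -> linear U;
  G_dot : forall U X Y, G U -> dot (U X) (U Y) = dot X Y;
  G_id : G id;
  G_comp : forall U U', G U -> G U' -> G (U \o U');
  G_inv : forall U, G U -> exists2 U', G U' & cancel U U' /\ cancel U' U;
  G_compact : forall (F : set_system nat) (U : nat -> E -> E),
    UltraFilter F -> (forall k, G (U k)) ->
    exists2 U', G U' & forall X, (fun k => U k X) @ F --> U' X;
  K_opp : forall k, K k -> K (fun X => - k X);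
  K_skew : forall k X Y, K k -> dot (k X) Y = - dot X (k Y);
  K_curve : forall k, K k -> exists2 U : R -> E -> E, (forall t, G (U t)) &
    forall X, (fun t => (t ^+ 2)^-1 *:
      (U t X - X - t *: k X - (t ^+ 2 / 2) *: k (k X))) @ 0^'+ --> (0 : E);
  K_Dg_orth : forall k x v, K k -> dot (k (Dg x)) (Dg v) = 0;
  orbit_tangent : forall (F : set_system nat) (U : nat -> E -> E)
    (t : nat -> R) (x : 'rV[R]_n) (L : E), UltraFilter F -> Ch x ->
    (forall k, G (U k)) -> (forall k, 0 < t k) -> t @ F --> (0 : R) ->
    (fun k => (t k)^-1 *: (U k (Dg x) - Dg x)) @ F --> L ->
    exists2 k, K k & k (Dg x) = L;
  stationary_Dg : forall w Y, Reg w ->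
    (forall k, K k -> dot (k Y) (Dg w) = 0) -> exists y, Y = Dg y;
  maximal_chamber : forall w y, Reg w ->
    (forall U, G U -> dot (U (Dg y)) (Dg w) <= dot y w) -> Ch y;
  lam_orbit : forall U y, G U -> Ch y -> lam (U (Dg y)) = y;
  regular0 : Reg w0;
  regular_perturb : forall y (eps : R), Ch y -> 0 < eps -> Reg (y + eps *: w0)
}.

Section SpectralSystem.
Variables (R : realType) (E : euclideanType R) (n : nat).
Variables (Dg : {linear 'rV[R]_n -> E}) (lam : E -> 'rV[R]_n).
Variables (G K : set (E -> E)) (Ch Reg : set 'rV[R]_n) (w0 : 'rV[R]_n).
Hypothesis sys : spectral_system Dg lam G K Ch Reg w0.

Let GD U X Y : G U -> U (X + Y) = U X + U Y.
Proof.
by move=> GU; have := G_linear sys GU 1 X Y; rewrite !scale1r.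
Qed.
Let GZ U a X : G U -> U (a *: X) = a *: U X.
Proof.
move=> GU; have U0 : U 0 = 0.
  by apply: (addrI (U 0)); rewrite -GD// !addr0.
by have := G_linear sys GU a X 0; rewrite U0 !addr0.
Qed.
Let GB U X Y : G U -> U (X - Y) = U X - U Y.
Proof. by move=> GU; rewrite GD// -scaleN1r GZ// scaleN1r. Qed.

Lemma G_bound : exists2 c : R, 0 < c & forall U X, G U -> `|U X| <= c * `|X|.
Proof.
have [c c0 cP] := @dot_norm R E; exists c => // U X GU.
rewrite -(@ler_pXn2r _ 2)// ?nnegrE ?mulr_ge0 ?(ltW c0)//.
have [H _] := cP (U X); apply: le_trans H _.
rewrite (G_dot sys)// exprMn expr2 -mulrA ler_pM2l//.
by have [_] := cP X.
Qed.

Lemma G_cvg (F : set_system nat) (FF : Filter F) (U : nat -> E -> E)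
    (U' : E -> E) (f : nat -> E) (X : E) :
  (forall k, G (U k)) -> (fun k => U k X) @ F --> U' X -> f @ F --> X ->
  (fun k => U k (f k)) @ F --> U' X.
Proof.
move=> GU UX fX; have [c c0 cP] := G_bound.
have -> : (fun k => U k (f k)) = (fun k => U k (f k - X) + U k X).
  by apply: funext => k; rewrite -GD// subrK.
rewrite -[U' X]add0r; apply: cvgD => //.
apply/cvgr0Pnorm_le => eps e0.
have ec : 0 < eps / c by rewrite divr_gt0.
move/cvgrPdist_le: fX => /(_ _ ec); apply: filterS => k; rewrite distrC => H.
by apply: le_trans (cP _ _ (GU k)) _; rewrite mulrC -ler_pdivlMr.
Qed.

Lemma G_cvg1 (F : set_system nat) (FF : Filter F) (U : E -> E)
    (f : nat -> E) (X : E) :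
  G U -> f @ F --> X -> (fun k => U (f k)) @ F --> U X.
Proof. by move=> GU; apply: (@G_cvg F FF (fun=> U)) => //; exact: cvg_cst. Qed.

Lemma orbit_maximizer X Y :
  exists2 U, G U & forall U', G U' -> dot (U' X) Y <= dot (U X) Y.
Proof.
pose S := [set dot (U X) Y | U in G].
have ubS : has_sup S.
  split; first by exists (dot X Y), id => //; exact: G_id sys.
  exists ((dot X X + dot Y Y) / 2) => _ [U GU <-].
  rewrite ler_pdivlMr// mulrC; apply: le_trans (dot_le_sum _ _) _.
  by rewrite (G_dot sys).
have /choice[U UP] : forall k : nat, exists U, G U /\
    sup S - k.+1%:R^-1 < dot (U X) Y.
  move=> k; have k0 : (0 : R) < k.+1%:R^-1 by rewrite invr_gt0.
  by have [_ [U GU <-] H] := sup_adherent k0 ubS; exists U.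
have [F [UF oF]] := @ultraFilterLemma nat \oo _.
have [U' GU' UU'] := G_compact sys UF (fun k => (UP k).1).
exists U' => // W GW.
have : sup S <= dot (U' X) Y.
  have c1 : (fun k => dot (U k X) Y) @ F --> dot (U' X) Y.
    by apply: cvg_dot => //; exact: cvg_cst.
  have c2 : (fun k : nat => sup S - k.+1%:R^-1) @ F --> sup S.
    suff : (fun k : nat => sup S - k.+1%:R^-1) @ F --> sup S - 0.
      by rewrite subr0.
    apply: cvgB; first exact: cvg_cst.
    by move=> A /(@cvg_harmonic R) HA; exact: oF.
  by apply: (ler_cvg_to c2 c1); apply: nearW => k; exact: ltW (UP k).2.
by apply: le_trans; apply: sup_upper_bound => //; exists W.
Qed.

Lemma curve_derivative k (U : R -> E -> E) X Y :
  (fun t => (t ^+ 2)^-1 *: (U t X - X - t *: k X - (t ^+ 2 / 2) *: k (k X)))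
    @ 0^'+ --> (0 : E) ->
  (fun t => t^-1 * (dot (U t X) Y - dot X Y)) @ 0^'+ --> dot (k X) Y.
Proof.
set r := (fun t => _ *: _) => r0.
have H : (fun t : R => dot (k X) Y + t * (dot (k (k X)) Y / 2)
    + t * dot (r t) Y) @ 0^'+ --> dot (k X) Y
      + 0 * (dot (k (k X)) Y / 2) + 0 * dot (0 : E) Y.
  have t0 : (fun t : R => t) @ 0^'+ --> (0 : R) by exact: cvg_at_right_filter.
  apply: cvgD; first by apply: cvgD; [exact: cvg_cst | exact: cvgMr_tmp].
  by apply: cvgM => //; apply: cvg_dot => //; exact: cvg_cst.
move: H; rewrite !mul0r !addr0; apply: cvg_trans; apply: near_eq_cvg.
near=> t; have t0 : 0 < t by [].
rewrite /r !(dotZl, dotBl); field; rewrite gt_eqF//.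
Unshelve. all: by end_near. Qed.

(** First-order condition along the curves in the group. *)
Lemma maximizer_stationary X Y :
  (forall U, G U -> dot (U X) Y <= dot X Y) ->
  forall k, K k -> dot (k X) Y = 0.
Proof.
move=> Xmax.
have le0 k : K k -> dot (k X) Y <= 0.
  move=> Kk; have [U GU /(_ X)/(@curve_derivative _ _ _ Y) H] := K_curve sys Kk.
  have c0 : (fun t : R => (0 : R)) @ 0^'+ --> (0 : R) by exact: cvg_cst.
  apply: (ler_cvg_to H c0); near=> t; have t0 : 0 < t by [].
  by rewrite pmulr_rle0 ?invr_gt0// subr_le0 Xmax.
move=> k Kk; apply/eqP; rewrite eq_le le0//=.
by have := le0 _ (K_opp sys Kk); rewrite dotNl oppr_le0.
Unshelve. all: by end_near. Qed.

Lemma orbit_maximum X w : Reg w ->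
  exists2 U, G U & exists2 y, Ch y & U X = Dg y /\
    forall U', G U' -> dot (U' X) (Dg w) <= dot y w.
Proof.
move=> rw; have [U GU Umax] := orbit_maximizer X (Dg w).
have Umax' U' : G U' -> dot (U' (U X)) (Dg w) <= dot (U X) (Dg w).
  by move=> GU'; exact: (Umax (U' \o U) (G_comp sys GU' GU)).
have [y Uy] := stationary_Dg sys rw (maximizer_stationary Umax').
exists U => //; exists y.
  apply: (maximal_chamber sys rw) => U' GU'.
  by rewrite -Uy -(dot_Dg sys) -Uy; exact: Umax'.
by split=> // U' GU'; rewrite -(dot_Dg sys) -Uy; exact: Umax.
Qed.

(** Variational proof: on the orbit of [X], a maximizer of the linear functional
    given by a regular diagonal matrix exists by compactness, is diagonal because
    it is stationary, and lies in the chamber because it is maximal. *)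
Lemma spectral_decomposition X :
  Ch (lam X) /\ exists2 U, G U & X = U (Dg (lam X)).
Proof.
have [U GU [y Cy [Uy _]]] := orbit_maximum X (regular0 sys).
have [U' GU' [U'K _]] := G_inv sys GU.
have XE : X = U' (Dg y) by rewrite -Uy U'K.
have ly : lam X = y by rewrite XE (lam_orbit sys).
by rewrite ly; split=> //; exists U'.
Qed.

Lemma lam_G U X : G U -> lam (U X) = lam X.
Proof.
have [C [U' GU' XE]] := spectral_decomposition X => GU.
by rewrite {1}XE (lam_orbit sys (G_comp sys GU GU')).
Qed.

(** The inequality of von Neumann and Fan.  When the spectrum of [Y] is regular,
    [orbit_maximum] is the claim; the general case follows by perturbing the
    spectrum of [Y] along [w0]. *)
Lemma trace_inequality X Y : dot X Y <= dot (lam X) (lam Y).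
Proof.
have [Cy [U GU YE]] := spectral_decomposition Y.
have [U' GU' [U'K UU']] := G_inv sys GU.
have reg (eps : R) : 0 < eps ->
    dot (U' X) (Dg (lam Y + eps *: w0)) <= dot (lam X) (lam Y + eps *: w0).
  move=> e0; have [W GW [y Chy [Wy Wmax]]] :=
    orbit_maximum X (regular_perturb sys Cy e0).
  have -> : lam X = y by rewrite -(lam_G X GW) Wy (lam_orbit sys (G_id sys)).
  exact: Wmax.
have -> : dot X Y = dot (U' X) (Dg (lam Y)).
  by rewrite -(G_dot sys (U' X) _ GU) UU' -YE.
have t0 : (fun t : R => t) @ 0^'+ --> (0 : R) by exact: cvg_at_right_filter.
have c1 : (fun t : R => dot (U' X) (Dg (lam Y)) + t * dot (U' X) (Dg w0)) @ 0^'+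
    --> dot (U' X) (Dg (lam Y)) + 0 * dot (U' X) (Dg w0).
  by apply: cvgD; [exact: cvg_cst | exact: cvgMr_tmp].
have c2 : (fun t : R => dot (lam X) (lam Y) + t * dot (lam X) w0) @ 0^'+
    --> dot (lam X) (lam Y) + 0 * dot (lam X) w0.
  by apply: cvgD; [exact: cvg_cst | exact: cvgMr_tmp].
move: c1 c2; rewrite !mul0r !addr0 => c1 c2.
apply: (ler_cvg_to c1 c2); near=> t.
have tp : 0 < t by [].
by have := reg _ tp; rewrite linearD linearZ /= !(dotDr, dotZr).
Unshelve. all: by end_near. Qed.

Lemma dot_lam X : dot (lam X) (lam X) = dot X X.
Proof.
have [_ [U GU XE]] := spectral_decomposition X.
by rewrite [in RHS]XE (G_dot sys)// (dot_Dg sys).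
Qed.

Lemma lam_nonexpansive X Y :
  dot (lam X - lam Y) (lam X - lam Y) <= dot (X - Y) (X - Y).
Proof.
rewrite !(dotBl, dotBr) !dot_lam (dotC (lam Y)) (dotC Y).
by have := trace_inequality X Y; lra.
Qed.

Lemma bounded_cvg (F : set_system nat) (X : nat -> E) (M : R) :
  UltraFilter F -> (forall k, dot (X k) (X k) <= M) -> exists Y : E, X @ F --> Y.
Proof.
move=> UF XM.
have /choice[U UP] : forall k, exists U, G U /\ X k = U (Dg (lam (X k))).
  by move=> k; have [_ [U GU XE]] := spectral_decomposition (X k); exists U.
have [U' GU' UU'] := G_compact sys UF (fun k => (UP k).1).
have [|l lP] := @ultra_matrix_cvg R 1 n nat F (fun k => lam (X k))
    (Num.sqrt M) UF.
  move=> i j; apply: nearW => k; rewrite ord1.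
  rewrite -sqrtr_sqr ler_sqrt; last by apply: le_trans (XM k); exact: dot_ge0.
  apply: le_trans (XM k); rewrite -dot_lam [leRHS]mxdotE big_ord1.
  rewrite (bigD1 j)//= -expr2 lerDl sumr_ge0// => ? _.
  by rewrite -expr2 sqr_ge0.
exists (U' (Dg l)).
rewrite (_ : X = fun k => U k (Dg (lam (X k)))); last first.
  by apply: funext => k; have [_ {1}->] := UP k.
apply: G_cvg => [k||//]; first by have [] := UP k.
  exact: UU'.
apply: cvg_dot0; under eq_fun do rewrite -linearB (dot_Dg sys).
exact: cvg_dot_sub0.
Qed.

Lemma cvg_Dg (F : set_system nat) (FF : Filter F) (f : nat -> 'rV[R]_n) l :
  f @ F --> l -> (fun k => Dg (f k)) @ F --> Dg l.
Proof.
move=> fl; apply: cvg_dot0; under eq_fun do rewrite -linearB (dot_Dg sys).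
exact: cvg_dot_sub0.
Qed.

(** * Parabolic regularity under a spectral system *)

Section ParabolicRegularity.
Variables (g : 'rV[R]_n -> \bar R) (theta : E -> \bar R).
Hypotheses (thetaE : forall X, theta X = g (lam X))
  (g_Dg : forall x, g (lam (Dg x)) = g x).
Variables (Xb V : E).
Hypotheses (greg : second_order_regular (epi g) (lam Xb, fine (g (lam Xb))))
  (VP : subdifferential theta Xb V).

Let theta_G_Dg U x : G U -> theta (U (Dg x)) = g x.
Proof. by move=> GU; rewrite thetaE lam_G. Qed.

(** The frames [P_ i] diagonalize [X' i = X i + t i ^ (3/2) V], not
    [X i = Xb + t i H_ i].  The perturbation is [o(t i)], hence harmless at first
    order, but dominates [t i ^ 2]; the hypothesis makes [V] and [X i] attain the
    trace inequality up to [O(t i ^ 2)], so the limit [P] must diagonalize [V] as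
    well as [Xb].  The generator [k] is the velocity at which the frames [P_ i]
    turn [Dg (lam Xb)]. *)
Lemma limiting_frame (F : set_system nat) (t : nat -> R) (H_ : nat -> E) (H : E)
    (c : R) :
  UltraFilter F -> (forall k, 0 < t k) -> t @ F --> (0 : R) -> H_ @ F --> H ->
  (\forall k \near F, (theta (Xb + t k *: H_ k)%R <=
    theta Xb + (dot V (t k *: H_ k) + t k ^+ 2 / 2 * c)%:E)%E) ->
  exists (P : E -> E) (h : 'rV[R]_n) (k : E -> E),
    [/\ G P /\ K k, P (Dg (lam V)) = V, P (Dg (lam Xb)) = Xb,
      H = P (k (Dg (lam Xb)) + Dg h) &
      (fun i => (t i)^-1 *: (lam (Xb + t i *: H_ i) - lam Xb)) @ F --> h].
Proof.
move=> UF t0 tcvg Hcvg thetaH.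
have [thfin Vsub] := VP.
pose v := lam V; pose xb := lam Xb.
pose q i := Num.sqrt (t i).
have q0 i : 0 < q i by rewrite sqrtr_gt0.
have qq i : q i * q i = t i by rewrite -expr2 sqr_sqrtr// ltW.
have qcvg : q @ F --> (0 : R).
  rewrite -(@sqrtr0 R); apply: (@continuous_cvg _ _ _ F _ t Num.sqrt 0) => //.
  exact: sqrt_continuous.
pose X i := Xb + t i *: H_ i.
pose X' i := X i + (t i * q i) *: V.
have /choice[P_ PP] : forall i, exists U, G U /\ X' i = U (Dg (lam (X' i))).
  by move=> i; have [_ [U GU XE]] := spectral_decomposition (X' i); exists U.
have GP_ i : G (P_ i) by have [] := PP i.
have X'E i : X' i = P_ i (Dg (lam (X' i))) by have [] := PP i.
have [P GP PcvgE] := G_compact sys UF GP_.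
have [Q GQ QE] := (spectral_decomposition V).2.
(* |P_ i (Dg v) - V|^2 <= sqrt (t i) * c by the trace inequality *)
have VE : P (Dg v) = V.
  suff cV : (fun i => P_ i (Dg v)) @ F --> V.
    exact: (cvg_unique _ (PcvgE _) cV).
  apply: cvg_dot0.
  have bnd : \forall i \near F, 0 <= dot (P_ i (Dg v) - V) (P_ i (Dg v) - V)
      <= q i * c.
    apply: filterS thetaH => i thi; rewrite dot_ge0/=.
    have vx : dot v (lam (X i)) <= dot V (X i) + t i ^+ 2 / 2 * c.
      have := Vsub (Q (Dg (lam (X i)))).
      rewrite theta_G_Dg// -thetaE => /le_trans/(_ thi).
      rewrite leeD2lE// lee_fin dotBr {1}QE (G_dot sys)// (dot_Dg sys) -/v.
      by rewrite /X dotDr; lra.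
    have f1 : dot V (X' i) <= dot v (lam (X' i)) by exact: trace_inequality.
    have f2 : dot v (lam (X' i)) = dot (P_ i (Dg v)) (X' i).
      by rewrite [in RHS]X'E (G_dot sys)// (dot_Dg sys).
    have f3 : dot (P_ i (Dg v)) (X i) <= dot v (lam (X i)).
      apply: le_trans (trace_inequality _ _) _.
      rewrite lam_G// (_ : lam (Dg v) = v)//.
      by rewrite -(lam_G _ GQ) -QE.
    move: f1; rewrite f2 /X' [dot V (X i + _)]dotDr.
    rewrite [dot (P_ i (Dg v)) (X i + _)]dotDr !dotZr => f1.
    have f4 : t i * q i * (dot V V - dot (P_ i (Dg v)) V) <= t i ^+ 2 / 2 * c.
      by lra.
    have f5 : dot (P_ i (Dg v)) (P_ i (Dg v)) = dot V V.
      by rewrite (G_dot sys)// (dot_Dg sys) dot_lam.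
    rewrite !(dotBl, dotBr) f5 (dotC V (P_ i _)).
    rewrite -(ler_pM2l (mulr_gt0 (t0 i) (q0 i))).
    have -> : t i * q i * (q i * c) = t i * (q i * q i) * c by ring.
    rewrite qq.
    by lra.
  have c0 : (fun=> 0 : R) @ F --> (0 : R) by exact: cvg_cst.
  have cq : (fun i => q i * c) @ F --> (0 : R).
    by rewrite -(mul0r c); exact: cvgMr_tmp.
  exact: (squeeze_cvgr bnd c0 cq).
pose Y i := (t i)^-1 *: (X' i - Xb).
have YE i : Y i = H_ i + q i *: V.
  by rewrite /Y /X' /X; lincomb_coefs R; field; rewrite gt_eqF.
have Ycvg : Y @ F --> H.
  rewrite (funext YE) -[H]addr0 -(scale0r V); apply: cvgD => //.
  exact: cvgZr_tmp.
have X'cvg : X' @ F --> Xb.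
  have -> : X' = (fun i => Xb + t i *: Y i).
    by apply: funext => i; rewrite /Y; lincomb_coefs R; field; rewrite gt_eqF.
  rewrite -[Xb in _ --> Xb]addr0 -(scale0r H); apply: cvgD; first exact: cvg_cst.
  exact: cvgZ.
have XbE : P (Dg xb) = Xb.
  have c1 : (fun i => P_ i (Dg (lam (X' i)))) @ F --> P (Dg xb).
    apply: G_cvg => //; apply: cvg_Dg; apply: cvg_dot0.
    apply: (squeeze_cvgr _ (cvg_cst 0) (cvg_dot_sub0 X'cvg)).
    by apply: nearW => i; rewrite dot_ge0 lam_nonexpansive.
  by move: c1; rewrite -(funext X'E) => c1; exact: (cvg_unique _ c1 X'cvg).
pose xi i := (t i)^-1 *: (lam (X' i) - xb).
have dxi i : dot (xi i) (xi i) <= dot (Y i) (Y i).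
  rewrite /xi /Y !dotZl !dotZr !mulrA ler_pM2l ?lam_nonexpansive//.
  by rewrite mulr_gt0// invr_gt0.
have [h xicvg] : exists h : 'rV[R]_n, xi @ F --> h.
  apply: (@ultra_matrix_cvg R 1 n nat F xi (1 + dot H H) UF) => a j.
  rewrite ord1.
  have : \forall i \near F, dot (Y i) (Y i) <= dot H H + 1.
    have := cvg_dot Ycvg Ycvg; move/(_ _)/cvgrPdist_le/(_ 1 ltr01).
    by apply: filterS => i; rewrite distrC => /(le_trans (ler_norm _)); lra.
  apply: filterS => i HY.
  have : xi i 0 j ^+ 2 <= 1 + dot H H.
    rewrite addrC; apply: le_trans HY; apply: le_trans (dxi i).
    rewrite [leRHS]mxdotE big_ord1 (bigD1 j)//= -expr2 lerDl sumr_ge0// => ? _.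
    by rewrite -expr2 sqr_ge0.
  have := dot_ge0 H; rewrite -(real_normK (num_real (xi i 0 j))).
  have := normr_ge0 (xi i 0 j); set a0 := `|_|; nra.
have [Pi GPi [PiP PPi]] := G_inv sys GP.
have Lcvg : (fun i => (t i)^-1 *: (Pi (P_ i (Dg xb)) - Dg xb)) @ F -->
    Pi H - Dg h.
  have c1 : (fun i => Pi (Y i - P_ i (Dg (xi i)))) @ F --> Pi (H - P (Dg h)).
    apply: G_cvg1 => //; apply: cvgB => //; apply: G_cvg => //.
    exact: cvg_Dg.
  have fE : (fun i => Pi (Y i - P_ i (Dg (xi i)))) =
      (fun i => (t i)^-1 *: (Pi (P_ i (Dg xb)) - Dg xb)).
    apply: funext => i.
    rewrite -{2}(PiP (Dg xb)) XbE -GB// -GZ//; congr (Pi _).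
    have -> : Dg (xi i) = (t i)^-1 *: (Dg (lam (X' i)) - Dg xb).
      by rewrite /xi linearZ /= linearB.
    by rewrite (GZ _ _ (GP_ i)) (GB _ _ (GP_ i)) -X'E /Y; lincomb R.
  by move: c1; rewrite fE GB// PiP.
have [k Kk kE] : exists2 k, K k & k (Dg xb) = Pi H - Dg h.
  exact: (orbit_tangent sys UF (spectral_decomposition Xb).1 (fun i => G_comp sys GPi (GP_ i)) t0 tcvg Lcvg).
exists P, h, k; split=> //.
  by rewrite kE subrK PPi.
have -> : (fun i => (t i)^-1 *: (lam (Xb + t i *: H_ i) - lam Xb)) =
    (fun i => xi i + (t i)^-1 *: (lam (X i) - lam (X' i))).
  by apply: funext => i; rewrite /xi /xb; lincomb R.
rewrite -[h in _ --> h]addr0; apply: cvgD => //.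
apply: cvg_dot0; under eq_fun do rewrite subr0.
have cq : (fun i => q i * q i * dot V V) @ F --> (0 : R).
  suff : (fun i => q i * q i * dot V V) @ F --> 0 * 0 * dot V V.
    by rewrite !mul0r.
  by apply: cvgMr_tmp; apply: cvgM.
apply: (squeeze_cvgr _ (cvg_cst 0) cq); apply: nearW => i; rewrite dot_ge0/=.
rewrite !(dotZl, dotZr).
have := lam_nonexpansive (X i) (X' i).
have -> : X i - X' i = - ((t i * q i) *: V) by rewrite /X'; lincomb R.
rewrite dotNl dotNr opprK dotZl dotZr => N.
rewrite mulrA -ler_pdivlMl; last by rewrite mulr_gt0// invr_gt0.
apply: le_trans N _; rewrite le_eqVlt; apply/predU1P; left.
by field; rewrite gt_eqF.
Qed.

Lemma G_Dg_bound : exists2 c : R, 0 < c &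
  forall U u, G U -> `|U (Dg u)| <= c * `|u|.
Proof.
have [c c0 cP] := @dot_norm R E.
have [d d0 dP] := @dot_norm R 'rV[R]_n.
exists (Num.sqrt (c * d)) => [|U u GU]; first by rewrite sqrtr_gt0 mulr_gt0.
rewrite -(@ler_pXn2r _ 2)// ?nnegrE ?mulr_ge0 ?sqrtr_ge0//.
rewrite exprMn sqr_sqrtr; last by rewrite mulr_ge0 ?ltW.
have [H _] := cP (U (Dg u)); apply: le_trans H _.
rewrite (G_dot sys)// (dot_Dg sys) -mulrA ler_pM2l//.
by have [_] := dP u.
Qed.

(** The trace inequality applied to [P (U (t i) (Dg (lam V)))] in place of [V],
    where [U] is the curve of velocity [k]: turning [V] together with the frames
    of [Xb + t i H_ i] gains the second-order term [r]. *)
Lemma trace_inequality_curve (F : set_system nat) (FF : ProperFilter F)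
    (t : nat -> R) (H_ : nat -> E) (H : E) (P k : E -> E) (h : 'rV[R]_n) (r : R) :
  (forall i, 0 < t i) -> t @ F --> (0 : R) -> H_ @ F --> H ->
  G P -> K k -> P (Dg (lam V)) = V -> P (Dg (lam Xb)) = Xb ->
  H = P (k (Dg (lam Xb)) + Dg h) ->
  r < dot (k (Dg (lam V))) (k (Dg (lam Xb))) ->
  \forall i \near F, dot V (Xb + t i *: H_ i) + t i ^+ 2 / 2 * r <=
    dot (lam V) (lam (Xb + t i *: H_ i)).
Proof.
move=> t0 tcvg Hcvg GP Kk VE XbE HE rq.
have [U GU Ucurve] := K_curve sys Kk.
have [Pi GPi [PiP PPi]] := G_inv sys GP.
pose v := lam V; pose xb := lam Xb.
pose r_ s := (s ^+ 2)^-1 *: (U s (Dg v) - Dg v - s *: k (Dg v)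
  - (s ^+ 2 / 2) *: k (k (Dg v))).
have tcvg' : t @ F --> (0 : R)^'+.
  move=> A A0; have := tcvg _ A0; rewrite /nbhs/=.
  by apply: filterS => i /= Ai; apply: Ai; exact: t0.
have rcvg : (fun i => r_ (t i)) @ F --> (0 : E).
  exact: (cvg_comp _ _ tcvg' (Ucurve (Dg v))).
pose X i := Xb + t i *: H_ i.
have Xcvg : X @ F --> Xb.
  rewrite -[Xb in _ --> Xb]addr0 -(scale0r H).
  by apply: cvgD; [exact: cvg_cst | exact: cvgZ].
have PiH : Pi H = k (Dg xb) + Dg h by rewrite HE PiP.
have PiXb : Pi Xb = Dg xb by rewrite -XbE PiP.
pose e i := dot (k (Dg v)) (Pi (H_ i)) + 2^-1 * dot (k (k (Dg v))) (Dg xb)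
   + t i * (2^-1 * dot (k (k (Dg v))) (Pi (H_ i))) + dot (r_ (t i)) (Pi (X i)).
have ecvg : e @ F --> dot (k (Dg v)) (Pi H) + 2^-1 * dot (k (k (Dg v))) (Dg xb)
   + 0 * (2^-1 * dot (k (k (Dg v))) (Pi H)) + dot (0 : E) (Pi Xb).
  have PiHc : (fun i => Pi (H_ i)) @ F --> Pi H by exact: G_cvg1.
  apply: cvgD; last by apply: cvg_dot => //; exact: G_cvg1.
  apply: cvgD; last first.
    apply: cvgM => //; apply: cvgMl_tmp; apply: cvg_dot => //; exact: cvg_cst.
  apply: cvgD; last exact: cvg_cst.
  by apply: cvg_dot => //; exact: cvg_cst.
have elim : dot (k (Dg v)) (Pi H) + 2^-1 * dot (k (k (Dg v))) (Dg xb)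
   + 0 * (2^-1 * dot (k (k (Dg v))) (Pi H)) + dot (0 : E) (Pi Xb) =
   dot (k (Dg v)) (k (Dg xb)) / 2.
  by rewrite PiH dotDr (K_Dg_orth sys)// dot0l (K_skew sys (k (Dg v)))//; field.
rewrite {}elim in ecvg.
have r2 : 0 < dot (k (Dg v)) (k (Dg xb)) / 2 - r / 2 by rewrite subr_gt0 ltr_pM2r.
have er : \forall i \near F, r / 2 <= e i.
  move/cvgrPdist_le: ecvg => /(_ _ r2); apply: filterS => i.
  by move=> /(le_trans (ler_norm _)); lra.
apply: filterS er => i er.
have f1 : dot (P (U (t i) (Dg v))) (X i) <= dot v (lam (X i)).
  apply: le_trans (trace_inequality _ _) _.
  rewrite lam_G// lam_G// (_ : lam (Dg v) = v)//.
  by rewrite -(lam_G _ GP) VE.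
apply: le_trans f1.
have ti := t0 i.
have UE : U (t i) (Dg v) = Dg v + t i *: k (Dg v)
    + (t i ^+ 2 / 2) *: k (k (Dg v)) + t i ^+ 2 *: r_ (t i).
  by rewrite /r_; lincomb_coefs R; field; rewrite gt_eqF.
have PX : Pi (X i) = Dg xb + t i *: Pi (H_ i).
  by rewrite /X (GD _ _ GPi) (GZ _ _ GPi) PiXb.
have -> : dot (P (U (t i) (Dg v))) (X i) = dot (U (t i) (Dg v)) (Pi (X i)).
  by rewrite -(G_dot sys (U (t i) _) _ GP) PPi.
have -> : dot V (Xb + t i *: H_ i) = dot (Dg v) (Pi (X i)).
  by rewrite -(G_dot sys (Dg v) _ GP) PPi VE.
rewrite UE.
have -> : dot (Dg v + t i *: k (Dg v) + (t i ^+ 2 / 2) *: k (k (Dg v))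
   + t i ^+ 2 *: r_ (t i)) (Pi (X i)) = dot (Dg v) (Pi (X i)) + t i ^+ 2 * e i.
  rewrite 3!dotDl 3!dotZl /e {2 3}PX !dotDr !dotZr (K_Dg_orth sys)//.
  by field.
rewrite lerD2l -mulrA ler_pM2l ?exprn_gt0// mulrC; lra.
Qed.

(** The second-order coefficient of [U s (Dg (x + s h + s^2/2 w))], whose velocity
    is [k (Dg x) + Dg h]. *)
Lemma spectral_curve_cvg (k : E -> E) (U : R -> E -> E) (x h w : 'rV[R]_n) :
  (forall X, (fun s => (s ^+ 2)^-1 *:
     (U s X - X - s *: k X - (s ^+ 2 / 2) *: k (k X))) @ 0^'+ --> (0 : E)) ->
  (fun s => (2 / s ^+ 2) *: (U s (Dg x) - Dg x - s *: k (Dg x))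
    + (2 / s) *: (U s (Dg h) - Dg h) + U s (Dg w)) @ 0^'+ -->
  k (k (Dg x)) + 2 *: k (Dg h) + Dg w.
Proof.
move=> Uc.
pose r_ X s := (s ^+ 2)^-1 *: (U s X - X - s *: k X - (s ^+ 2 / 2) *: k (k X)).
have t0 : (fun s : R => s) @ 0^'+ --> (0 : R) by exact: cvg_at_right_filter.
have c1 : (fun s => k (k (Dg x)) + 2 *: r_ (Dg x) s) @ 0^'+ -->
    k (k (Dg x)) + (2 : R) *: (0 : E).
  by apply: cvgD; [exact: cvg_cst | apply: cvgZl_tmp; exact: Uc].
have c2 : (fun s => (2 *: k (Dg h) + s *: k (k (Dg h)))
    + (2 * s) *: r_ (Dg h) s) @ 0^'+ -->
    (2 *: k (Dg h) + (0 : R) *: k (k (Dg h))) + (2 * 0 : R) *: (0 : E).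
  apply: cvgD; first by apply: cvgD; [exact: cvg_cst | exact: cvgZr_tmp].
  by apply: cvgZ; [exact: cvgMl_tmp | exact: Uc].
have c3 : (fun s => (Dg w + s *: k (Dg w) + (s ^+ 2 / 2) *: k (k (Dg w)))
    + s ^+ 2 *: r_ (Dg w) s) @ 0^'+ -->
    (Dg w + (0 : R) *: k (Dg w) + (0 ^+ 2 / 2 : R) *: k (k (Dg w)))
      + (0 ^+ 2 : R) *: (0 : E).
  have s2 : (fun s : R => s ^+ 2) @ 0^'+ --> (0 ^+ 2 : R) by apply: cvgM.
  apply: cvgD; last by apply: cvgZ => //; exact: Uc.
  apply: cvgD; last by apply: cvgZr_tmp; exact: cvgMr_tmp.
  by apply: cvgD; [exact: cvg_cst | exact: cvgZr_tmp].
have /(_ _ _) := cvgD (cvgD c1 c2) c3.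
rewrite expr0n !(mul0r, mulr0, scale0r, scaler0, addr0).
apply: cvg_trans; apply: near_eq_cvg; near=> s; have s0 : 0 < s by [].
by rewrite /= !fctE /r_; lincomb_coefs R; field; rewrite gt_eqF.
Unshelve. all: by end_near. Qed.

(** By [trace_inequality_curve], the points [x i = lam (Xb + t i H_ i)] have
    heights [y i] over them in [epi g] whose second-order coefficient is
    [<v, .> + c - q0], where [q0] is the gain of the turn.  Second-order
    regularity replaces this sequence by parabolas [xb + s h + s^2/2 u1] in
    [epi g].  They are lifted to [P (U s (Dg ...))], and the turn [U s] adds
    [- q0] to the product of [V] with the second-order coefficient, which
    cancels the gain. *)
Theorem spectral_parabolic_regular (t : nat -> R) (H_ : nat -> E) (H : E)
    (c eps : R) :
  (forall k, 0 < t k) -> t @ \oo --> (0 : R) -> H_ @ \oo --> H ->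
  (\forall k \near \oo, (theta (Xb + t k *: H_ k)%R <=
    theta Xb + (dot V (t k *: H_ k) + t k ^+ 2 / 2 * c)%:E)%E) ->
  0 < eps -> exists W, forall delta : R, 0 < delta -> \forall s \near 0^'+,
    exists2 W', `|W' - W| <= delta &
      (theta (Xb + s *: H + (s ^+ 2 / 2) *: W')%R <= theta Xb +
        (s * dot V H + s ^+ 2 / 2 * (dot V W + c + eps))%:E)%E.
Proof.
move=> t0 tcvg0 Hcvg0 thetaH0 e0.
have [F [UF oF]] := @ultraFilterLemma nat \oo _.
have tcvg : t @ F --> (0 : R) by move=> A /tcvg0; exact: oF.
have Hcvg : H_ @ F --> H by move=> A /Hcvg0; exact: oF.
have thetaH := oF _ thetaH0.
have [P [h [k [[GP Kk] VE XbE HE xicvg]]]] :=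
  limiting_frame UF t0 tcvg Hcvg thetaH.
pose v := lam V; pose xb := lam Xb.
rewrite -/v -/xb in VE XbE HE xicvg.
have [thfin _] := VP.
pose gamma := fine (theta Xb).
have gE : theta Xb = gamma%:E by rewrite fineK.
pose q0 := dot (k (Dg v)) (k (Dg xb)).
have rq : q0 - eps / 4 < q0 by rewrite ltrBlDr ltrDl divr_gt0.
have PF : ProperFilter F := @ultra_proper _ F UF.
have trace := trace_inequality_curve PF t0 tcvg Hcvg GP Kk VE XbE HE rq.
pose c' := c - q0 + eps / 4.
pose x i := lam (Xb + t i *: H_ i).
pose y i : R^o := gamma + (dot v (x i - xb) + t i ^+ 2 / 2 * c').
have vxb : dot v xb = dot V Xb.
  by rewrite -(dot_Dg sys) -(G_dot sys _ _ GP) VE XbE.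
have epiz : \forall i \near F, epi g (x i, y i).
  apply: filterS2 trace thetaH => i; rewrite -/v -/(x i) => tr th.
  rewrite /epi/= /x -thetaE; apply: le_trans th _.
  rewrite gE -EFinD lee_fin /y lerD2l dotBr vxb /c'.
  by move: tr; rewrite dotDr -/(x i); lra.
have zcvg : (fun i => (t i)^-1 *: ((x i, y i) - (xb, gamma) : 'rV[R]_n * R^o))
    @ F --> ((h, dot v h : R^o) : 'rV[R]_n * R^o).
  have c2 : (fun i => (dot v ((t i)^-1 *: (x i - xb)) + t i * (c' / 2) : R^o))
      @ F --> (dot v h + 0 * (c' / 2) : R^o).
    apply: cvgD; last exact: cvgMr_tmp.
    by apply: cvg_dot => //; exact: cvg_cst.
  rewrite mul0r addr0 in c2.
  have c3 : (fun i => ((t i)^-1 *: (x i - xb),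
      dot v ((t i)^-1 *: (x i - xb)) + t i * (c' / 2) : R^o) : 'rV[R]_n * R^o)
      @ F --> ((h, dot v h : R^o) : 'rV[R]_n * R^o).
    exact: (cvg_pair xicvg c2).
  apply: cvg_trans c3; apply: near_eq_cvg.
  apply: nearW => i /=; congr (_, _); rewrite /y dotZr /GRing.scale/=.
  by field; rewrite gt_eqF.
have [M M0 MP] : exists2 M : R, 0 < M & forall u : 'rV[R]_n, `|dot v u| <= M * `|u|.
  have [C C0 CP] := @dot_bound R 'rV[R]_n.
  exists (C * `|v| + 1) => [|u]; first by rewrite ltr_wpDl// mulr_ge0// ltW.
  by apply: le_trans (CP v u) _; rewrite ler_wpM2r// lerDl.
pose eps1 := eps / (4 * (M + 1)).
have M1 : 0 < M + 1 by rewrite addr_gt0.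
have e10 : 0 < eps1 by rewrite divr_gt0// mulr_gt0.
have gfin : fine (g (lam Xb)) = gamma by rewrite /gamma thetaE.
have greg' := greg; rewrite gfin in greg'.
have near_w := greg' F PF t (fun i => (x i, y i)) _ t0 tcvg epiz zcvg eps1 e10.
have [i [w wle winner]] := @filter_ex _ F PF _ near_w.
move: w wle winner => [w1 w2] wle winner.
have w2le : w2 <= dot v w1 + c - q0 + eps / 2.
  move: wle; rewrite ge_max => /andP[/= wle1 wle2].
  set u1 := _ *: _ in wle1; set u2 := _ *: _ in wle2.
  have u2E : u2 = dot v u1 + c'.
    rewrite /u2 /u1 /y /GRing.scale/= !(dotZr, dotBr).
    by field; rewrite gt_eqF.
  have d1 : dot v u1 - dot v w1 <= M * eps1.
    rewrite -dotBr; apply: le_trans (ler_norm _) _; apply: le_trans (MP _) _.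
    by rewrite ler_pM2l// distrC.
  have d2 : w2 - u2 <= eps1 by apply: le_trans (ler_norm _) wle2.
  have d3 : (M + 1) * eps1 = eps / 4 by rewrite /eps1; field; rewrite gt_eqF.
  by move: d3 d2 d1; rewrite u2E /c'; lra.
have [U GU Uc] := K_curve sys Kk.
pose W := P (k (k (Dg xb)) + 2 *: k (Dg h) + Dg w1).
have VW : dot V W = dot v w1 - q0.
  rewrite /W -VE (G_dot sys)// !dotDr dotZr (dot_Dg sys).
  rewrite -(dotC (k (Dg h))) (K_Dg_orth sys)//.
  have := K_skew sys (Dg v) (k (Dg xb)) Kk; rewrite -/q0 => ->; ring.
have VH : dot V H = dot v h.
  rewrite HE -VE (G_dot sys)// dotDr (dot_Dg sys) -(dotC (k _)).
  by rewrite (K_Dg_orth sys)// add0r.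
exists W => delta d0.
have [B B0 BP] := G_Dg_bound.
have [B' B'0 B'P] := G_bound.
pose delta1 := Num.min (eps / 4) (delta / (2 * B)).
have d10 : 0 < delta1 by rewrite lt_min !divr_gt0// mulr_gt0.
have Wc := spectral_curve_cvg (x := xb) (h := h) (w := w1) Uc.
have B'd : 0 < delta / (2 * B') by rewrite divr_gt0// mulr_gt0.
near=> s; have s0 : 0 < s by [].
have [[u1 u2] ule epiu] : exists2 w', `|w' - (w1, w2)| <= delta1 &
   epi g ((xb, gamma) + s *: (h, dot v h : R^o) + (s ^+ 2 / 2) *: w').
  by near: s; exact: winner.
have Wcs : `|k (k (Dg xb)) + 2 *: k (Dg h) + Dg w1 - ((2 / s ^+ 2) *:
    (U s (Dg xb) - Dg xb - s *: k (Dg xb))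
    + (2 / s) *: (U s (Dg h) - Dg h) + U s (Dg w1))| <= delta / (2 * B').
  by near: s; move/cvgrPdist_le: Wc; apply.
pose a := xb + s *: h + (s ^+ 2 / 2) *: u1.
pose W' := (2 / s ^+ 2) *: (P (U s (Dg a)) - Xb - s *: H).
have XE : Xb + s *: H + (s ^+ 2 / 2) *: W' = P (U s (Dg a)).
  by rewrite /W'; lincomb_coefs R; field; rewrite gt_eqF.
move: ule; rewrite ge_max => /andP[/= ule1 ule2].
exists W'.
  have -> : W' - W = P ((2 / s ^+ 2) *: (U s (Dg xb) - Dg xb - s *: k (Dg xb))
     + (2 / s) *: (U s (Dg h) - Dg h) + U s (Dg w1)
     - (k (k (Dg xb)) + 2 *: k (Dg h) + Dg w1)) + P (U s (Dg (u1 - w1))).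
    have GUs := GU s.
    have -> : W' = P ((2 / s ^+ 2) *:
        (U s (Dg a) - Dg xb - s *: (k (Dg xb) + Dg h))).
      by rewrite (GZ _ _ GP) 2!(GB _ _ GP) (GZ _ _ GP) XbE -HE.
    rewrite /W -(GB _ _ GP) -(GD _ _ GP); congr (P _).
    have -> : Dg a = Dg xb + s *: Dg h + (s ^+ 2 / 2) *: Dg u1.
      by rewrite /a !linearD !linearZ.
    have -> : Dg (u1 - w1) = Dg u1 - Dg w1 by rewrite linearB.
    rewrite 2!(GD _ _ GUs) 2!(GZ _ _ GUs) (GB _ _ GUs).
    by lincomb_coefs R; field; rewrite gt_eqF.
  apply: le_trans (ler_normD _ _) _; rewrite [delta]splitr; apply: lerD.
    apply: le_trans (B'P _ _ GP) _; rewrite distrC -ler_pdivlMl//.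
    have -> : B'^-1 * (delta / 2) = delta / (2 * B').
      by field; rewrite gt_eqF.
    exact: Wcs.
  apply: le_trans (BP (P \o U s) _ (G_comp sys GP (GU s))) _.
  rewrite -ler_pdivlMl//; apply: le_trans ule1 _.
  rewrite /delta1 ge_min; apply/orP; right.
  have -> : B^-1 * (delta / 2) = delta / (2 * B) by field; rewrite gt_eqF.
  exact: lexx.
rewrite XE (theta_G_Dg _ (G_comp sys GP (GU s))).
move: epiu; rewrite /epi/= -/a => /le_trans; apply.
rewrite gE -EFinD lee_fin -addrA lerD2l VH /GRing.scale/= lerD2l.
rewrite ler_pM2l ?divr_gt0 ?exprn_gt0// VW.
have : u2 - w2 <= eps / 4.
  apply: le_trans (ler_norm _) _; apply: le_trans ule2 _.
  by rewrite ge_min lexx.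
lra.
Unshelve. all: by end_near. Qed.

End ParabolicRegularity.

End SpectralSystem.

(** * Orthogonal and skew-symmetric matrices *)

Section MatrixLimits.
Variable R : realType.

Lemma cvg_mulmx m n p (T : Type) (F : set_system T) (FF : Filter F)
    (f : T -> 'M[R]_(m, n)) (g : T -> 'M[R]_(n, p)) (A : 'M[R]_(m, n)) (B : 'M[R]_(n, p)) :
  f @ F --> A -> g @ F --> B -> (fun k => f k *m g k) @ F --> A *m B.
Proof.
move=> fA gB; apply: matrix_cvg => i j.
under eq_fun do rewrite mxE; rewrite mxE.
apply: (@cvg_finsum R T F FF R^o) => l.
by apply: cvgM; apply: matrix_cvg_entry.
Qed.

Lemma cvg_trmx m n (T : Type) (F : set_system T) (FF : Filter F)
    (f : T -> 'M[R]_(m, n)) (A : 'M[R]_(m, n)) :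
  f @ F --> A -> (fun k => (f k)^T) @ F --> A^T.
Proof.
move=> fA; apply: matrix_cvg => i j; under eq_fun do rewrite mxE.
by rewrite mxE; apply: matrix_cvg_entry.
Qed.

End MatrixLimits.

Section Orthogonal.
Variables (R : realType) (n : nat).
Implicit Types A B : 'M[R]_n.

Definition orthogonal_mx A := A *m A^T = 1%:M.

Lemma orthogonal_tr A : orthogonal_mx A -> A^T *m A = 1%:M.
Proof. exact: mulmx1C. Qed.

Lemma orthogonal1 : orthogonal_mx 1%:M.
Proof. by rewrite /orthogonal_mx trmx1 mulmx1. Qed.

Lemma orthogonalT A : orthogonal_mx A -> orthogonal_mx A^T.
Proof. by move=> /orthogonal_tr; rewrite /orthogonal_mx trmxK. Qed.

Lemma orthogonalM A B : orthogonal_mx A -> orthogonal_mx B ->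
  orthogonal_mx (A *m B).
Proof.
rewrite /orthogonal_mx => oA oB.
by rewrite trmx_mul mulmxA -(mulmxA A) oB mulmx1.
Qed.

Lemma orthogonal_tperm i j : orthogonal_mx (tperm_mx i j).
Proof.
by rewrite /orthogonal_mx /tperm_mx tr_perm_mx tpermV -perm_mxM tperm2 perm_mx1.
Qed.

Lemma orthogonal_entry_le A i j : orthogonal_mx A -> `|A i j| <= 1.
Proof.
move=> oA; have := congr1 (fun M : 'M[R]_n => M i i) oA.
rewrite !mxE eqxx => E.
rewrite -(@ler_pXn2r _ 2)// ?nnegrE// expr1n -[leRHS]E.
rewrite (bigD1 j)//= !mxE -expr2 real_normK ?num_real// lerDl sumr_ge0// => l _.
by rewrite mxE -expr2 sqr_ge0.
Qed.

Lemma orthogonal_compact (F : set_system nat) (A : nat -> 'M[R]_n) :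
  UltraFilter F -> (forall k, orthogonal_mx (A k)) ->
  exists2 B, orthogonal_mx B & A @ F --> B.
Proof.
move=> UF oA; have [|B AB] := @ultra_matrix_cvg R n n nat F A 1 UF.
  by move=> i j; apply: nearW => k; exact: orthogonal_entry_le.
have PF := @ultra_proper _ F UF.
exists B => //; have H := cvg_mulmx _ AB (cvg_trmx _ AB).
have {}H : (fun k => A k *m (A k)^T) @ F --> B *m B^T by exact: H.
have E : (fun k => A k *m (A k)^T) = fun=> 1%:M by apply: funext => k; exact: oA.
rewrite E in H.
have H1 : (fun=> 1%:M) @ F --> (1%:M : 'M[R]_n) by exact: cvg_cst.
exact: (cvg_unique _ H H1).
Qed.

Definition skew_mx A := A^T = - A.

Lemma skew_unit A : skew_mx A -> 1%:M - A \in unitmx.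
Proof.
move=> sA; rewrite -row_free_unit -kermx_eq0; apply/rowV0P => v.
move=> /sub_kermxP; rewrite mulmxBr mulmx1 => /subr0_eq vA.
have E : mxdot v v = - mxdot v v.
  rewrite {1}vA /mxdot -mulmxA -mxtrace_tr !trmx_mul trmxK.
  by move: sA; rewrite /skew_mx => ->; rewrite mulmxN mulNmx -vA linearN.
by apply: (@dot_eq0 R 'rV[R]_n); move: E; rewrite /dot/=; lra.
Qed.

(** The Cayley transform [(1 + t A / 2) (1 - t A / 2)^-1], an algebraic
    substitute for the exponential; iterating [C = 1 + N + C N] with
    [N = t A / 2] gives its expansion. *)
Lemma cayley A : skew_mx A -> exists C : R -> 'M[R]_n,
  (forall t, orthogonal_mx (C t)) /\
  forall t, C t = 1%:M + t *: A + (t ^+ 2 / 2) *: (A *m A)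
    + (t ^+ 3 / 8) *: ((1%:M + C t) *m A *m A *m A).
Proof.
move=> sA; pose N t := (t / 2) *: A.
have sN t : (N t)^T = - N t.
  by rewrite /N linearZ /= sA scalerN.
have uN t : 1%:M - N t \in unitmx by exact: skew_unit.
pose C t := (1%:M + N t) *m invmx (1%:M - N t).
have CN t : C t *m (1%:M - N t) = 1%:M + N t by rewrite mulmxKV.
clearbody C.
have NT t : (1%:M - N t)^T = 1%:M + N t.
  by rewrite linearB /= trmx1 sN opprK.
have NT' t : (1%:M + N t)^T = 1%:M - N t by rewrite linearD /= trmx1 sN.
exists C; split=> t.
  suff : (C t)^T *m C t = 1%:M by move=> /mulmx1C.
  have H : (1%:M - N t)^T *m ((C t)^T *m C t) *m (1%:M - N t) =
           (1%:M - N t)^T *m (1%:M - N t).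
    rewrite -!mulmxA CN mulmxA -trmx_mul CN NT NT'.
    by rewrite !(mulmxDl, mulmxDr, mulmxBl, mulmxBr, mulNmx, mulmxN, mulmx1, mul1mx);
       lincomb R.
  have uT : (1%:M - N t)^T \in unitmx by rewrite unitmx_tr.
  move/(congr1 (mulmx (invmx (1%:M - N t)^T))): H.
  rewrite -!mulmxA !mulKmx// => /(congr1 (mulmx^~ (invmx (1%:M - N t)))).
  by rewrite mulmxA mulmxK// mulmxV.
have C1 : C t = 1%:M + N t + C t *m N t.
  have := CN t; rewrite mulmxBr mulmx1 => <-; lincomb R.
have C2 : C t = 1%:M + 2 *: N t + N t *m N t + C t *m N t *m N t.
  rewrite {1}C1 {1}C1 !mulmxDl mul1mx; lincomb R.
have C3 : C t = 1%:M + 2 *: N t + 2 *: (N t *m N t) + (1%:M + C t) *m N t *m N t *m N t.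
  rewrite {1}C2 {1}C1 !(mulmxDl, mul1mx); lincomb R.
rewrite {1}C3 /N -!(scalemxAl, scalemxAr) !scalerA.
by lincomb_coefs R; field.
Qed.

Lemma char_poly_orthogonal A (M : 'M[R]_n) : orthogonal_mx A ->
  char_poly (A *m M *m A^T) = char_poly M.
Proof.
move=> oA; rewrite /char_poly.
have -> : char_poly_mx (A *m M *m A^T) =
    map_mx polyC A *m char_poly_mx M *m map_mx polyC A^T.
  rewrite /char_poly_mx !map_mxM /= mulmxBr mulmxBl; congr (_ - _).
  by rewrite scalar_mxC -mulmxA -map_mxM oA /= map_mx1 mulmx1.
rewrite !det_mulmx mulrC mulrA -det_mulmx -map_mxM.
by rewrite (orthogonal_tr oA) map_mx1 det1 mul1r.
Qed.

Lemma char_poly_diag (y : 'rV[R]_n) :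
  char_poly (diag_mx y) = \prod_i ('X - (y 0 i)%:P).
Proof.
rewrite char_poly_trig ?diag_mx_is_trig//.
by apply: eq_bigr => i _; rewrite mxE eqxx mulr1n.
Qed.

Lemma prod_XsubC_perm (x y : 'rV[R]_n) :
  \prod_i ('X - (x 0 i)%:P) = \prod_i ('X - (y 0 i)%:P) ->
  exists s : 'S_n, forall i, x 0 i = y 0 (s i).
Proof.
move=> E.
have /tuple_permP[s sE] : perm_eq [seq x 0 i | i <- enum 'I_n]
    [tuple y 0 i | i < n].
  apply: (@prod_XsubC_eq R); rewrite /= !big_map.
  by move: E; rewrite -!big_enum /=.
exists s => i.
have := congr1 (fun u => nth 0 u i) sE.
rewrite /= (nth_map i) ?size_enum_ord// nth_ord_enum.
rewrite (nth_map i) ?size_enum_ord// nth_ord_enum.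
by rewrite tnth_map tnth_ord_tuple.
Qed.

(** A sorted sequence is determined by its multiset of entries. *)
Lemma nonincreasing_row_perm (x y : 'rV[R]_n) (s : 'S_n) :
  nonincreasing_row x -> nonincreasing_row y ->
  (forall i, x 0 i = y 0 (s i)) -> x = y.
Proof.
move=> xs ys xy.
have sorted_row (v : 'rV[R]_n) : nonincreasing_row v ->
    sorted (>=%R) [seq v 0 i | i <- enum 'I_n].
  move=> vs; rewrite sorted_map.
  apply: (@sub_sorted _ (fun i j : 'I_n => (i <= j)%N)); first by move=> i j /vs.
  have := iota_sorted 0 n; rewrite -val_enum_ord sorted_map.
  by [].
have E : [seq x 0 i | i <- enum 'I_n] = [seq y 0 i | i <- enum 'I_n].
  apply: (sorted_eq (leT := >=%R)).
  - exact: ge_trans.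
  - by move=> a b /= /andP[ba ab]; apply/eqP; rewrite eq_le ba ab.
  - exact: sorted_row.
  - exact: sorted_row.
  have -> : [seq x 0 i | i <- enum 'I_n] = [tuple tnth [tuple y 0 i | i < n] (s i) | i < n].
    by apply: eq_map => i; rewrite tnth_map tnth_ord_tuple.
  by apply/(@tuple_permP _ n _ [tuple y 0 i | i < n]); exists s.
apply/rowP => i; have := congr1 (fun u => nth 0 u i) E.
by rewrite /= (nth_map i) ?size_enum_ord// (nth_map i) ?size_enum_ord// nth_ord_enum.
Qed.

Lemma eigenvalues_diag A (y : 'rV[R]_n) : orthogonal_mx A ->
  nonincreasing_row y -> eigenvalues (A *m diag_mx y *m A^T) = y.
Proof.
move=> oA ys; rewrite /eigenvalues; case: xgetP => [v _ [vs vE]|/(_ y)[]].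
  move: vE; rewrite char_poly_orthogonal// char_poly_diag.
  move=> /esym/prod_XsubC_perm[s vy].
  exact: nonincreasing_row_perm vy.
by split=> //; rewrite char_poly_orthogonal// char_poly_diag.
Qed.

End Orthogonal.

(** * Pairs of orthogonal matrices acting on matrices *)

Section MatrixActions.
Variable R : realType.

Lemma cayley_cvg p (a : 'M[R]_p) : skew_mx a -> exists A : R -> 'M[R]_p,
  (forall t, orthogonal_mx (A t)) /\ exists2 r : R -> 'M[R]_p,
  r @ 0^'+ --> (0 : 'M[R]_p) &
  forall t, A t = 1%:M + t *: a + (t ^+ 2 / 2) *: (a *m a) + t ^+ 2 *: r t.
Proof.
move=> /cayley[A [oA AE]]; exists A; split=> //.
exists (fun t => ((t / 8) *: (1%:M + A t)) *m (a *m a *m a)) => [|t]; last first.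
  rewrite {1}AE; congr (_ + _); rewrite -scalemxAl scalerA !mulmxA.
  by congr (_ *: _); ring.
rewrite -(mul0mx _ (a *m a *m a)); apply: cvg_mulmx; last exact: cvg_cst.
apply: matrix_cvg => i j; rewrite mxE.
apply/cvgr0Pnorm_le => eps e0.
near=> t; have t0 : 0 < t by [].
rewrite !mxE normrM ger0_norm ?divr_ge0 ?(ltW t0)//.
have h : `|(i == j)%:R + A t i j| <= 2.
  apply: le_trans (ler_normD _ _) _.
  have := orthogonal_entry_le i j (oA t).
  by case: (i == j); rewrite ?normr1 ?normr0; lra.
have t4 : t <= eps by near: t; exact: nbhs_right_le.
apply: le_trans (ler_wpM2l _ h) _; first by rewrite divr_ge0 ?(ltW t0).
lra.
Unshelve. all: by end_near. Qed.

Lemma action_curve_cvg p q (a : 'M[R]_p) (b : 'M[R]_q) (A r : R -> 'M[R]_p)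
    (B s : R -> 'M[R]_q) (X : 'M[R]_(p, q)) :
  skew_mx b ->
  r @ 0^'+ --> (0 : 'M[R]_p) -> s @ 0^'+ --> (0 : 'M[R]_q) ->
  (forall t, A t = 1%:M + t *: a + (t ^+ 2 / 2) *: (a *m a) + t ^+ 2 *: r t) ->
  (forall t, B t = 1%:M + t *: b + (t ^+ 2 / 2) *: (b *m b) + t ^+ 2 *: s t) ->
  (fun t => (t ^+ 2)^-1 *: (A t *m X *m (B t)^T - X
     - t *: (a *m X - X *m b) - (t ^+ 2 / 2) *:
       (a *m (a *m X - X *m b) - (a *m X - X *m b) *m b))) @ 0^'+
     --> (0 : 'M[R]_(p, q)).
Proof.
move=> sb r0 s0 AE BE.
have t0 : (fun t : R => t) @ 0^'+ --> (0 : R) by exact: cvg_at_right_filter.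
have t2 : (fun t : R => t ^+ 2 / 2) @ 0^'+ --> (0 ^+ 2 / 2 : R).
  by apply: cvgMr_tmp; apply: cvgM.
pose T t := 1%:M + t *: a + (t ^+ 2 / 2) *: (a *m a).
have Tc : T @ 0^'+ --> 1%:M + 0 *: a + (0 ^+ 2 / 2) *: (a *m a).
  apply: cvgD; last exact: cvgZr_tmp.
  by apply: cvgD; [exact: cvg_cst | exact: cvgZr_tmp].
have c1 : (fun t => r t *m (X *m (B t)^T)) @ 0^'+ --> (0 : 'M[R]_(p, q)).
  have Bc : B @ 0^'+ --> 1%:M + 0 *: b + (0 ^+ 2 / 2) *: (b *m b) + 0 ^+ 2 *: 0.
    rewrite (funext BE); apply: cvgD; last by apply: cvgZ => //; apply: cvgM.
    apply: cvgD; last exact: cvgZr_tmp.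
    by apply: cvgD; [exact: cvg_cst | exact: cvgZr_tmp].
  rewrite -(mul0mx _ (X *m (1%:M + 0 *: b + (0 ^+ 2 / 2) *: (b *m b) + 0 ^+ 2 *: 0)^T)).
  apply: cvg_mulmx => //; apply: cvg_mulmx; first exact: cvg_cst.
  exact: cvg_trmx.
have c2 : (fun t => T t *m X *m (s t)^T) @ 0^'+ --> (0 : 'M[R]_(p, q)).
  rewrite -(mulmx0 _ ((1%:M + 0 *: a + (0 ^+ 2 / 2) *: (a *m a)) *m X)).
  apply: cvg_mulmx; last by rewrite -trmx0; exact: cvg_trmx.
  by apply: cvg_mulmx => //; exact: cvg_cst.
have c3 : (fun t => t *: (2^-1 *: (a *m X *m (b *m b) - a *m a *m X *m b))
   + (t ^+ 2 / 2) *: (2^-1 *: (a *m a *m X *m (b *m b)))) @ 0^'+ -->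
   0 *: (2^-1 *: (a *m X *m (b *m b) - a *m a *m X *m b))
   + (0 ^+ 2 / 2) *: (2^-1 *: (a *m a *m X *m (b *m b))).
  by apply: cvgD; exact: cvgZr_tmp.
have /(_ _ _) := cvgD (cvgD c1 c2) c3.
rewrite expr0n mul0r !scale0r !addr0.
apply: cvg_trans; apply: near_eq_cvg; near=> t; have tp : 0 < t by [].
rewrite /= !fctE {1}AE -/(T t) mulmxDl mulmxDl -!scalemxAl -mulmxA.
have -> : T t *m X *m (B t)^T = T t *m X *m (1%:M + t *: b + (t ^+ 2 / 2) *: (b *m b))^T + t ^+ 2 *: (T t *m X *m (s t)^T).
  by rewrite {1}BE linearD /= linearZ /= mulmxDr -scalemxAr.
have -> : (1%:M + t *: b + (t ^+ 2 / 2) *: (b *m b))^T =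
    1%:M - t *: b + (t ^+ 2 / 2) *: (b *m b).
  rewrite !linearD /= !linearZ /= trmx1 trmx_mul.
  by move: sb; rewrite /skew_mx => ->; rewrite mulmxN mulNmx opprK scalerN.
rewrite /T !(mulmxDl, mulmxDr, mulmxBl, mulmxBr, mulmxN, mulNmx, mul1mx, mulmx1).
rewrite -!(scalemxAl, scalemxAr) !mulmxA.
by lincomb_coefs R; field; rewrite gt_eqF.
Unshelve. all: by end_near. Qed.

Lemma mxdot_orthogonal p q (A : 'M[R]_p) (B : 'M[R]_q) (X Y : 'M[R]_(p, q)) :
  orthogonal_mx A -> orthogonal_mx B ->
  mxdot (A *m X *m B^T) (A *m Y *m B^T) = mxdot X Y.
Proof.
move=> oA oB; rewrite /mxdot !trmx_mul trmxK -!mulmxA (mulmxA B^T).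
by rewrite (orthogonal_tr oB) mul1mx mxtrace_mulC -!mulmxA (orthogonal_tr oA) mulmx1.
Qed.

Lemma mxdotMl p q (a : 'M[R]_p) (X Y : 'M[R]_(p, q)) :
  mxdot (a *m X) Y = mxdot X (a^T *m Y).
Proof. by rewrite /mxdot trmx_mul trmxK -mulmxA mxtrace_mulC mulmxA. Qed.

Lemma mxdotMr p q (b : 'M[R]_q) (X Y : 'M[R]_(p, q)) :
  mxdot (X *m b) Y = mxdot X (Y *m b^T).
Proof. by rewrite /mxdot trmx_mul trmxK mulmxA. Qed.

Lemma mxdot_skew p q (a : 'M[R]_p) (b : 'M[R]_q) (X Y : 'M[R]_(p, q)) :
  skew_mx a -> skew_mx b ->
  mxdot (a *m X - X *m b) Y = - mxdot X (a *m Y - Y *m b).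
Proof.
rewrite /skew_mx => sa sb.
have -> : mxdot (a *m X - X *m b) Y = mxdot (a *m X) Y - mxdot (X *m b) Y.
  exact: (@dotBl R 'M[R]_(p, q)).
have -> : mxdot X (a *m Y - Y *m b) = mxdot X (a *m Y) - mxdot X (Y *m b).
  exact: (@dotBr R 'M[R]_(p, q)).
have dN Z : mxdot X (- Z) = - mxdot X Z by exact: (@dotNr R 'M[R]_(p, q)).
by rewrite mxdotMl mxdotMr sa sb mulNmx mulmxN !dN opprB opprK addrC.
Qed.

Definition pad_row n (x : 'rV[R]_n) (j : nat) : R :=
  oapp (fun i : 'I_n => x 0 i) 0 (insub j).

(** Extension by 0 to all pairs of indices: entries of an n x n, an m x m and an
    n x m matrix at the same indices can then be multiplied without casts. *)
Definition pad_mx p q (A : 'M[R]_(p, q)) (i j : nat) : R :=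
  oapp (fun i' : 'I_p => oapp (fun j' : 'I_q => A i' j') 0 (insub j)) 0 (insub i).

Definition rdiag n m (x : 'rV[R]_n) : 'M[R]_(n, m) :=
  \matrix_(i, j) (if (i == j :> nat) then x 0 i else 0).

Lemma rdiag_linear n m : linear (@rdiag n m).
Proof.
move=> a x y; apply/matrixP => i j; rewrite !mxE.
by case: ifP => // _; rewrite mulr0 addr0.
Qed.

Lemma pad_rowE n (x : 'rV[R]_n) (i : 'I_n) : pad_row x i = x 0 i.
Proof. by rewrite /pad_row valK. Qed.

Lemma pad_row_out n (x : 'rV[R]_n) j : (n <= j)%N -> pad_row x j = 0.
Proof. by move=> nj; rewrite /pad_row insubF// ltnNge nj. Qed.

Lemma pad_mxE p q (A : 'M[R]_(p, q)) (i : 'I_p) (j : 'I_q) : pad_mx A i j = A i j.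
Proof. by rewrite /pad_mx !valK. Qed.

Lemma pad_mx_outl p q (A : 'M[R]_(p, q)) i j : (p <= i)%N -> pad_mx A i j = 0.
Proof.
move=> pi; rewrite /pad_mx; have -> // : insub i = None :> option 'I_p.
by rewrite insubF// ltnNge pi.
Qed.

Lemma pad_mx_outr p q (A : 'M[R]_(p, q)) i j : (q <= j)%N -> pad_mx A i j = 0.
Proof.
move=> qj; rewrite /pad_mx; case: (insub i) => //= i'.
by case: insubP => //= j' jq _; rewrite ltnNge qj in jq.
Qed.

Lemma mulmx_rdiag p n m (A : 'M[R]_(p, n)) (x : 'rV[R]_n) i (j : 'I_m) :
  (A *m rdiag m x) i j = pad_mx A i j * pad_row x j.
Proof.
rewrite mxE; have [jn|nj] := ltnP j n; last first.
  rewrite pad_row_out// mulr0 big1// => l _; rewrite mxE.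
  by rewrite (ltn_eqF (leq_trans (ltn_ord l) nj)) mulr0.
rewrite (_ : (j : nat) = Ordinal jn)// pad_rowE pad_mxE.
rewrite (bigD1 (Ordinal jn))//= mxE eqxx big1 ?addr0// => l lj.
by rewrite mxE; case: eqP => [lj'|_]; rewrite ?mulr0//; case/eqP: lj; exact: val_inj.
Qed.

Lemma rdiag_mulmx n m q (B : 'M[R]_(m, q)) (x : 'rV[R]_n) (i : 'I_n) j :
  (rdiag m x *m B) i j = pad_row x i * pad_mx B i j.
Proof.
rewrite mxE pad_rowE; have [im|mi] := ltnP i m; last first.
  rewrite pad_mx_outl// mulr0 big1// => l _; rewrite mxE.
  by rewrite gtn_eqF ?mul0r//; exact: leq_trans (ltn_ord l) mi.
rewrite [in RHS](_ : (i : nat) = Ordinal im)// pad_mxE.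
rewrite (bigD1 (Ordinal im))//= mxE eqxx big1 ?addr0// => l lj.
rewrite mxE; case: eqP => [lj'|_]; rewrite ?mul0r//; case/eqP: lj.
by apply: val_inj; rewrite /= lj'.
Qed.

Lemma pad_mx_fun p q (f : nat -> nat -> R) i j : (i < p)%N -> (j < q)%N ->
  pad_mx (\matrix_(i < p, j < q) f i j) i j = f i j.
Proof.
move=> ip jq; rewrite -[i in LHS]/(val (Ordinal ip)) -[j in LHS]/(val (Ordinal jq)).
by rewrite pad_mxE mxE.
Qed.

Lemma pad_mxT p q (A : 'M[R]_(p, q)) i j : pad_mx A^T i j = pad_mx A j i.
Proof.
rewrite /pad_mx; case: insubP => [i' _ _|]; case: insubP => //= j' _ _.
by rewrite mxE.
Qed.

Lemma skew_diag p (a : 'M[R]_p) i : skew_mx a -> pad_mx a i i = 0.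
Proof.
move=> sa; have [ip|pi] := ltnP i p; last by rewrite pad_mx_outl.
rewrite -[i]/(val (Ordinal ip)) pad_mxE; set o := Ordinal ip.
have : a^T o o = (- a) o o by rewrite sa.
by rewrite !mxE; lra.
Qed.

Lemma mxdot_rdiag n m (Y : 'M[R]_(n, m)) (x : 'rV[R]_n) :
  mxdot Y (rdiag m x) = \sum_(i < n) pad_mx Y i i * x 0 i.
Proof.
rewrite mxdotE; apply: eq_bigr => i _.
have [im|mi] := ltnP i m; last first.
  rewrite pad_mx_outr// mul0r big1// => l _; rewrite mxE.
  by rewrite gtn_eqF ?mulr0//; exact: leq_trans (ltn_ord l) mi.
rewrite [X in pad_mx _ _ X](_ : (i : nat) = Ordinal im)// pad_mxE.
rewrite (bigD1 (Ordinal im))//= mxE eqxx big1 ?addr0// => l lj.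
rewrite mxE; case: eqP => [lj'|_]; rewrite ?mulr0//; case/eqP: lj.
by apply: val_inj; rewrite /= lj'.
Qed.

Lemma skew_rdiag_orth n m (a : 'M[R]_n) (b : 'M[R]_m) (x v : 'rV[R]_n) :
  skew_mx a -> skew_mx b ->
  mxdot (a *m rdiag m x - rdiag m x *m b) (rdiag m v) = 0.
Proof.
move=> sa sb; rewrite mxdot_rdiag big1// => i _.
have [im|mi] := ltnP i m; last by rewrite pad_mx_outr// mul0r.
rewrite [X in pad_mx _ _ X](_ : (i : nat) = Ordinal im)// pad_mxE.
rewrite mxE mulmx_rdiag [X in _ + X]mxE rdiag_mulmx /=.
by rewrite !skew_diag// mul0r mulr0 subr0 mul0r.
Qed.

Lemma orthogonal_normalize p (F : set_system nat) (A : nat -> 'M[R]_p) :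
  UltraFilter F -> (forall k, orthogonal_mx (A k)) ->
  exists A', orthogonal_mx A' /\
    A @ F --> A' /\ (fun k => A k *m A'^T) @ F --> (1%:M : 'M[R]_p).
Proof.
move=> UF oA; have PF := @ultra_proper _ F UF.
have [A' oA' AA'] := orthogonal_compact UF oA.
exists A'; split=> //; split=> //; rewrite -[1%:M]oA'.
by apply: cvg_mulmx => //; exact: cvg_cst.
Qed.

Lemma nonneg_sqr_neq (a b : R) : 0 <= a -> 0 <= b -> a != b -> a ^+ 2 - b ^+ 2 != 0.
Proof.
move=> a0 b0; apply: contra; rewrite subr_eq0 => /eqP E.
by rewrite -(@eqrXn2 _ 2)// E.
Qed.

(** The equation couples only the entries [(i, j)] and [(j, i)].  If [x i] and
    [x j] differ, Cramer's rule applies with determinant [x j ^ 2 - x i ^ 2]; if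
    they are equal, solvability on this pair is what the hypotheses on [L] say.
    Columns beyond [n] behave as a zero entry of [x]. *)
Lemma skew_rdiag_solve n m (x : 'rV[R]_n) (L : 'M[R]_(n, m)) :
  (n <= m)%N -> (forall i, 0 <= x 0 i) ->
  (forall i j, pad_row x i = pad_row x j -> pad_row x i != 0 ->
     pad_mx L i j = - pad_mx L j i) ->
  (forall i j, pad_row x i = 0 -> pad_row x j = 0 -> pad_mx L i j = 0) ->
  exists (a : 'M[R]_n) (b : 'M[R]_m), [/\ skew_mx a, skew_mx b &
    a *m rdiag m x - rdiag m x *m b = L].
Proof.
move=> nm x0 La L0; pose y := pad_row x; pose l := pad_mx L.
have y0 i : 0 <= y i.
  have [ip|pi] := ltnP i n; last by rewrite /y pad_row_out.
  by rewrite /y -[i]/(val (Ordinal ip)) pad_rowE.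
(* the first terms of [fa] and [fb] vanish when y i = y j, as _ / 0 = 0 *)
pose e i j := if y i == y j then l i j / (2 * y i) else 0.
pose fa i j := (y j * l i j + y i * l j i) / (y j ^+ 2 - y i ^+ 2) + e i j.
pose fb i j := (y i * l i j + y j * l j i) / (y j ^+ 2 - y i ^+ 2) - e i j.
have eN i j : e j i = - e i j.
  rewrite /e eq_sym; case: eqP => [E|_]; last by rewrite oppr0.
  have [z|nz] := eqVneq (y i) 0.
    by rewrite -E z mulr0 invr0 !mulr0 oppr0.
  by rewrite -E (La i j E nz : l i j = - l j i) mulNr opprK.
have frac (c c' d : R) : c' = c -> c' / (- d) = - (c / d).
  by move=> ->; rewrite invrN mulrN.
have dE i j : y i ^+ 2 - y j ^+ 2 = - (y j ^+ 2 - y i ^+ 2) by rewrite opprB.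
have faN i j : fa j i = - fa i j.
  rewrite /fa eN opprD dE; congr (_ + _); apply: frac; ring.
have fbN i j : fb j i = - fb i j.
  rewrite /fb eN opprD dE; congr (_ + _); apply: frac; ring.
exists (\matrix_(i, j) fa i j), (\matrix_(i, j) fb i j); split.
- by apply/matrixP => i j; rewrite !mxE faN.
- by apply/matrixP => i j; rewrite !mxE fbN.
apply/matrixP => i j; rewrite mxE mulmx_rdiag [X in _ + X]mxE rdiag_mulmx.
rewrite -/(y i) -/(y j) (pad_mx_fun fb) ?(leq_trans (ltn_ord i) nm)//.
have -> : pad_mx (\matrix_(i < n, j < n) fa i j) i j * y j = fa i j * y j.
  have [jn|nj] := ltnP j n; first by rewrite (pad_mx_fun fa).
  by rewrite /y (pad_row_out _ nj) !mulr0.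
rewrite -[RHS]pad_mxE -/(l i j) /fa /fb /e.
case: eqP => [E|/eqP E].
  have [z|nz] := eqVneq (y i) 0.
    by rewrite -E z !mul0r mulr0 subr0 /l L0// -/(y j) -E.
  by rewrite -E subrr invr0 !mulr0 add0r; field.
have D : y j ^+ 2 - y i ^+ 2 != 0 by apply: nonneg_sqr_neq; rewrite // eq_sym.
by rewrite addr0 subr0; field.
Qed.

(** The frames have limits that fix [rdiag m x]; divided by these limits they tend
    to the identity.  The expansions of [A D B^T] and of its transpose both
    survive, and their sum shows the antisymmetry of [L] on equal entries of
    [x]. *)
Lemma rect_orbit_tangent n m (F : set_system nat) (A : nat -> 'M[R]_n)
    (B : nat -> 'M[R]_m) (t : nat -> R) (x : 'rV[R]_n) (L : 'M[R]_(n, m)) :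
  UltraFilter F -> (forall k, orthogonal_mx (A k)) ->
  (forall k, orthogonal_mx (B k)) -> t @ F --> (0 : R) -> (forall k, 0 < t k) ->
  (fun k => (t k)^-1 *: (A k *m rdiag m x *m (B k)^T - rdiag m x)) @ F --> L ->
  exists (A' : nat -> 'M[R]_n) (B' : nat -> 'M[R]_m),
  [/\ A' @ F --> (1%:M : 'M[R]_n), B' @ F --> (1%:M : 'M[R]_m),
    (fun k => (t k)^-1 *: (A' k *m rdiag m x - rdiag m x *m B' k)) @ F --> L &
    (fun k => (t k)^-1 *: (B' k *m (rdiag m x)^T - (rdiag m x)^T *m A' k)) @ F
      --> L^T].
Proof.
move=> UF oA oB tc t0 Lc; have PF := @ultra_proper _ F UF.
have [A' [oA' [AA' A1]]] := orthogonal_normalize UF oA.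
have [B' [oB' [BB' B1]]] := orthogonal_normalize UF oB.
set D := rdiag m x in Lc *.
have ADB : A' *m D *m B'^T = D.
  have c1 : (fun k => A k *m D *m (B k)^T) @ F --> A' *m D *m B'^T.
    apply: cvg_mulmx; last exact: cvg_trmx.
    by apply: cvg_mulmx => //; exact: cvg_cst.
  have c2 : (fun k => A k *m D *m (B k)^T) @ F --> D.
    have -> : (fun k => A k *m D *m (B k)^T) =
        (fun k => D + t k *: ((t k)^-1 *: (A k *m D *m (B k)^T - D))).
      apply: funext => k; lincomb_coefs R; field; rewrite gt_eqF//.
    rewrite -[D in _ --> D]addr0 -(scale0r L).
    by apply: cvgD; [exact: cvg_cst | exact: cvgZ].
  exact: (cvg_unique _ c1 c2).
have ADB' : A'^T *m D *m B' = D.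
  by rewrite -[in LHS]ADB !mulmxA (orthogonal_tr oA') mul1mx -!mulmxA
    (orthogonal_tr oB') mulmx1.
have DB : D *m B'^T = A'^T *m D by rewrite -{1}ADB' -!mulmxA oB' mulmx1.
have DB' : B'^T *m D^T = D^T *m A'^T.
  by rewrite -!trmx_mul -{1}ADB -!mulmxA (orthogonal_tr oB') mulmx1.
exists (fun k => A k *m A'^T), (fun k => B k *m B'^T).
pose M k := (t k)^-1 *: (A k *m D *m (B k)^T - D).
have BB k : (B k)^T *m (B k *m B'^T) = B'^T.
  by rewrite mulmxA (orthogonal_tr (oB k)) mul1mx.
have AA k : (A k)^T *m (A k *m A'^T) = A'^T.
  by rewrite mulmxA (orthogonal_tr (oA k)) mul1mx.
split=> //.
- have c : (fun k => M k *m (B k *m B'^T)) @ F --> L *m 1%:M by apply: cvg_mulmx.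
  rewrite mulmx1 in c; apply: cvg_trans c; apply: near_eq_cvg; apply: nearW => k /=.
  rewrite /M -scalemxAl mulmxBl -[_ *m (B k)^T *m _]mulmxA BB -!mulmxA.
  by rewrite DB.
- have c : (fun k => (M k)^T *m (A k *m A'^T)) @ F --> L^T *m 1%:M.
    by apply: cvg_mulmx => //; exact: cvg_trmx.
  rewrite mulmx1 in c; apply: cvg_trans c; apply: near_eq_cvg; apply: nearW => k /=.
  rewrite /M linearZ linearB /= !trmx_mul trmxK -scalemxAl mulmxBl -!mulmxA AA.
  by rewrite DB'.
Qed.

End MatrixActions.

(** * Singular values of rectangular matrices *)

Section Chambers.
Variables (R : realType) (n : nat).

Definition strictly_decreasing_row (w : 'rV[R]_n) : Prop :=
  forall i j : 'I_n, (i < j)%N -> w 0 j < w 0 i.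

(** The regular row along which spectra are perturbed, in both systems below. *)
Definition staircase : 'rV[R]_n := \row_i (n - i)%:R.

Lemma staircase_decreasing : strictly_decreasing_row staircase.
Proof. by move=> i j ij; rewrite !mxE ltr_nat ltn_sub2l. Qed.

Lemma staircase_gt0 i : 0 < staircase 0 i.
Proof. by rewrite mxE ltr0n subn_gt0. Qed.

Lemma perturb_decreasing (y : 'rV[R]_n) (eps : R) : nonincreasing_row y ->
  0 < eps -> strictly_decreasing_row (y + eps *: staircase).
Proof.
move=> ys e0 i j ij; rewrite !mxE.
apply: ler_ltD; first exact: (ys i j (ltnW ij)).
by rewrite ltr_pM2l// ltr_nat ltn_sub2l.
Qed.

(** Rearrangement: exchanging two entries of [y] that are out of order would
    increase the product with the decreasing row [w]. *)
Lemma swap_nonincreasing (w y : 'rV[R]_n) : strictly_decreasing_row w ->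
  (forall i j, dot (\row_l y 0 (tperm i j l)) w <= dot y w) ->
  nonincreasing_row y.
Proof.
move=> ws H i j; rewrite leq_eqVlt => /predU1P[/val_inj->//|ij].
have ne : i != j by apply: contraTneq ij => ->; rewrite ltnn.
have := H i j; rewrite /dot/= !mxdotE !big_ord1.
rewrite (bigD1 i)//= (bigD1 j) 1?eq_sym//= [leRHS](bigD1 i)//= [in leRHS](bigD1 j) 1?eq_sym//=.
rewrite !mxE tpermL tpermR !addrA.
have -> : \sum_(l < n | (l != i) && (l != j)) (\row_l0 y 0 (tperm i j l0)) 0 l * w 0 l =
    \sum_(l < n | (l != i) && (l != j)) y 0 l * w 0 l.
  by apply: eq_bigr => l /andP[li lj]; rewrite mxE tpermD// eq_sym.
rewrite lerD2r => {}H; have := ws i j ij => wij.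
rewrite leNgt; apply/negP => yij; nra.
Qed.

End Chambers.

Section RectangularSystem.
Variables (R : realType) (n m : nat).
Hypothesis nm : (n <= m)%N.
Local Notation E := 'M[R]_(n, m).

Definition rect_diag : {linear 'rV[R]_n -> E} :=
  HB.pack (rdiag m) (GRing.isLinear.Build R _ _ _ _ (@rdiag_linear R n m)).

Definition rect_group : set (E -> E) := [set U | exists A B,
  [/\ orthogonal_mx A, orthogonal_mx B & U = fun X => A *m X *m B^T]].

Definition rect_generators : set (E -> E) := [set k | exists a b,
  [/\ skew_mx a, skew_mx b & k = fun X => a *m X - X *m b]].

Definition rect_chamber : set 'rV[R]_n :=
  [set y | nonincreasing_row y /\ forall i, 0 <= y 0 i].

Definition rect_regular : set 'rV[R]_n :=
  [set y | strictly_decreasing_row y /\ forall i, 0 < y 0 i].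

Lemma dot_rdiag (x y : 'rV[R]_n) : mxdot (rdiag m x) (rdiag m y) = mxdot x y.
Proof.
rewrite mxdot_rdiag [RHS]mxdotE big_ord1; apply: eq_bigr => i _.
have im : (i < m)%N := leq_trans (ltn_ord i) nm.
rewrite [X in pad_mx _ _ X](_ : (i : nat) = Ordinal im)// pad_mxE mxE /=.
by rewrite eqxx.
Qed.

(** Some generator maps [rdiag m w] to the off-diagonal part [L] of [Y], since
    distinct positive entries of [w] make the equation solvable; stationarity
    then says that [Y] is orthogonal to [L]. *)
Lemma rect_stationary w (Y : E) : rect_regular w ->
  (forall k, rect_generators k -> dot (k Y) (rdiag m w) = 0) ->
  exists y, Y = rdiag m y.
Proof.
move=> [ws w0] Yk.
pose L : E := \matrix_(i, j) (if (i == j :> nat) then 0 else Y i j).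
have padw0 i : pad_row w i = 0 -> (n <= i)%N.
  move=> wi; rewrite leqNgt; apply/negP => ip.
  have := w0 (Ordinal ip); rewrite -[Ordinal ip in X in _ < X]/(Ordinal ip).
  by rewrite -pad_rowE /= wi ltxx.
have [|||a [b [sa sb abL]]] := @skew_rdiag_solve R n m w L nm.
- by move=> i; exact: ltW.
- move=> i j E wi.
  have ip : (i < n)%N.
    by rewrite ltnNge; apply: contra wi => pi; rewrite pad_row_out.
  have jp : (j < n)%N.
    by rewrite ltnNge; apply: contra wi => pj; rewrite E pad_row_out.
  have ij : i = j.
    move: E; rewrite -[i in LHS]/(val (Ordinal ip)) -[j in RHS]/(val (Ordinal jp)).
    rewrite !pad_rowE; case: (ltngtP i j) => // ij.
      by have := ws (Ordinal ip) (Ordinal jp) ij => + E; rewrite E ltxx.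
    by have := ws (Ordinal jp) (Ordinal ip) ij => + E; rewrite E ltxx.
  rewrite -ij; have im := leq_trans ip nm.
  have -> : pad_mx L i i = 0.
    rewrite -[X in pad_mx _ X _]/(val (Ordinal ip)) -[X in pad_mx _ _ X]/(val (Ordinal im)).
    by rewrite pad_mxE mxE /= eqxx.
  by rewrite oppr0.
- by move=> i j /padw0 pi _; rewrite pad_mx_outl.
have H : mxdot Y L = 0.
  apply/eqP; rewrite -oppr_eq0 -abL -mxdot_skew//; apply/eqP.
  by apply: (Yk (fun X => a *m X - X *m b)); exists a, b.
have L0 : L = 0.
  apply: (@dot_eq0 R E); rewrite -[RHS]H; apply: etrans (mxdotE _ _) _.
  rewrite mxdotE; apply: eq_bigr => i _; apply: eq_bigr => j _.
  by rewrite !mxE; case: ifP; rewrite ?mulr0.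
exists (\row_i Y i (widen_ord nm i)).
apply/matrixP => i j; rewrite !mxE; case: eqP => [ij|/eqP/negPf ij].
  by congr (Y i _); apply: val_inj.
by have := congr1 (fun M : E => M i j) L0; rewrite /L !mxE ij.
Qed.

(** The competitors are simultaneous exchanges of two rows and of the two columns
    with the same indices, and changes of sign of one row. *)
Lemma rect_maximal w y : rect_regular w ->
  (forall U, rect_group U -> dot (U (rdiag m y)) (rdiag m w) <= dot y w) ->
  rect_chamber y.
Proof.
move=> [ws w0] H; split.
  apply: (swap_nonincreasing ws) => i j.
  have oA := @orthogonal_tperm R n i j.
  have oB := @orthogonal_tperm R m (widen_ord nm i) (widen_ord nm j).
  have := H (fun X => tperm_mx i j *m X
    *m (tperm_mx (widen_ord nm i) (widen_ord nm j))^T) _.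
  have GU : rect_group (fun X => tperm_mx i j *m X
    *m (tperm_mx (widen_ord nm i) (widen_ord nm j))^T).
    by eexists; eexists; split; [exact: oA|exact: oB|].
  move=> /(_ GU); apply: le_trans.
  rewrite -[leLHS]dot_rdiag le_eqVlt; apply/predU1P; left; congr mxdot.
  rewrite /tperm_mx tr_perm_mx tpermV.
  apply/matrixP => k l.
  have -> : (perm_mx (tperm i j) *m rdiag m y *m
      perm_mx (tperm (widen_ord nm i) (widen_ord nm j))) k l =
      rdiag m y (tperm i j k) (tperm (widen_ord nm i) (widen_ord nm j) l).
    by rewrite -row_permE -{1}[tperm (widen_ord _ _) _]tpermV -col_permE !mxE.
  rewrite !mxE.
  have wi : injective (widen_ord nm).
    by move=> u v /(congr1 val) /= uv; exact: val_inj.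
  have E : (tperm i j k == tperm (widen_ord nm i) (widen_ord nm j) l :> nat) =
      (k == l :> nat).
    have -> : (tperm i j k : nat) = widen_ord nm (tperm i j k) by [].
    rewrite (inj_tperm _ _ _ wi) val_eqE (inj_eq perm_inj).
    by rewrite -val_eqE.
  by rewrite E.
move=> i; have := H (fun X => diag_mx (\row_l (-1) ^+ (l == i)) *m X *m 1%:M^T).
move=> /(_ _); have oD : orthogonal_mx (diag_mx (\row_l (-1) ^+ (l == i)) : 'M[R]_n).
  rewrite /orthogonal_mx tr_diag_mx mulmx_diag; apply/matrixP => k l.
  rewrite !mxE; case: (k == l); rewrite ?mulr0n// !mulr1n.
  by rewrite -expr2 sqrr_sign.
have -> : diag_mx (\row_l (-1) ^+ (l == i)) *m rdiag m y *m 1%:M^T =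
    rdiag m (\row_l ((-1) ^+ (l == i) * y 0 l)).
  rewrite trmx1 mulmx1 mul_diag_mx; apply/matrixP => k l; rewrite !mxE.
  by case: ifP; rewrite ?mulr0.
move=> {}H.
have {}H : mxdot (\row_l ((-1) ^+ (l == i) * y 0 l)) w <= mxdot y w.
  rewrite -[leLHS]dot_rdiag; apply: H.
  by eexists; eexists; split; [exact: oD | exact: orthogonal1 |].
move: H; rewrite !mxdotE !big_ord1 (bigD1 i)//= [leRHS](bigD1 i)//= !mxE eqxx.
rewrite expr1 mulN1r mulNr.
have -> : \sum_(l < n | l != i) (\row_l0 ((-1) ^+ (l0 == i) * y 0 l0)) 0 l * w 0 l =
    \sum_(l < n | l != i) y 0 l * w 0 l.
  by apply: eq_bigr => l /negPf li; rewrite mxE li mul1r.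
rewrite lerD2r => H; have wi := w0 i.
have {}H : 0 <= y 0 i * w 0 i by lra.
by move: H; rewrite pmulr_lge0.
Qed.

Lemma sub_trmxE p q (X Y : 'M[R]_(p, q)) i j :
  (X^T - Y^T) i j = X j i - Y j i.
Proof. by rewrite !mxE. Qed.

Lemma rect_tangent (F : set_system nat) (U : nat -> E -> E) (t : nat -> R)
    (x : 'rV[R]_n) (L : E) : UltraFilter F -> rect_chamber x ->
  (forall k, rect_group (U k)) -> (forall k, 0 < t k) -> t @ F --> (0 : R) ->
  (fun k => (t k)^-1 *: (U k (rdiag m x) - rdiag m x)) @ F --> L ->
  exists2 k, rect_generators k & k (rdiag m x) = L.
Proof.
move=> UF [_ x0] GU t0 tc Lc; have PF := @ultra_proper _ F UF.
have /choice[AB ABP] : forall k, exists AB : 'M[R]_n * 'M[R]_m,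
    [/\ orthogonal_mx AB.1, orthogonal_mx AB.2 &
     U k = fun X => AB.1 *m X *m AB.2^T].
  by move=> k; have [A [B H]] := GU k; exists (A, B).
have oA k : orthogonal_mx (AB k).1 by have [] := ABP k.
have oB k : orthogonal_mx (AB k).2 by have [] := ABP k.
have UE : (fun k => (t k)^-1 *: (U k (rdiag m x) - rdiag m x)) = (fun k =>
    (t k)^-1 *: ((AB k).1 *m rdiag m x *m (AB k).2^T - rdiag m x)).
  by apply: funext => k; have [_ _ ->] := ABP k.
rewrite UE in Lc.
have [A [B [A1 B1 c1 c2]]] := rect_orbit_tangent UF oA oB tc t0 Lc.
pose y := pad_row x.
have e1 i j : (i < n)%N -> (j < m)%N -> (fun k => (t k)^-1 *
    (pad_mx (A k) i j * y j - y i * pad_mx (B k) i j)) @ F --> pad_mx L i j.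
  move=> ip jp; rewrite -[i]/(val (Ordinal ip)) -[j]/(val (Ordinal jp)).
  have := matrix_cvg_entry PF (i:=Ordinal ip) (j:=Ordinal jp) c1.
  rewrite pad_mxE; apply: cvg_trans; apply: near_eq_cvg; apply: nearW => k /=.
  by rewrite mxE [X in _ * X]mxE [X in _ + X]mxE mulmx_rdiag rdiag_mulmx.
have e2 i j : (i < m)%N -> (j < n)%N -> (fun k => (t k)^-1 *
    (pad_mx (B k) i j * y j - y i * pad_mx (A k) i j)) @ F --> pad_mx L j i.
  move=> ip jp; rewrite -[i]/(val (Ordinal ip)) -[j]/(val (Ordinal jp)).
  have := matrix_cvg_entry PF (i:=Ordinal ip) (j:=Ordinal jp) c2.
  rewrite -pad_mxE pad_mxT; apply: cvg_trans; apply: near_eq_cvg.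
  apply: nearW => k /=; rewrite mxE; congr (_ * _).
  have -> : B k *m (rdiag m x)^T = (rdiag m x *m (B k)^T)^T.
    by rewrite trmx_mul trmxK.
  have -> : (rdiag m x)^T *m A k = ((A k)^T *m rdiag m x)^T.
    by rewrite trmx_mul trmxK.
  rewrite sub_trmxE rdiag_mulmx mulmx_rdiag !pad_mxT [y _ * pad_mx (A k) _ _]mulrC.
  by rewrite [pad_mx (B k) _ _ * _]mulrC.
have [||a [b [sa sb abL]]] := @skew_rdiag_solve R n m x L nm x0.
- move=> i j E yi.
  have ip : (i < n)%N.
    by rewrite ltnNge; apply: contra yi => pi; rewrite pad_row_out.
  have jp : (j < n)%N.
    by rewrite ltnNge; apply: contra yi => pj; rewrite E pad_row_out.
  have := cvgD (e1 i j ip (leq_trans jp nm)) (e2 i j (leq_trans ip nm) jp).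
  have -> : (fun k => (t k)^-1 * (pad_mx (A k) i j * y j - y i * pad_mx (B k) i j))
    + (fun k => (t k)^-1 * (pad_mx (B k) i j * y j - y i * pad_mx (A k) i j))
    = fun=> 0 :> R.
    by apply: funext => k /=; rewrite !fctE -[y i]/(pad_row x i) E /y; ring.
  move=> /(_ _ _) c; have c0 : (fun=> 0 : R) @ F --> (0 : R) by exact: cvg_cst.
  by apply/eqP; rewrite -addr_eq0; apply/eqP; exact: (cvg_unique _ c c0).
- move=> i j yi yj.
  have [ip|pi] := ltnP i n; last by rewrite pad_mx_outl.
  have [jp|pj] := ltnP j m; last by rewrite pad_mx_outr.
  have c := e1 i j ip jp.
  have E : (fun k => (t k)^-1 * (pad_mx (A k) i j * y j - y i * pad_mx (B k) i j))
    = fun=> 0 :> R.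
    by apply: funext => k /=; rewrite /y yi yj mulr0 mul0r subrr mulr0.
  rewrite E in c; have c0 : (fun=> 0 : R) @ F --> (0 : R) by exact: cvg_cst.
  exact: (cvg_unique _ c c0).
by exists (fun X => a *m X - X *m b) => //; exists a, b.
Qed.

Lemma rdiag_mul_tr (y : 'rV[R]_n) :
  rdiag m y *m (rdiag m y)^T = diag_mx (\row_i (y 0 i ^+ 2)).
Proof.
apply/matrixP => i j; rewrite rdiag_mulmx pad_rowE pad_mxT.
have im : (i < m)%N := leq_trans (ltn_ord i) nm.
rewrite [X in pad_mx _ _ X](_ : (i : nat) = Ordinal im)// pad_mxE !mxE /=.
rewrite [j == i :> nat]eq_sym -[LHS]/(_ * (if i == j then _ else _)).
by case: eqP => [->|_]; rewrite ?mulr1n ?expr2 ?mulr0 ?mulr0n.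
Qed.

(** The spectrum of the Gram matrix [X X^T] is the row of squares of [y]. *)
Lemma singular_values_rdiag A B y : orthogonal_mx A -> orthogonal_mx B ->
  rect_chamber y -> singular_values (A *m rdiag m y *m B^T) = y.
Proof.
move=> oA oB [ys y0]; rewrite /singular_values.
have -> : A *m rdiag m y *m B^T *m (A *m rdiag m y *m B^T)^T =
    A *m diag_mx (\row_i (y 0 i ^+ 2)) *m A^T.
  rewrite -rdiag_mul_tr !trmx_mul trmxK -!mulmxA (mulmxA B^T).
  by rewrite (orthogonal_tr oB) mul1mx.
rewrite eigenvalues_diag//.
  by apply/rowP => i; rewrite !mxE sqrtr_sqr ger0_norm.
by move=> i j ij; rewrite !mxE lerXn2r ?nnegrE// ys.
Qed.

Lemma rect_spectral_system :
  spectral_system rect_diag (@singular_values R n m) rect_group rect_generators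
    rect_chamber rect_regular (staircase R n).
Proof.
split.
- exact: dot_rdiag.
- move=> _ [A [B [oA oB ->]]] c X Y.
  by rewrite mulmxDr mulmxDl -scalemxAr -scalemxAl.
- by move=> _ X Y [A [B [oA oB ->]]]; exact: mxdot_orthogonal.
- exists 1%:M, 1%:M; split; [exact: orthogonal1..|].
  by apply: funext => X; rewrite trmx1 mul1mx mulmx1.
- move=> _ _ [A [B [oA oB ->]]] [A' [B' [oA' oB' ->]]].
  exists (A *m A'), (B *m B'); split; [exact: orthogonalM..|].
  by apply: funext => X /=; rewrite trmx_mul !mulmxA.
- move=> _ [A [B [oA oB ->]]].
  exists (fun X => A^T *m X *m B^T^T).
    by exists A^T, B^T; split=> //; exact: orthogonalT.
  split=> X; rewrite trmxK !mulmxA.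
    by rewrite (orthogonal_tr oA) mul1mx -mulmxA (orthogonal_tr oB) mulmx1.
  by rewrite oA mul1mx -mulmxA oB mulmx1.
- move=> F U UF GU; have PF := @ultra_proper _ F UF.
  have /choice[AB ABP] : forall k, exists AB : 'M[R]_n * 'M[R]_m,
      [/\ orthogonal_mx AB.1, orthogonal_mx AB.2 &
       U k = fun X => AB.1 *m X *m AB.2^T].
    by move=> k; have [A [B H]] := GU k; exists (A, B).
  have [|A oA AA] := @orthogonal_compact R n F (fun k => (AB k).1) UF.
    by move=> k; have [] := ABP k.
  have [|B oB BB] := @orthogonal_compact R m F (fun k => (AB k).2) UF.
    by move=> k; have [] := ABP k.
  exists (fun X => A *m X *m B^T); first by exists A, B.
  move=> X; have -> : (fun k => U k X) =
      (fun k => (AB k).1 *m X *m ((AB k).2)^T).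
    by apply: funext => k; have [_ _ ->] := ABP k.
  apply: cvg_mulmx; last exact: cvg_trmx.
  by apply: cvg_mulmx => //; exact: cvg_cst.
- move=> _ [a [b [sa sb ->]]]; exists (- a), (- b); split.
  + by rewrite /skew_mx linearN /= sa.
  + by rewrite /skew_mx linearN /= sb.
  + by apply: funext => X; rewrite mulNmx mulmxN; lincomb R.
- by move=> _ X Y [a [b [sa sb ->]]]; exact: mxdot_skew.
- move=> _ [a [b [sa sb ->]]].
  have [A [oA [r r0 AE]]] := cayley_cvg sa.
  have [B [oB [s s0 BE]]] := cayley_cvg sb.
  exists (fun t X => A t *m X *m (B t)^T); first by move=> t; exists (A t), (B t).
  by move=> X; exact: action_curve_cvg sb r0 s0 AE BE.
- by move=> _ x v [a [b [sa sb ->]]]; exact: skew_rdiag_orth.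
- exact: rect_tangent.
- exact: rect_stationary.
- exact: rect_maximal.
- by move=> _ y [A [B [oA oB ->]]] Cy; exact: singular_values_rdiag.
- by split; [exact: staircase_decreasing | exact: staircase_gt0].
- move=> y eps [ys y0] e0; split; first exact: perturb_decreasing.
  by move=> i; rewrite mxE ltr_wpDl// mxE mulr_gt0// staircase_gt0.
Qed.

End RectangularSystem.

(** * Eigenvalues of symmetric matrices *)

Section SymmetricSystem.
Variables (R : realType) (n : nat).
Local Notation E := (symmx R n).

Definition smx (M : 'M[R]_n) : E := vsproj (symspace R n) M.

Lemma val_smx M : M^T = M -> vsval (smx M) = M.
Proof. by move=> sM; rewrite /smx vsprojK// mem_symspace sM. Qed.

Lemma tr_val (X : E) : (vsval X)^T = vsval X.
Proof. by apply/eqP; rewrite -mem_symspace; exact: subvsP. Qed.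

Lemma symm_inj (X Y : E) : vsval X = vsval Y -> X = Y.
Proof. exact: val_inj. Qed.

Lemma smx_linear : linear smx.
Proof. by move=> a X Y; rewrite /smx linearP. Qed.

Lemma val_add (X Y : E) : vsval (X + Y) = vsval X + vsval Y.
Proof. exact: linearD. Qed.
Lemma val_scale (a : R) (X : E) : vsval (a *: X) = a *: vsval X.
Proof. exact: linearZ. Qed.
Lemma val_sub (X Y : E) : vsval (X - Y) = vsval X - vsval Y.
Proof. exact: linearB. Qed.

Lemma symm_cvg (T : Type) (F : set_system T) (FF : Filter F) (f : T -> E) (X : E) :
  (fun k => vsval (f k)) @ F --> vsval X -> f @ F --> X.
Proof.
move=> /cvgrPdist_le H; apply/cvgrPdist_le => eps /H.
by apply: filterS => k; rewrite -val_sub.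
Qed.

Lemma symm_cvg_val (T : Type) (F : set_system T) (FF : Filter F) (f : T -> E)
    (X : E) :
  f @ F --> X -> (fun k => vsval (f k)) @ F --> vsval X.
Proof.
move=> /cvgrPdist_le H; apply/cvgrPdist_le => eps /H.
by apply: filterS => k; rewrite -val_sub.
Qed.

Lemma rdiag_diag (x : 'rV[R]_n) : rdiag n x = diag_mx x.
Proof.
by apply/matrixP => i j; rewrite !mxE val_eqE; case: (i == j).
Qed.

Lemma sdiag_linear : linear (fun x : 'rV[R]_n => smx (diag_mx x)).
Proof. by move=> a x y; rewrite -smx_linear linearP. Qed.

Definition symm_diag : {linear 'rV[R]_n -> E} :=
  HB.pack (fun x : 'rV[R]_n => smx (diag_mx x))
    (GRing.isLinear.Build R _ _ _ _ sdiag_linear).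

Lemma val_symm_diag x : vsval (symm_diag x) = rdiag n x.
Proof. by rewrite rdiag_diag /= val_smx// tr_diag_mx. Qed.

Definition symm_act A (X : E) : E := smx (A *m vsval X *m A^T).

Lemma val_symm_act A X : vsval (symm_act A X) = A *m vsval X *m A^T.
Proof. by rewrite val_smx// !trmx_mul trmxK tr_val mulmxA. Qed.

Definition symm_gen a (X : E) : E := smx (a *m vsval X - vsval X *m a).

Lemma val_symm_gen a X : skew_mx a ->
  vsval (symm_gen a X) = a *m vsval X - vsval X *m a.
Proof.
move=> sa; rewrite val_smx// linearB /= !trmx_mul tr_val sa mulNmx mulmxN.
by lincomb R.
Qed.

Definition symm_group : set (E -> E) :=
  [set U | exists2 A, orthogonal_mx A & U = symm_act A].

Definition symm_generators : set (E -> E) :=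
  [set k | exists2 a, skew_mx a & k = symm_gen a].

(** Entrywise division by the differences of the entries of [x]. *)
Lemma symm_commutator_solve (x : 'rV[R]_n) (L : E) :
  (forall i j, x 0 i = x 0 j -> vsval L i j = 0) ->
  exists2 a, skew_mx a & symm_gen a (symm_diag x) = L.
Proof.
move=> L0; pose a := \matrix_(i, j) (vsval L i j / (x 0 j - x 0 i)).
have sa : skew_mx a.
  apply/matrixP => i j; rewrite !mxE -mulrN -invrN opprB.
  by have := congr1 (fun M : 'M[R]_n => M i j) (tr_val L); rewrite mxE => ->.
exists a => //; apply: symm_inj; rewrite val_symm_gen// val_symm_diag.
apply/matrixP => i j; rewrite mxE mulmx_rdiag [X in _ + X]mxE rdiag_mulmx.
rewrite !pad_rowE !pad_mxE mxE.
have [E|ne] := eqVneq (x 0 i) (x 0 j).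
  by rewrite L0// !mul0r mulr0 subrr.
by field; rewrite subr_eq0 eq_sym.
Qed.

Lemma symm_tangent (F : set_system nat) (U : nat -> E -> E) (t : nat -> R)
    (x : 'rV[R]_n) (L : E) : UltraFilter F -> nonincreasing_row x ->
  (forall k, symm_group (U k)) -> (forall k, 0 < t k) -> t @ F --> (0 : R) ->
  (fun k => (t k)^-1 *: (U k (symm_diag x) - symm_diag x)) @ F --> L ->
  exists2 k, symm_generators k & k (symm_diag x) = L.
Proof.
move=> UF _ GU t0 tc Lc; have PF := @ultra_proper _ F UF.
have /choice[A AP] : forall k, exists A : 'M[R]_n,
    orthogonal_mx A /\ U k = symm_act A.
  by move=> k; have [A oA H] := GU k; exists A.
have oA k : orthogonal_mx (A k) by have [] := AP k.
have {}Lc : (fun k => (t k)^-1 *: (A k *m rdiag n x *m (A k)^T - rdiag n x)) @ F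
    --> vsval L.
  have := symm_cvg_val PF Lc; apply: cvg_trans; apply: near_eq_cvg.
  apply: nearW => k /=; have [_ ->] := AP k.
  rewrite -[smx (diag_mx x)]/(symm_diag x) val_symm_act.
  by rewrite -[vsval (symm_diag x)]/(vsval (smx (diag_mx x))) val_symm_diag.
have [A' [B' [A1 B1 c1 c2]]] := rect_orbit_tangent UF oA oA tc t0 Lc.
have [|a sa aE] := @symm_commutator_solve x L; last first.
  by exists (symm_gen a) => //; exists a.
move=> i j E.
have e1 : (fun k => (t k)^-1 * (A' k i j * x 0 j - x 0 i * B' k i j)) @ F
    --> vsval L i j.
  have := matrix_cvg_entry PF (i:=i) (j:=j) c1.
  apply: cvg_trans; apply: near_eq_cvg; apply: nearW => k /=.
  rewrite mxE [X in _ * X]mxE [X in _ + X]mxE mulmx_rdiag rdiag_mulmx.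
  by rewrite !pad_rowE !pad_mxE.
have e2 : (fun k => (t k)^-1 * (B' k i j * x 0 j - x 0 i * A' k i j)) @ F
    --> vsval L j i.
  have := matrix_cvg_entry PF (i:=i) (j:=j) c2; rewrite mxE.
  have -> : (rdiag n x)^T = rdiag n x by rewrite rdiag_diag tr_diag_mx.
  apply: cvg_trans; apply: near_eq_cvg; apply: nearW => k /=.
  rewrite mxE [X in _ * X]mxE [X in _ + X]mxE mulmx_rdiag rdiag_mulmx.
  by rewrite !pad_rowE !pad_mxE.
have := cvgD e1 e2.
have -> : (fun k => (t k)^-1 * (A' k i j * x 0 j - x 0 i * B' k i j))
    + (fun k => (t k)^-1 * (B' k i j * x 0 j - x 0 i * A' k i j)) = fun=> 0 :> R.
  by apply: funext => k /=; rewrite !fctE E; ring.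
move=> /(_ _ _) c; have c0 : (fun=> 0 : R) @ F --> (0 : R) by exact: cvg_cst.
have h : vsval L i j + vsval L j i = 0 by exact: (cvg_unique _ c c0).
move: h; have -> : vsval L j i = vsval L i j.
  by have := congr1 (fun M : 'M[R]_n => M i j) (tr_val L); rewrite mxE.
lra.
Qed.

Lemma symm_stationary w (Y : E) : strictly_decreasing_row w ->
  (forall k, symm_generators k -> dot (k Y) (symm_diag w) = 0) ->
  exists y, Y = symm_diag y.
Proof.
move=> ws Yk.
pose M : 'M[R]_n := \matrix_(i, j) (if i == j then 0 else vsval Y i j).
have sM : M^T = M.
  apply/matrixP => i j; rewrite !mxE eq_sym; case: ifP => // _.
  by have := congr1 (fun M : 'M[R]_n => M i j) (tr_val Y); rewrite mxE.
have [|a sa aE] := @symm_commutator_solve w (smx M).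
  move=> i j E; rewrite val_smx// mxE; case: eqP => // /eqP ne.
  move: ne; rewrite neq_ltn => /orP[] /ws; rewrite E ltxx//.
have aE' := congr1 vsval aE; rewrite val_symm_gen// val_symm_diag val_smx// in aE'.
have H : mxdot (vsval Y) M = 0.
  apply/eqP; rewrite -oppr_eq0 -aE' -mxdot_skew//; apply/eqP.
  have := Yk (symm_gen a); rewrite /dot/= /symdot val_symm_gen//.
  rewrite -[smx (diag_mx w)]/(symm_diag w) val_symm_diag; apply.
  by exists a.
have M0 : M = 0.
  apply: (@dot_eq0 R 'M[R]_n); rewrite -[RHS]H; apply: etrans (mxdotE _ _) _.
  rewrite mxdotE; apply: eq_bigr => i _; apply: eq_bigr => j _.
  by rewrite !mxE; case: ifP; rewrite ?mulr0.
exists (\row_i vsval Y i i); apply: symm_inj; rewrite val_symm_diag.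
apply/matrixP => i j; rewrite !mxE val_eqE; case: eqP => [->//|/eqP/negPf ij].
by have := congr1 (fun M : 'M[R]_n => M i j) M0; rewrite /M !mxE ij.
Qed.

Lemma symm_maximal w y : strictly_decreasing_row w ->
  (forall U, symm_group U -> dot (U (symm_diag y)) (symm_diag w) <= dot y w) ->
  nonincreasing_row y.
Proof.
move=> ws H; apply: (swap_nonincreasing ws) => i j.
have oA := @orthogonal_tperm R n i j.
have := H (symm_act (tperm_mx i j)) _.
have GU : symm_group (symm_act (tperm_mx i j)) by exists (tperm_mx i j).
move=> /(_ GU); apply: le_trans.
rewrite {2}/dot/= /symdot val_symm_act.
rewrite -[smx (diag_mx w)]/(symm_diag w) -[smx (diag_mx y)]/(symm_diag y).
rewrite !val_symm_diag -[leLHS](dot_rdiag (leqnn n)).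
rewrite le_eqVlt; apply/predU1P; left; congr mxdot.
rewrite /tperm_mx tr_perm_mx tpermV; apply/matrixP => k l.
have -> : (perm_mx (tperm i j) *m rdiag n y *m perm_mx (tperm i j)) k l =
    rdiag n y (tperm i j k) (tperm i j l).
  by rewrite -row_permE -{1}[tperm i j in X in _ *m X]tpermV -col_permE !mxE.
by rewrite !mxE !val_eqE (inj_eq perm_inj).
Qed.

Definition symm_spectrum (X : E) : 'rV[R]_n := eigenvalues (vsval X).

Lemma symm_spectral_system :
  spectral_system symm_diag symm_spectrum symm_group symm_generators
    (@nonincreasing_row R n) (@strictly_decreasing_row R n) (staircase R n).
Proof.
split.
- move=> x y; rewrite [LHS]/dot/= /symdot.
  rewrite -[smx (diag_mx x)]/(symm_diag x) -[smx (diag_mx y)]/(symm_diag y).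
  by rewrite !val_symm_diag dot_rdiag.
- move=> _ [A oA ->] c X Y; apply: symm_inj.
  rewrite val_symm_act !val_add !val_scale !val_symm_act.
  by rewrite mulmxDr mulmxDl -scalemxAr -scalemxAl.
- move=> _ X Y [A oA ->]; rewrite [LHS]/dot/= /symdot !val_symm_act.
  exact: mxdot_orthogonal.
- exists 1%:M; first exact: orthogonal1.
  by apply: funext => X; apply: symm_inj; rewrite val_symm_act trmx1 mul1mx mulmx1.
- move=> _ _ [A oA ->] [A' oA' ->]; exists (A *m A'); first exact: orthogonalM.
  by apply: funext => X; apply: symm_inj; rewrite /= !val_symm_act trmx_mul !mulmxA.
- move=> _ [A oA ->]; exists (symm_act A^T).
    by exists A^T => //; exact: orthogonalT.
  split=> X; apply: symm_inj; rewrite !val_symm_act trmxK !mulmxA.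
    by rewrite (orthogonal_tr oA) mul1mx -mulmxA (orthogonal_tr oA) mulmx1.
  by rewrite oA mul1mx -mulmxA oA mulmx1.
- move=> F U UF GU; have PF := @ultra_proper _ F UF.
  have /choice[A AP] : forall k, exists A : 'M[R]_n,
      orthogonal_mx A /\ U k = symm_act A.
    by move=> k; have [A oA H] := GU k; exists A.
  have [|A' oA' AA'] := @orthogonal_compact R n F A UF.
    by move=> k; have [] := AP k.
  exists (symm_act A'); first by exists A'.
  move=> X; apply: symm_cvg; rewrite val_symm_act.
  have -> : (fun k => vsval (U k X)) = (fun k => A k *m vsval X *m (A k)^T).
    by apply: funext => k; have [_ ->] := AP k; rewrite val_symm_act.
  apply: cvg_mulmx; last exact: cvg_trmx.
  by apply: cvg_mulmx => //; exact: cvg_cst.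
- move=> _ [a sa ->]; have sNa : skew_mx (- a) by rewrite /skew_mx linearN /= sa.
  exists (- a) => //; apply: funext => X; apply: symm_inj.
  rewrite -scaleN1r val_scale !val_symm_gen// mulNmx mulmxN; lincomb R.
- move=> _ X Y [a sa ->]; rewrite /dot/= /symdot !val_symm_gen//.
  exact: mxdot_skew.
- move=> _ [a sa ->].
  have [A [oA [r r0 AE]]] := cayley_cvg sa.
  exists (fun t => symm_act (A t)); first by move=> t; exists (A t).
  move=> X; apply: symm_cvg.
  have := action_curve_cvg (vsval X) sa r0 r0 AE AE.
  apply: cvg_trans; apply: near_eq_cvg; apply: nearW => t /=.
  by rewrite val_symm_act !val_symm_gen.
- move=> _ x v [a sa ->]; rewrite /dot/= /symdot val_symm_gen//.
  rewrite -[smx (diag_mx x)]/(symm_diag x) -[smx (diag_mx v)]/(symm_diag v).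
  by rewrite !val_symm_diag; exact: skew_rdiag_orth.
- exact: symm_tangent.
- exact: symm_stationary.
- exact: symm_maximal.
- move=> _ y [A oA ->] ys; rewrite /symm_spectrum val_symm_act val_symm_diag.
  by rewrite rdiag_diag eigenvalues_diag.
- exact: staircase_decreasing.
- by move=> y eps; exact: perturb_decreasing.
Qed.

End SymmetricSystem.

(** * Transport along signed permutations *)

Section Transport.
Variable R : realType.

(** Second-order regularity is expressed by a norm up to constants, so it is
    invariant under a bicontinuous linear symmetry of [K]. *)
Lemma second_order_regular_transport (V : normedModType R) (K : set V) (x : V)
    (Phi Psi : {linear V -> V}) (C : R) :
  0 < C -> cancel Psi Phi -> cancel Phi Psi ->
  (forall v, `|Phi v| <= C * `|v|) -> (forall v, `|Psi v| <= C * `|v|) ->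
  (forall z, K (Phi z) <-> K z) ->
  second_order_regular K (Phi x) -> second_order_regular K x.
Proof.
move=> C0 PsiK PhiK bPhi bPsi KPhi reg F FF t z zeta t0 tc Kz zc eps e0.
have zc' : (fun k => (t k)^-1 *: (Phi (z k) - Phi x)) @ F --> Phi zeta.
  have cPhi : {for zeta, continuous Phi}.
    apply/cvgrPdist_le => e ep; near=> v; rewrite -linearB.
    apply: le_trans (bPhi _) _; rewrite -ler_pdivlMl//.
    near: v; apply: cvgr_dist_le; first exact: cvg_id.
    by rewrite mulr_gt0// invr_gt0.
  have := @continuous_cvg _ _ _ F FF _ Phi zeta cPhi zc.
  apply: cvg_trans; apply: near_eq_cvg; apply: nearW => k /=.
  by rewrite linearZ /= linearB.
have Kz' : \forall k \near F, K (Phi (z k)).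
  by apply: filterS Kz => k /KPhi.
have eC : 0 < eps / C by rewrite divr_gt0.
have := reg F FF t (fun k => Phi (z k)) _ t0 tc Kz' zc' _ eC.
apply: filterS => k [w wle win]; exists (Psi w).
  pose u := (2 / t k ^+ 2) *: (z k - x - t k *: zeta); rewrite -/u.
  have uE : (2 / t k ^+ 2) *: (Phi (z k) - Phi x - t k *: Phi zeta) = Phi u.
    have PhiB a b : Phi (a - b) = Phi a - Phi b by exact: linearB.
    have PhiZ (a : R) b : Phi (a *: b) = a *: Phi b by exact: linearZ.
    by rewrite /u PhiZ !PhiB PhiZ.
  rewrite uE in wle.
  have -> : Psi w - u = Psi (w - Phi u) by rewrite linearB /= PhiK.
  by apply: le_trans (bPsi _) _; rewrite -ler_pdivlMl// mulrC.
move=> delta d0; have dC : 0 < delta / C by rewrite divr_gt0.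
apply: filterS (win _ dC) => s [w' w'le Kw']; exists (Psi w').
  by rewrite -linearB; apply: le_trans (bPsi _) _; rewrite -ler_pdivlMl// mulrC.
by apply/KPhi; rewrite !linearD /= !linearZ /= PsiK.
Unshelve. all: by end_near. Qed.

Lemma row_orthogonal_bound n : exists2 c : R, 1 <= c &
  forall (Q : 'M[R]_n) (v : 'rV[R]_n), orthogonal_mx Q -> `|v *m Q| <= c * `|v|.
Proof.
have [c c0 cP] := @dot_norm R 'rV[R]_n.
exists (1 + c) => [|Q v oQ]; first by rewrite lerDl ltW.
apply: (@le_trans _ _ (c * `|v|)); last by rewrite ler_wpM2r// lerDr.
rewrite -(@ler_pXn2r _ 2)// ?nnegrE ?mulr_ge0 ?(ltW c0)//.
have [H _] := cP (v *m Q); apply: le_trans H _.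
have -> : dot (v *m Q) (v *m Q) = dot v v.
  have := mxdot_orthogonal v v (orthogonal1 R 1) (orthogonalT oQ).
  by rewrite trmxK mul1mx.
rewrite exprMn expr2 -mulrA ler_pM2l//.
by have [_] := cP v.
Qed.

Lemma second_order_regular_epi_transport n (g : 'rV[R]_n -> \bar R)
    (Q : 'M[R]_n) (x : 'rV[R]_n) (r : R^o) :
  orthogonal_mx Q -> (forall y, g (y *m Q) = g y) ->
  second_order_regular (epi g) (x *m Q, r) -> second_order_regular (epi g) (x, r).
Proof.
move=> oQ gQ.
have lin (M : 'M[R]_n) : linear (fun z : 'rV[R]_n * R^o => (z.1 *m M, z.2)).
  move=> a u v; apply: injective_projections => //=.
  by rewrite mulmxDl scalemxAl.
pose Phi : {linear ('rV[R]_n * R^o)%type -> ('rV[R]_n * R^o)%type} :=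
  HB.pack (fun z : 'rV[R]_n * R^o => (z.1 *m Q, z.2))
    (GRing.isLinear.Build R _ _ _ _ (lin Q)).
pose Psi : {linear ('rV[R]_n * R^o)%type -> ('rV[R]_n * R^o)%type} :=
  HB.pack (fun z : 'rV[R]_n * R^o => (z.1 *m Q^T, z.2))
    (GRing.isLinear.Build R _ _ _ _ (lin Q^T)).
have [c c1 cP] := row_orthogonal_bound n.
have c0 : 0 < c by apply: lt_le_trans c1.
have bnd M v : orthogonal_mx M -> `|(v.1 *m M, v.2) : 'rV[R]_n * R^o| <= c * `|v|.
  move=> oM; rewrite ge_max /=; apply/andP; split.
    apply: le_trans (cP _ _ oM) _; rewrite ler_pM2l//.
    by rewrite le_max lexx.
  apply: (@le_trans _ _ `|v|); first by rewrite le_max lexx orbT.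
  by rewrite ler_peMl.
apply: (@second_order_regular_transport _ _ (x, r) Phi Psi c c0).
- by move=> [u a]; rewrite /Phi/Psi/= -mulmxA (orthogonal_tr oQ) mulmx1.
- by move=> [u a]; rewrite /Phi/Psi/= -mulmxA oQ mulmx1.
- by move=> v; exact: bnd.
- by move=> v; apply: bnd; exact: orthogonalT.
- by move=> [u a]; rewrite /epi/= gQ.
Qed.

End Transport.

Section SignedPermutations.
Variables (R : realType) (n : nat).

Definition signed_perm_mx (eps : 'I_n -> bool) (s : 'S_n) : 'M[R]_n :=
  diag_mx (\row_i (-1) ^+ eps i) *m perm_mx s.

Lemma orthogonal_signed_perm eps s : orthogonal_mx (signed_perm_mx eps s).
Proof.
apply: orthogonalM.
  rewrite /orthogonal_mx tr_diag_mx mulmx_diag; apply/matrixP => k l.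
  rewrite !mxE; case: (k == l); rewrite ?mulr0n// !mulr1n.
  by rewrite -expr2 sqrr_sign.
by rewrite /orthogonal_mx tr_perm_mx -perm_mxM mulgV perm_mx1.
Qed.

Lemma row_perm_permE (x : 'rV[R]_n) (s : 'S_n) j : (x *m perm_mx s^-1) 0 j = x 0 (s j).
Proof. by rewrite -col_permE mxE. Qed.

(** Absolutely symmetric functions cannot tell a row from the sorted row of its
    absolute values. *)
Lemma abs_signed_perm (x y : 'rV[R]_n) (s : 'S_n) :
  (forall i, 0 <= y 0 i) -> (forall i, y 0 i ^+ 2 = x 0 (s i) ^+ 2) ->
  y = x *m signed_perm_mx (fun i => x 0 i < 0) s^-1.
Proof.
move=> y0 yx; apply/rowP => j.
rewrite /signed_perm_mx mulmxA row_perm_permE mul_mx_diag !mxE.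
have -> : y 0 j = `|x 0 (s j)|.
  by rewrite -(ger0_norm (y0 j)) -!sqrtr_sqr yx.
case: ltrP => h; first by rewrite expr1 mulrN1 ltr0_norm.
by rewrite expr0 mulr1 ger0_norm.
Qed.

Lemma absolutely_symmetric_symmetric (g : 'rV[R]_n -> \bar R) :
  absolutely_symmetric_fun g -> symmetric_fun g.
Proof.
move=> ag s x; have := ag (fun=> false) s x.
have -> : diag_mx (\row_i (-1) ^+ false) = 1%:M :> 'M[R]_n.
  by apply/matrixP => i j; rewrite !mxE expr0.
by rewrite mul1mx.
Qed.

Lemma char_poly_eq_perm A (x y : 'rV[R]_n) : orthogonal_mx A ->
  diag_mx x = A *m diag_mx y *m A^T -> exists s : 'S_n, forall i, y 0 i = x 0 (s i).
Proof.
move=> oA E; apply: prod_XsubC_perm.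
by rewrite -!char_poly_diag E char_poly_orthogonal.
Qed.

End SignedPermutations.

(** * Parabolic regularity of spectral functions *)

Section Regularity.
Variables (R : realType).

(** Whenever a sequence leaving [Xb] in the direction [H] keeps the growth of
    [theta] below that of the subgradient [V] plus [c t^2/2], parabolas with a
    fixed second-order coefficient do so up to [eps].  This bounds the second-order
    epiderivative of [theta] from above, hence its conjugate at [V] from
    below. *)
Definition parabolically_regular (E : euclideanType R) (theta : E -> \bar R)
    (Xb V : E) : Prop :=
  forall (t : nat -> R) (H_ : nat -> E) (H : E) (c eps : R),
  (forall k, 0 < t k) -> t @ \oo --> (0 : R) -> H_ @ \oo --> H ->
  (\forall k \near \oo, (theta (Xb + t k *: H_ k)%R <=
    theta Xb + (dot V (t k *: H_ k) + t k ^+ 2 / 2 * c)%:E)%E) ->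
  0 < eps -> exists W, forall delta : R, 0 < delta -> \forall s \near 0^'+,
    exists2 W', `|W' - W| <= delta &
      (theta (Xb + s *: H + (s ^+ 2 / 2) *: W')%R <= theta Xb +
        (s * dot V H + s ^+ 2 / 2 * (dot V W + c + eps))%:E)%E.

Lemma symm_parabolically_regular n (g : 'rV[R]_n -> \bar R)
    (theta : symmx R n -> \bar R) Xb V :
  symmetric_fun g -> (forall X, theta X = g (symm_spectrum X)) ->
  second_order_regular (epi g) (symm_spectrum Xb, fine (g (symm_spectrum Xb))) ->
  subdifferential theta Xb V -> parabolically_regular theta Xb V.
Proof.
move=> sg thetaE greg VP t H_ H c eps.
apply: (spectral_parabolic_regular (symm_spectral_system R n) thetaE _ greg VP).
move=> x; have [_ [_ [A oA ->] xE]] :=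
  spectral_decomposition (symm_spectral_system R n) (symm_diag R n x).
have := congr1 vsval xE; rewrite val_symm_act !val_symm_diag !rdiag_diag.
move=> /(char_poly_eq_perm oA)[s sE].
have -> : symm_spectrum (symm_diag R n x) = x *m perm_mx s^-1.
  by apply/rowP => j; rewrite row_perm_permE sE.
exact: sg.
Qed.

Lemma rect_parabolically_regular n m (nm : (n <= m)%N) (g : 'rV[R]_n -> \bar R)
    (theta : 'M[R]_(n, m) -> \bar R) Xb V :
  absolutely_symmetric_fun g -> (forall X, theta X = g (singular_values X)) ->
  second_order_regular (epi g) (singular_values Xb, fine (g (singular_values Xb))) ->
  subdifferential theta Xb V -> parabolically_regular theta Xb V.
Proof.
move=> sg thetaE greg VP t H_ H c eps.
apply: (spectral_parabolic_regular (rect_spectral_system R nm) thetaE _ greg VP).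
move=> x; have [[_ y0] [_ [A [B [oA oB ->]]] /= xE]] :=
  spectral_decomposition (rect_spectral_system R nm) (rdiag m x).
rewrite /=; set y := singular_values _ in y0 xE *.
have E : diag_mx (\row_i (x 0 i ^+ 2)) = A *m diag_mx (\row_i (y 0 i ^+ 2)) *m A^T.
  rewrite -!(rdiag_mul_tr nm) {1 2}xE !trmx_mul trmxK -!mulmxA (mulmxA B^T).
  by rewrite (orthogonal_tr oB) mul1mx.
have [s sE] := char_poly_eq_perm oA E.
rewrite (@abs_signed_perm R n x y s) ?sg//.
by move=> i; have := sE i; rewrite !mxE.
Qed.

(** The matrix [X X^T] is the square of [X], so its eigenvalues are the squares of
    those of [X], rearranged. *)
Lemma symm_singular_spectrum n (X : symmx R n) : exists eps s,
  singular_values (vsval X) = symm_spectrum X *m signed_perm_mx R eps s.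
Proof.
have [_ [_ [A oA ->] XE]] := spectral_decomposition (symm_spectral_system R n) X.
set l := symm_spectrum X in XE *.
pose l2 : 'rV[R]_n := \row_i (l 0 i ^+ 2).
pose M := smx (diag_mx l2).
have [_ [_ [B oB ->] ME]] := spectral_decomposition (symm_spectral_system R n) M.
set e := symm_spectrum M in ME *.
have := congr1 vsval ME.
rewrite val_symm_act -[M]/(symm_diag R n l2) !val_symm_diag !rdiag_diag => E2.
have [s sE] := char_poly_eq_perm oB E2.
have ll : diag_mx l *m diag_mx l = diag_mx l2.
  by rewrite mulmx_diag; congr diag_mx; apply/rowP => i; rewrite !mxE expr2.
have XX : vsval X *m (vsval X)^T = A *m diag_mx l2 *m A^T.
  have -> : vsval X = A *m diag_mx l *m A^T.
    by rewrite XE val_symm_act val_symm_diag rdiag_diag.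
  rewrite !trmx_mul trmxK -!mulmxA (mulmxA A^T) (orthogonal_tr oA) mul1mx.
  by rewrite tr_diag_mx (mulmxA (diag_mx l)) ll.
have eE : eigenvalues (vsval X *m (vsval X)^T) = e.
  rewrite XX E2 !mulmxA -mulmxA -trmx_mul eigenvalues_diag//.
    exact: orthogonalM.
  by have [] := spectral_decomposition (symm_spectral_system R n) M.
exists (fun i => l 0 i < 0), s^-1%g; apply: abs_signed_perm => i.
  by rewrite mxE sqrtr_ge0.
rewrite mxE eE sqr_sqrtr; last by rewrite sE mxE sqr_ge0.
by rewrite sE mxE.
Qed.

(** On symmetric matrices an absolutely symmetric function of the singular values
    is the same function of the eigenvalues; the regularity of its epigraph at
    the former passes to the latter along a signed permutation. *)
Lemma spectral_fun_parabolically_regular n (k : spectral_kind n)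
    (g : 'rV[R]_n -> \bar R) (theta : matrix_space R k -> \bar R)
    (Xb V : matrix_space R k) :
  spectral_symmetry k g -> (forall X, theta X = g (spectrum X)) ->
  C2_cone_reducible_fun g (spectrum Xb) -> subdifferential theta Xb V ->
  parabolically_regular theta Xb V.
Proof.
case: k theta Xb V => [m nm||] theta Xb V /= sg thetaE
  /reducible_fun_second_order_regular greg.
- exact: (rect_parabolically_regular nm sg thetaE greg).
- have thetaE' X : theta X = g (symm_spectrum X).
    by rewrite thetaE; have [eps [s ->]] := symm_singular_spectrum X; exact: sg.
  apply: (symm_parabolically_regular (absolutely_symmetric_symmetric sg) thetaE').
  have [eps [s sE]] := symm_singular_spectrum Xb.
  apply: (@second_order_regular_epi_transport R n g (signed_perm_mx R eps s)).
  + exact: orthogonal_signed_perm.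
  + by move=> y; exact: sg.
  + by move: greg; rewrite sE sg.
- exact: (symm_parabolically_regular sg thetaE greg).
Qed.

Lemma matrix_space_bounded_cvg n (k : spectral_kind n) (F : set_system nat)
    (X : nat -> matrix_space R k) (M : R) :
  UltraFilter F -> (forall i, dot (X i) (X i) <= M) ->
  exists Y : matrix_space R k, X @ F --> Y.
Proof.
case: k X => [m nm||] X UF XM.
- exact: (bounded_cvg (rect_spectral_system R nm) UF XM).
- exact: (bounded_cvg (symm_spectral_system R n) UF XM).
- exact: (bounded_cvg (symm_spectral_system R n) UF XM).
Qed.

End Regularity.

(** * Gradients, Hessians and lower limits *)

Section ScalarTaylor.
Variables (R : realType) (d : nat) (f : 'rV[R]_d -> R^o) (D : set 'rV[R]_d)
  (x : 'rV[R]_d).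
Hypotheses (oD : open D) (Dx : D x) (fC2 : C2_on D f).

Lemma dot_grad z v : dot (grad f z) v = 'd f z v.
Proof.
rewrite /dot/= mxdotE big_ord1 (coordinates_diff f z v (row_coordinates R d)).
by apply: eq_bigr => i _; rewrite mxE mulrC.
Qed.

Lemma differentiable_grad : differentiable (grad f) x.
Proof.
have [_ C2] := fC2.
have -> : grad f = \sum_(i < d) (fun z => 'd f z (delta_mx 0 i) *: (delta_mx 0 i : 'rV[R]_d)).
  apply: funext => z; rewrite fct_sumE [LHS]row_sum_delta.
  by apply: eq_bigr => i _; rewrite mxE.
apply: differentiable_sum => i; apply: differentiableZl.
by have [] := C2 (delta_mx 0 i) x Dx.
Qed.

Lemma taylor2_grad_hess (eps : R) : 0 < eps -> \forall y \near 0,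
  `|f (x + y) - f x - dot (grad f x) y - dot y (hess f x y) / 2|
  <= eps * `|y| ^+ 2.
Proof.
move=> e0; have [C1 C2] := fC2.
have nD : \forall z \near x, D z by exact: open_nbhs_nbhs.
have h1 : \forall z \near x, differentiable f z.
  by apply: filterS nD => z Dz; have [] := C1 z Dz.
have h2 i (s : R) v : 'd (grad f) x (s *: v) 0 i = s * 'd (grad f) x v 0 i.
  by rewrite linearZ /= mxE.
have h3 (i : 'I_d) (r : R) : 0 < r -> \forall y \near 0,
    `|'d f (x + y) (delta_mx 0 i) - 'd f x (delta_mx 0 i) -
      'd (grad f) x y 0 i| <= r * `|y|.
  move=> r0; apply: filterS (diff_near differentiable_grad r0) => y.
  by apply: le_trans; apply: le_trans (row_entry_le _ i); rewrite !mxE.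
apply: filterS (taylor2 (row_coordinates R d) h1 h2 h3 e0) => y.
rewrite dot_grad; congr (`|_ - _ / 2| <= _).
by rewrite [RHS]mxdotE big_ord1.
Qed.

End ScalarTaylor.

Section LowerLimits.
Variables (R : realType) (U : choiceType) (T : filteredType U) (F : set_system T).

Lemma limf_einf_le (f : T -> \bar R) (a : \bar R) :
  (forall A, F A -> exists2 z, A z & (f z <= a)%E) -> (limf_einf f F <= a)%E.
Proof.
move=> H; rewrite limf_einfE; apply: ge_ereal_sup => _ [A FA <-].
have [z Az fz] := H A FA; apply: le_trans fz.
by apply: ereal_inf_lbound; exists z.
Qed.

Lemma limf_einf_ge (f : T -> \bar R) (a : \bar R) :
  (\forall z \near F, (a <= f z)%E) -> (a <= limf_einf f F)%E.
Proof.
move=> H; rewrite limf_einfE.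
apply: le_trans (ereal_sup_ubound _); last by exists [set z | (a <= f z)%E].
by apply: le_ereal_inf_tmp => _ [z az <-].
Qed.

End LowerLimits.

Lemma subgradient_epiderivative (R : realType) (E : euclideanType R)
    (p : E -> \bar R) (u V d : E) :
  subdifferential p u V -> ((dot V d)%:E <= epiderivative p u d)%E.
Proof.
move=> [pu VP]; apply/lee_subgt0Pr => eps ep; apply: limf_einf_ge.
exists ([set s : R | 0 < s], [set K : E | dot V d - eps <= dot V K]).
  split; first by exact: nbhs_right_gt.
  have VK : (fun K : E => dot V K) @ nbhs d --> dot V d.
    by apply: cvg_dot; [exact: cvg_cst | exact: cvg_id].
  by apply: (cvgr_ge _ VK); rewrite ltrBlDr ltrDl.
move=> [s K] [/= s0 dK]; rewrite lee_pdivlMr// leeBrDl//.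
apply: le_trans (VP _); rewrite leeD2l// -EFinB -EFinM lee_fin.
have -> : u + s *: K - u = s *: K by lincomb R.
by rewrite dotZr mulrC ler_pM2l.
Qed.

(** * Quadratic growth *)

Section Growth.
Variables (R : realType) (d e : nat) (E : euclideanType R).
Variables (C : E) (b : 'rV[R]_e).
Variables (F : {linear E -> 'rV[R]_d}) (Fadj : {linear 'rV[R]_d -> E}).
Variables (A : {linear E -> 'rV[R]_e}) (Aadj : {linear 'rV[R]_e -> E}).
Variables (h : 'rV[R]_d -> \bar R) (theta : E -> \bar R) (Q : set 'rV[R]_e)
  (Xb : E).
Hypotheses (adjF : is_adjoint F Fadj) (adjA : is_adjoint A Aadj)
  (hproper : proper_fun h) (hconvex : convex_set (epi h))
  (hopen : open (effdom h)) (hC2 : C2_on (effdom h) (fine \o h : _ -> R^o))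
  (thetap : proper_closed_convex theta) (Qpol : polyhedral_cone Q)
  (Xbsol : primal_solutions C b F A h theta Q Xb)
  (bounded_cvgE : forall (U : set_system nat) (X : nat -> E) (M : R),
    UltraFilter U -> (forall i, dot (X i) (X i) <= M) -> exists Y : E, X @ U --> Y)
  (thetareg : forall V, subdifferential theta Xb V ->
    parabolically_regular theta Xb V)
  (Mne : multipliers C b F Fadj A Aadj h theta Q Xb !=set0)
  (sosc : no_gap_SOSC C b F Fadj A Aadj h theta Q Xb).

Let obj := primal_obj C F h theta.
Let feas := primal_feasible b A Q.
Let grd := grad_h F h Xb.
Let G := Fadj grd + C.

(** Continuity of a linear map with an adjoint: each entry of its value is a
    product with a fixed vector. *)
Lemma adjoint_cvg k (L : E -> 'rV[R]_k) (Ladj : 'rV[R]_k -> E)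
    (T : Type) (U : set_system T) (FU : Filter U) (f : T -> E) (X : E) :
  is_adjoint L Ladj -> f @ U --> X -> (fun i => L (f i)) @ U --> L X.
Proof.
move=> adj fX; have LE Y j : L Y 0 j = dot Y (Ladj (delta_mx 0 j)).
  rewrite -adj /dot/= mxdotE big_ord1 (bigD1 j)//= mxE !eqxx mulr1 big1 ?addr0//.
  by move=> l lj; rewrite mxE eqxx (negPf lj) mulr0.
apply: matrix_cvg => i j; rewrite ord1 LE.
under eq_fun do rewrite LE.
by apply: cvg_dot => //; exact: cvg_cst.
Qed.

Lemma obj_fin X : (obj X < +oo)%E ->
  [/\ h (F X) \is a fin_num, theta X \is a fin_num &
   obj X = (fine (h (F X)) + dot C X + fine (theta X))%:E].
Proof.
have [hN _] := hproper; have [[thN _] _ _] := thetap.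
rewrite /obj /primal_obj; have := hN (F X); have := thN X.
case: (h (F X)) => [r||]; case: (theta X) => [s||] //= _ _ H.
Qed.

Lemma Xb_feasible : feas Xb. Proof. by have [] := Xbsol. Qed.

Lemma Xb_fin : [/\ h (F Xb) \is a fin_num, theta Xb \is a fin_num &
   obj Xb = (fine (h (F Xb)) + dot C Xb + fine (theta Xb))%:E].
Proof. by apply: obj_fin; have [] := Xbsol. Qed.

Lemma multiplierP y : multipliers C b F Fadj A Aadj h theta Q Xb y ->
  [/\ subdifferential theta Xb (Aadj y - C - Fadj grd), dual_cone Q y &
      dot y (A Xb - b) = 0].
Proof.
move=> [[V VP VE] [z [yQ zP] zE]].
have -> : Aadj y - C - Fadj grd = V.
  by rewrite -[LHS]addr0 -[X in _ + X]VE /grd; lincomb R.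
split=> //.
have z0 : z = b - A Xb.
  by apply: (addrI (A Xb - b)); rewrite zE; lincomb R.
have H0 : dual_cone Q 0 by move=> w _; rewrite dot0l.
have H2 : dual_cone Q (2 *: y) by move=> w Qw; rewrite dotZl mulr_ge0// yQ.
have := zP _ H0; have := zP _ H2; rewrite z0.
rewrite !(dotBr, dotBl, dotZr, dotZl, dot0r) (dotC (A Xb)) (dotC b); lra.
Qed.

Lemma feasible_dual y X : dual_cone Q y -> dot y (A Xb - b) = 0 -> feas X ->
  0 <= dot y (A (X - Xb)).
Proof.
move=> yQ y0 [z Qz AX].
have -> : A (X - Xb) = z - (A Xb - b).
  by rewrite linearB /= AX; lincomb R.
by rewrite dotBr y0 subr0 yQ.
Qed.

(** Negation of growth: the offending points are normalized, and a subsequence of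
    directions is picked by an ultrafilter. *)
Lemma feasible_sequence :
  (forall r : R, 0 < r -> exists Y, [/\ feas Y, eucl_norm (Y - Xb) <= r &
     ~ (obj Xb + (r * dot (Y - Xb) (Y - Xb))%:E <= obj Y)%E]) ->
  exists (t : nat -> R) (H_ : nat -> E) (H : E),
  [/\ forall i, 0 < t i, t @ \oo --> (0 : R), H_ @ \oo --> H, dot H H = 1 &
    forall i, feas (Xb + t i *: H_ i) /\
      (obj (Xb + t i *: H_ i)%R < obj Xb + (t i ^+ 2 * i.+1%:R^-1)%:E)%E].
Proof.
move=> fail.
have i0 (i : nat) : 0 < i.+1%:R^-1 :> R by rewrite invr_gt0.
have /choice[Y YP] : forall i : nat, exists Y, [/\ feas Y,
    eucl_norm (Y - Xb) <= i.+1%:R^-1 &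
    (obj Y < obj Xb + (i.+1%:R^-1 * dot (Y - Xb) (Y - Xb))%:E)%E].
  move=> i; have [Y [fY nY nob]] := fail _ (i0 i).
  by exists Y; split=> //; rewrite ltNge; apply/negP.
pose t i := eucl_norm (Y i - Xb).
have tt i : t i ^+ 2 = dot (Y i - Xb) (Y i - Xb) by rewrite sqr_sqrtr ?dot_ge0.
have t0 i : 0 < t i.
  rewrite lt0r sqrtr_ge0 andbT; apply/eqP => ti0.
  have /dot_eq0 /subr0_eq YX : dot (Y i - Xb) (Y i - Xb) = 0 by rewrite -tt ti0 expr0n.
  have [_ _] := YP i; rewrite YX subrr dot0l mulr0 adde0 ltxx//.
pose H_ i := (t i)^-1 *: (Y i - Xb).
have H1 i : dot (H_ i) (H_ i) = 1.
  by rewrite dotZl dotZr -tt; field; rewrite gt_eqF.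
have YE i : Y i = Xb + t i *: H_ i.
  by rewrite /H_; lincomb_coefs R; field; rewrite gt_eqF.
have [U [UU oU]] := @ultraFilterLemma nat \oo _.
have PU : ProperFilter U := @ultra_proper _ U UU.
have [|H HH] := @bounded_cvgE U H_ 1 UU; first by move=> i; rewrite H1.
have /choice[k kP] : forall i : nat, exists k : nat, (i <= k)%N /\
    `|H - H_ k| <= i.+1%:R^-1.
  move=> i; have : \forall k \near U, (i <= k)%N /\ `|H - H_ k| <= i.+1%:R^-1.
    apply: filterI; first by apply: oU; exact: nbhs_infty_ge.
    by move/cvgrPdist_le: HH; apply.
  by move=> /(@filter_ex _ U PU)[k kP]; exists k.
have kle i : (k i).+1%:R^-1 <= i.+1%:R^-1 :> R.
  by rewrite lef_pV2 ?posrE ?ltr0n// ler_nat ltnS; have [] := kP i.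
have harm := @cvg_harmonic R.
exists (t \o k), (H_ \o k), H; split=> [i|||//|i] /=.
- exact: t0.
- apply: (squeeze_cvgr _ (cvg_cst 0) harm); apply: nearW => i /=.
  by rewrite ltW//=; apply: le_trans (kle i); have [] := YP (k i).
- apply/cvgrPdist_le => eps ep; move/cvgrPdist_le: harm => /(_ _ ep).
  apply: filterS => i; rewrite sub0r normrN => /(le_trans (ler_norm _)).
  by apply: le_trans; have [] := kP i.
- have := cvg_dot HH HH; have -> : (fun i => dot (H_ i) (H_ i)) = fun=> 1.
    by apply: funext => i; rewrite H1.
  move=> /(_ _) c; have c1 : (fun=> 1 : R) @ U --> (1 : R) by exact: cvg_cst.
  exact: (cvg_unique _ c c1).
- rewrite -YE; have [fY _ oY] := YP (k i); split=> //.
  apply: lt_le_trans oY _; have [_ _ ->] := Xb_fin.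
  rewrite -!EFinD lee_fin lerD2l -tt mulrC ler_wpM2l ?sqr_ge0//.
Qed.

Section Sequence.
Variables (t : nat -> R) (H_ : nat -> E) (H : E).
Hypotheses (t0 : forall i, 0 < t i) (tc : t @ \oo --> (0 : R))
  (Hc : H_ @ \oo --> H)
  (feasi : forall i, feas (Xb + t i *: H_ i))
  (obji : forall i,
    (obj (Xb + t i *: H_ i)%R < obj Xb + (t i ^+ 2 * i.+1%:R^-1)%:E)%E).

Let X i := Xb + t i *: H_ i.

Let Xc : X @ \oo --> Xb.
Proof.
rewrite -[Xb in _ --> Xb]addr0 -(scale0r H).
by apply: cvgD; [exact: cvg_cst | exact: cvgZ].
Qed.

Let q := dot (F H) (hess_h F h Xb (F H)).

(** The failure of growth bounds the sum of [h] and [theta] from above; Taylor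
    expansion of [h] leaves the bound on [theta].  The slack of size 8 [eps]
    between [q] and [r] pays for the Taylor remainder, for the continuity of the
    Hessian form and for [1/(i+1)]. *)
Lemma theta_upper (r : R) : r < q -> \forall i \near \oo,
  (theta (X i) <= theta Xb + (- (t i * dot G (H_ i)) - t i ^+ 2 / 2 * r)%:E)%E.
Proof.
move=> rq; pose f : 'rV[R]_d -> R^o := fine \o h.
have FXb : effdom h (F Xb).
  by have [hf _ _] := Xb_fin; rewrite /effdom/= ltey_eq hf.
pose M := `|F H| + 1.
have M0 : 0 < M by rewrite ltr_wpDl.
pose eps := (q - r) / 8.
have ep : 0 < eps by rewrite divr_gt0// subr_gt0.
have eM : 0 < eps / M ^+ 2 by rewrite divr_gt0// exprn_gt0.
have FHc : (fun i => F (H_ i)) @ \oo --> F H by exact: (adjoint_cvg _ adjF).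
have tFH : (fun i => t i *: F (H_ i)) @ \oo --> (0 : 'rV[R]_d).
  by rewrite -(scale0r (F H)); exact: cvgZ.
have T := tFH _ (taylor2_grad_hess hopen FXb hC2 eM).
have nM : \forall i \near \oo, `|F (H_ i)| <= M.
  have : \forall i \near \oo, `|F H - F (H_ i)| <= 1.
    by move/cvgrPdist_le: FHc; apply.
  apply: filterS => i zi; rewrite -(subrK (F H) (F (H_ i))) addrC.
  by apply: le_trans (ler_normD _ _) _; rewrite lerD2l distrC.
have qc : (fun i => dot (F (H_ i)) (hess f (F Xb) (F (H_ i)))) @ \oo --> q.
  apply: cvg_dot => //; apply: (@continuous_cvg _ _ _ _ _ _ (hess f (F Xb))) => //.
  exact: (diff_continuous (differentiable_grad FXb hC2)).
have nq : \forall i \near \oo, q - eps <= dot (F (H_ i)) (hess f (F Xb) (F (H_ i))).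
  move/cvgrPdist_le: qc => /(_ _ ep); apply: filterS => i.
  by move=> /(le_trans (ler_norm _)); lra.
have nh : \forall i \near \oo, i.+1%:R^-1 <= eps :> R.
  have harm := @cvg_harmonic R.
  move/cvgrPdist_le: harm => /(_ _ ep); apply: filterS => i.
  by rewrite sub0r normrN => /(le_trans (ler_norm _)).
move: T; rewrite /nbhs/= => T.
near=> i.
have Ti : `|f (F Xb + t i *: F (H_ i)) - f (F Xb) - dot (grad f (F Xb)) (t i *: F (H_ i))
    - dot (t i *: F (H_ i)) (hess f (F Xb) (t i *: F (H_ i))) / 2|
    <= eps / M ^+ 2 * `|t i *: F (H_ i)| ^+ 2 by near: i.
have nMi : `|F (H_ i)| <= M by near: i.
have nqi : q - eps <= dot (F (H_ i)) (hess f (F Xb) (F (H_ i))) by near: i.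
have nhi : i.+1%:R^-1 <= eps by near: i.
have ti := t0 i.
have [_ thb objb] := Xb_fin.
have objX : (obj (X i) < +oo)%E by apply: lt_trans (obji i) _; rewrite objb -EFinD ltry.
have [_ thi objE] := obj_fin objX.
have := obji i; rewrite -/(X i) objE objb -EFinD lte_fin => o.
have FX : F (X i) = F Xb + t i *: F (H_ i) by rewrite /X linearD linearZ.
have Dh : dot (grad f (F Xb)) (t i *: F (H_ i)) = t i * dot (Fadj grd) (H_ i).
  by rewrite dotZr dotC adjF dotC.
have Hz : hess f (F Xb) (t i *: F (H_ i)) = t i *: hess f (F Xb) (F (H_ i)).
  by rewrite /hess linearZ.
move: Ti; rewrite Dh Hz dotZl dotZr normrZ exprMn (gtr0_norm ti) => Ti.
have rem : eps / M ^+ 2 * (t i ^+ 2 * `|F (H_ i)| ^+ 2) <= eps * t i ^+ 2.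
  rewrite [t i ^+ 2 * _]mulrC mulrA ler_wpM2r ?sqr_ge0//.
  rewrite mulrAC ler_pdivrMr ?exprn_gt0// ler_pM2l//.
  by rewrite lerXn2r ?nnegrE// ltW.
have {}Ti : - (eps * t i ^+ 2) <= f (F Xb + t i *: F (H_ i)) - f (F Xb)
    - t i * dot (Fadj grd) (H_ i)
    - t i * (t i * dot (F (H_ i)) (hess f (F Xb) (F (H_ i)))) / 2.
  have := le_trans Ti rem; rewrite ler_norml => /andP[+ _]; exact.
rewrite -(fineK thi) -(fineK thb) -EFinD lee_fin.
move: o; rewrite FX /= -/(f _) -/(f (F Xb)) /X [dot C (Xb + _)]dotDr dotZr => o.
have t2 : 0 < t i ^+ 2 by rewrite exprn_gt0.
have k1 : t i ^+ 2 * (q - eps) <= t i ^+ 2 * dot (F (H_ i)) (hess f (F Xb) (F (H_ i))).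
  by rewrite ler_pM2l.
have k2 : t i ^+ 2 * i.+1%:R^-1 <= t i ^+ 2 * eps by rewrite ler_pM2l.
have k3 : t i ^+ 2 * r = t i ^+ 2 * (q - 8 * eps).
  by congr (_ * _); rewrite /eps; field.
rewrite /G dotDl.
move: Ti; set hh := dot _ (hess _ _ _) in k1 *.
have -> : t i * (t i * hh) = t i ^+ 2 * hh by ring.
rewrite -/(X i) in o *.
have t2e : 0 < t i ^+ 2 * eps by rewrite mulr_gt0.
have -> : t i ^+ 2 / 2 * r = (t i ^+ 2 * r) / 2 by ring.
have fE z : f z = fine (h z) by [].
rewrite k3 !fE => Ti.
move: o k1 k2 t2e Ti; rewrite !mulrBr !mulrDr.
move: (fine _) (fine _) (fine _) (fine _) (dot _ _) (dot _ _) (dot _ _) => a1 a2 a3 a4 a5 a6 a7.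
move: (t i ^+ 2 / _) (t i ^+ 2 * q) => a8 a9.
lra.
Unshelve. all: by end_near. Qed.

Lemma sequence_fin i : theta (X i) \is a fin_num.
Proof.
have [_ _ objb] := Xb_fin.
have [|_ //] := @obj_fin (X i).
by apply: lt_trans (obji i) _; rewrite objb -EFinD ltry.
Qed.

Lemma sequence_cvg_prod :
  (fun i => (t i, H_ i)) @ \oo --> filter_prod (0 : R)^'+ (nbhs H).
Proof.
have tp : t @ \oo --> (0 : R)^'+.
  move=> B HB; have T : \forall i \near \oo, 0 < t i -> B (t i) by exact: tc HB.
  by apply: (@filterS _ \oo _ _ _ _ T) => i; exact.
exact: (@cvg_pair _ _ _ \oo (0 : R)^'+ (nbhs H) _ _ _ t H_ tp Hc).
Qed.

Lemma epiderivative_upper : (epiderivative theta Xb H <= (- dot G H)%:E)%E.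
Proof.
have [_ thb _] := Xb_fin.
apply/lee_addgt0Pr => eps ep; apply: limf_einf_le => B HB.
have qq : q - 1 < q by rewrite ltrBlDr ltrDl.
have up := theta_upper qq.
have lim : (fun i => - dot G (H_ i) - t i / 2 * (q - 1)) @ \oo -->
    - dot G H - 0 / 2 * (q - 1).
  apply: cvgB; first by apply: cvgN; apply: cvg_dot => //; exact: cvg_cst.
  by apply: cvgMr_tmp; apply: cvgMr_tmp.
have nlim : \forall i \near \oo,
    - dot G (H_ i) - t i / 2 * (q - 1) <= - dot G H + eps.
  by apply: (cvgr_le _ lim); rewrite !mul0r subr0 ltrDl.
have BX : \forall i \near \oo, B (t i, H_ i) by exact: sequence_cvg_prod HB.
near \oo => i.
have Bi : B (t i, H_ i) by near: i.
have upi : (theta (X i) <= theta Xb +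
    (- (t i * dot G (H_ i)) - t i ^+ 2 / 2 * (q - 1))%:E)%E by near: i.
have li : - dot G (H_ i) - t i / 2 * (q - 1) <= - dot G H + eps by near: i.
exists (t i, H_ i) => //=; rewrite lee_pdivrMr// leeBlDl//.
apply: le_trans upi _; rewrite leeD2l// -EFinD -EFinM lee_fin.
by move: li; rewrite -(ler_pM2l (t0 i)); lra.
Unshelve. all: by end_near. Qed.

(** On feasible directions [<V, .>] exceeds [- <G, .>] by [<y, A .>], which is
    nonnegative.  The epiderivative lies between [<V, H>], as [V] is a
    subgradient, and [- <G, H>], by the upper bound along the sequence, so the
    three coincide. *)
Lemma multiplier_critical y : multipliers C b F Fadj A Aadj h theta Q Xb y ->
  let V := Aadj y - C - Fadj grd in
  [/\ subdifferential theta Xb V, epiderivative theta Xb H = (dot V H)%:E,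
      dot V H = - dot G H & forall i, - dot G (H_ i) <= dot V (H_ i)].
Proof.
move=> /multiplierP[VP yQ y0] V.
have VE Y : dot V Y = dot y (A Y) - dot G Y.
  have -> : V = Aadj y - G by rewrite /V /G; lincomb R.
  by rewrite dotBl (dotC (Aadj y)) -adjA dotC.
have yi i : 0 <= dot y (A (H_ i)).
  have := feasible_dual yQ y0 (feasi i).
  have -> : Xb + t i *: H_ i - Xb = t i *: H_ i by lincomb R.
  by rewrite linearZ /= dotZr pmulr_rge0.
have yH : 0 <= dot y (A H).
  have AH : (fun i => A (H_ i)) @ \oo --> A H by exact: (adjoint_cvg _ adjA).
  have c : (fun i => dot y (A (H_ i))) @ \oo --> dot y (A H).
    by apply: cvg_dot => //; exact: cvg_cst.
  by apply: (cvgr_to_ge c); apply: nearW.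
have lo := subgradient_epiderivative H VP.
have up := epiderivative_upper.
have VH : dot V H = - dot G H.
  apply/eqP; rewrite eq_le; apply/andP; split.
    by rewrite -lee_fin; apply: le_trans lo up.
  by rewrite VE; lra.
split=> // [|i]; last by rewrite VE; have := yi i; lra.
by apply/eqP; rewrite eq_le lo VH up.
Qed.

Lemma limit_critical : critical_cone C b F Fadj A h theta Q Xb H.
Proof.
have [y yM] := Mne.
have [_ epiH VH _] := multiplier_critical yM.
have sub i : (t i)^-1 *: (X i - Xb) = H_ i.
  by rewrite /X; lincomb_coefs R; field; rewrite gt_eqF.
split.
- exists (fun i => A (X i) - b), t; split=> // [i||].
  + by have [z Qz ->] := feasi i; rewrite addrC addKr.
  + by apply: cvgB; [exact: (adjoint_cvg _ adjA Xc) | exact: cvg_cst].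
  + have -> : (fun i => (t i)^-1 *: (A (X i) - b - (A Xb - b))) = fun i => A (H_ i).
      apply: funext => i; rewrite -[in RHS]sub.
      have AB u v : A (u - v) = A u - A v by exact: linearB.
      have AZ a v : A (a *: v) = a *: A v by exact: linearZ.
      by rewrite AZ AB; lincomb R.
    exact: (adjoint_cvg _ adjA).
- exists X, t; split=> // [i|].
    by rewrite /effdom/= ltey_eq sequence_fin.
  by rewrite (_ : (fun i => _) = H_)//; apply: funext.
- by rewrite epiH VH -EFinD subrr.
Qed.

(** Parabolic regularity applied to the sequence with [c = eps - q] gives [W] such
    that the second-order epiderivative at [W] is at most [<V, W> - q] up to
    [2 eps]; the conjugate at [V] is at least the difference with [<V, W>]. *)
Lemma conjugate_ge y : multipliers C b F Fadj A Aadj h theta Q Xb y ->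
  (q%:E <= conjugate (epiderivative2 theta Xb H) (Aadj y - C - Fadj grd)%R)%E.
Proof.
move=> yM; have [VP epiH VH VHi] := multiplier_critical yM.
set V := Aadj y - C - Fadj grd in VP epiH VH VHi *.
have [thb _] := VP.
apply/lee_subgt0Pr => e0 e0p.
pose eps := e0 / 2; have ep : 0 < eps by rewrite divr_gt0.
have rq : q - eps < q by rewrite ltrBlDr ltrDl.
have up : \forall i \near \oo, (theta (Xb + t i *: H_ i)%R <=
    theta Xb + (dot V (t i *: H_ i) + t i ^+ 2 / 2 * (eps - q))%:E)%E.
  apply: filterS (theta_upper rq) => i /le_trans; apply.
  rewrite leeD2l// lee_fin dotZr; have := VHi i.
  rewrite -(ler_pM2l (t0 i)); lra.
have [W WP] := thetareg VP t0 tc Hc up ep.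
have epi2 : (epiderivative2 theta Xb H W <= (dot V W + (eps - q) + eps)%:E)%E.
  apply: limf_einf_le => B [[B1 B2] /= [HB1 HB2] BB].
  have [dl dl0 dlP] : exists2 dl : R, 0 < dl & forall W', `|W' - W| <= dl -> B2 W'.
    have [dl /= dl0 dlP] : nbhs_ball W B2 by rewrite nbhs_ballE.
    exists (dl / 2) => [|W' Wd]; first by rewrite divr_gt0.
    apply: dlP; rewrite -ball_normE /= distrC; apply: le_lt_trans Wd _.
    by rewrite ltr_pdivrMr// ltr_pMr// ltr1n.
  have [s [[s0 B1s] [W' W'd thW']]] :=
    filter_ex (filterI (filterI (nbhs_right_gt 0) HB1) (WP dl dl0)).
  exists (s, W'); first by apply: BB; split=> //=; exact: dlP.
  have s2 : 0 < s ^+ 2 / 2 by rewrite divr_gt0 ?exprn_gt0.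
  rewrite /= lee_pdivrMr// epiH -EFinM leeBlDl// leeBlDl//.
  apply: le_trans thW' _; rewrite leeD2l// -EFinM -EFinD lee_fin.
  by rewrite [_ * (s ^+ 2 / 2)]mulrC.
apply: le_trans (ereal_sup_ubound _); last by exists W.
rewrite [dot W V]dotC; apply: le_trans (leeB _ epi2); last exact: lexx.
by rewrite -EFinB -EFinB lee_fin /eps; lra.
Qed.

Lemma sequence_absurd : dot H H = 1 -> False.
Proof.
move=> HH; have H0 : H <> 0.
  by move=> H0; move: HH; rewrite H0 dot0l => /eqP; rewrite eq_sym oner_eq0.
have := sosc limit_critical H0; rewrite ltNge => /negP; apply.
apply: ge_ereal_sup => _ [y yM <-]; have := conjugate_ge yM.
rewrite /= -/q -/grd; case: (conjugate _ _) => [c||] //=; last by rewrite addeNy leNye.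
by rewrite !lee_fin subr_le0.
Qed.

End Sequence.

(** Otherwise [conjugate_ge] contradicts the second-order condition at the limit
    direction, whichever multiplier is used. *)
Lemma local_growth : exists2 r : R, 0 < r & forall Y, feas Y ->
  eucl_norm (Y - Xb) <= r ->
  (obj Xb + (r * dot (Y - Xb) (Y - Xb))%:E <= obj Y)%E.
Proof.
apply: contrapT => no.
have [|t [H_ [H [t0 tc Hc HH fo]]]] := feasible_sequence.
  move=> r r0; apply: contrapT => nY; apply: no; exists r => // Y fY nYr.
  by apply: contrapT => nob; apply: nY; exists Y.
exact: (sequence_absurd t0 tc Hc (fun i => (fo i).1) (fun i => (fo i).2) HH).
Qed.

Lemma feasible_convex X Y s : feas X -> feas Y -> 0 <= s <= 1 ->
  feas (s *: X + (1 - s) *: Y).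
Proof.
move=> [z Qz AX] [w Qw AY] /andP[s0 s1].
have [k [B QE]] := Qpol; rewrite QE in Qz Qw.
exists (s *: z + (1 - s) *: w).
  rewrite QE => j /=; rewrite mulmxDl -!scalemxAl !mxE.
  by rewrite addr_ge0// mulr_ge0 ?subr_ge0//; [have := Qz j|have := Qw j]; rewrite !mxE.
have AD u v : A (u + v) = A u + A v by exact: linearD.
have AZ a v : A (a *: v) = a *: A v by exact: linearZ.
by rewrite AD !AZ AX AY; lincomb R.
Qed.

Lemma epi_convex (V : normedModType R) (p : V -> \bar R) (x y : V) s :
  convex_set (epi p) -> p x \is a fin_num -> p y \is a fin_num -> 0 <= s <= 1 ->
  (p (s *: x + (1 - s) *: y)%R <= (s * fine (p x) + (1 - s) * fine (p y))%:E)%E.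
Proof.
move=> cp px py s01.
have ex : epi p (x, fine (p x)) by rewrite /epi/= fineK.
have ey : epi p (y, fine (p y)) by rewrite /epi/= fineK.
exact: (@convex_setE _ _ _ _ _ s cp ex ey s01).
Qed.

(** The segment from [Xb] to another solution consists of solutions by convexity,
    which contradicts growth near [Xb]. *)
Lemma solution_unique : primal_solutions C b F A h theta Q = [set Xb].
Proof.
apply/seteqP; split=> [X'|_ ->] //= [fX' oX' minX'].
have [r r0 growth] := local_growth.
have [hX' thX' objX'] := obj_fin oX'.
have [hXb thXb objXb] := Xb_fin.
have fXb := Xb_feasible.
have le : fine (h (F X')) + dot C X' + fine (theta X')
    <= fine (h (F Xb)) + dot C Xb + fine (theta Xb).
  by rewrite -lee_fin -objXb -objX'; exact: minX'.
pose s := Num.min 1 (r / (eucl_norm (X' - Xb) + 1)).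
have nn : 0 <= eucl_norm (X' - Xb) by exact: sqrtr_ge0.
have n1 : 0 < eucl_norm (X' - Xb) + 1 by rewrite ltr_wpDl.
have s0 : 0 < s by rewrite lt_min ltr01 divr_gt0.
have s01 : 0 <= s <= 1 by rewrite ltW//= ge_min lexx.
pose Y := s *: X' + (1 - s) *: Xb.
have YXb : Y - Xb = s *: (X' - Xb) by rewrite /Y; lincomb R.
have nY : eucl_norm (Y - Xb) <= r.
  rewrite YXb /eucl_norm dotZl dotZr mulrA -expr2 sqrtrM ?sqr_ge0//.
  rewrite sqrtr_sqr gtr0_norm// -/(eucl_norm _).
  apply: (@le_trans _ _ (r / (eucl_norm (X' - Xb) + 1) * eucl_norm (X' - Xb))).
    by rewrite ler_wpM2r// ge_min lexx orbT.
  by rewrite mulrAC ler_pdivrMr// ler_pM2l// lerDl.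
have fY : feas Y by exact: feasible_convex.
have [_ _ thc] := thetap.
have hY : (h (F Y) <= (s * fine (h (F X')) + (1 - s) * fine (h (F Xb)))%:E)%E.
  have -> : F Y = s *: F X' + (1 - s) *: F Xb by rewrite /Y linearD !linearZ.
  exact: epi_convex.
have thY := epi_convex thc thX' thXb s01.
have oY : (obj Y <= (fine (h (F Xb)) + dot C Xb + fine (theta Xb))%:E)%E.
  apply: (@le_trans _ _ ((s * fine (h (F X')) + (1 - s) * fine (h (F Xb)))%:E +
      (s * dot C X' + (1 - s) * dot C Xb)%:E +
      (s * fine (theta X') + (1 - s) * fine (theta Xb))%:E)%E).
    by rewrite leeD// leeD//= /Y dotDr !dotZr lexx.
  rewrite -!EFinD lee_fin.
  have conv (u v : R) : u <= v -> s * u + (1 - s) * v <= v.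
    by rewrite -(ler_pM2l s0) mulrBl mul1r addrCA gerDl subr_le0.
  apply: le_trans (conv _ _ le); rewrite le_eqVlt; apply/predU1P; left.
  by clear; ring.
have := le_trans (growth Y fY nY) oY; rewrite objXb -EFinD lee_fin.
rewrite YXb dotZl dotZr gerDl => le0.
have /dot_eq0 /subr0_eq // : dot (X' - Xb) (X' - Xb) = 0.
apply/eqP; rewrite eq_le dot_ge0 andbT.
by move: le0; rewrite !pmulr_rle0.
Qed.

Lemma unique_solution_growth : primal_solutions C b F A h theta Q = [set Xb] /\
  quadratic_growth C b F A h theta Q Xb.
Proof.
split; first exact: solution_unique.
have [r r0 growth] := local_growth.
exists r, r; split=> // Y fY nY; rewrite solution_unique.
by rewrite /eucl_dist image_set1 inf1 sqr_sqrtr ?dot_ge0//; exact: growth.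
Qed.

End Growth.

Theorem theorem12 (R : realType) (n d e : nat) (k : spectral_kind n)
  (C : matrix_space R k) (b : 'rV[R]_e)
  (F : {linear matrix_space R k -> 'rV[R]_d})
  (Fadj : {linear 'rV[R]_d -> matrix_space R k})
  (A : {linear matrix_space R k -> 'rV[R]_e})
  (Aadj : {linear 'rV[R]_e -> matrix_space R k})
  (h : 'rV[R]_d -> \bar R) (theta : matrix_space R k -> \bar R)
  (g : 'rV[R]_n -> \bar R) (Q : set 'rV[R]_e) (Xbar : matrix_space R k) :
  (* standing assumptions *)
  is_adjoint F Fadj -> is_adjoint A Aadj ->
  proper_fun h -> convex_set (epi h) ->
  open (effdom h) -> C1_on (effdom h) (fine \o h : _ -> R^o) ->
  proper_closed_convex theta ->
  polyhedral_cone Q ->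
  primal_solutions C b F A h theta Q !=set0 ->
  dual_solutions C b Fadj Aadj h theta Q !=set0 ->
  (* theta is a spectral function *)
  proper_closed_convex g -> spectral_symmetry k g ->
  (forall X, theta X = g (spectrum X)) ->
  (* assumptions on the optimal solution *)
  primal_solutions C b F A h theta Q Xbar ->
  multipliers C b F Fadj A Aadj h theta Q Xbar !=set0 ->
  C2_on (effdom h) (fine \o h : _ -> R^o) ->
  C2_cone_reducible_fun g (spectrum Xbar) ->
  no_gap_SOSC C b F Fadj A Aadj h theta Q Xbar ->
  primal_solutions C b F A h theta Q = [set Xbar] /\
  quadratic_growth C b F A h theta Q Xbar.
Proof.
move=> adjF adjA hproper hconvex hopen _ thetap Qpol _ _ _ gsym thetaE sol Mne
  hC2 gred sosc.
apply: unique_solution_growth => //.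
- by move=> U X M UU; exact: matrix_space_bounded_cvg.
- by move=> V; exact: spectral_fun_parabolically_regular gsym thetaE gred.
Qed.
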